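(* Let $n=2$ and let $R_0\ne R_T$ be two positive real numbers. The $\mathcal{S}$-optimal spherical trajectory connecting the two concentric spheres of radii $R_0$ and $R_T$ over the time interval $[0,T]$ is a local minimizer of $\mathcal{S}$ if $T\ge\frac13\sqrt3\,T_{MCF}$, where $T_{MCF}=\frac{|R_0^2-R_T^2|}{4}$. Furthermore, there exists $0<T_1\le\frac13\sqrt3\,T_{MCF}$ such that for $0<T<T_1$ the $\mathcal{S}$-optimal spherical trajectory connecting the given data is not a local minimizer of $\mathcal{S}$.
   Context: For a smooth family of embeddings $\phi_t=\phi(\cdot,t):S^2\to\mathbb{R}^3$, $t\in[0,T]$, let $\bar\mu_t$ be the induced area measure on $S^2$, $\nu$ the inner unit normal, $v=\partial_t\phi\cdot\nu$ the scalar normal velocity and $H$ the scalar mean curvature (sum of principal curvatures). The action functional is $\mathcal{S}(\phi)=\int_0^T\int_{S^2}(v^2+H^2)\,d\bar\mu_t\,dt$. A spherical trajectory connecting the concentric spheres of radii $R_0$ and $R_T$ is a map $\phi_0(x,t)=r_0(t)x$, $x\in S^2$, with $r_0:[0,T]\to(0,\infty)$ smooth, $r_0(0)=R_0$, $r_0(T)=R_T$. The $\mathcal{S}$-optimal spherical trajectory is the unique minimizer of $\mathcal{S}$ in the class of spherical trajectories; it is given by $r_0(t)=\sqrt{R_0^2+\frac{R_T^2-R_0^2}{T}\,t}$. Competitors near a spherical trajectory are described as graphs over spheres: $\phi_\varepsilon(x,t)=(r_0(t)+\varepsilon\rho(x,t))x$ with $\rho:S^2\times[0,T]\to\mathbb{R}$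 smooth and $\rho(\cdot,0)=\rho(\cdot,T)=0$. Local minimality refers to these variations: $\phi_0$ is a local minimizer of $\mathcal{S}$ if for every such $\rho$ one has $\mathcal{S}(\phi_\varepsilon)\ge\mathcal{S}(\phi_0)$ for all sufficiently small $|\varepsilon|$, and it is not a local minimizer if this fails for some $\rho$. *)

(* Defs.v *)
From Stdlib Require Import Reals.
From Coquelicot Require Import Coquelicot.
Open Scope R_scope.

Definition V3 : Type := (R * R * R)%type.

Definition dot (u v : V3) : R :=
  let '(u1, u2, u3) := u in
  let '(v1, v2, v3) := v in
  u1 * v1 + u2 * v2 + u3 * v3.

Definition cross (u v : V3) : V3 :=
  let '(u1, u2, u3) := u in
  let '(v1, v2, v3) := v in
  (u2 * v3 - u3 * v2, u3 * v1 - u1 * v3, u1 * v2 - u2 * v1).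

Definition scale3 (a : R) (u : V3) : V3 :=
  let '(u1, u2, u3) := u in (a * u1, a * u2, a * u3).

Definition norm3 (u : V3) : R := sqrt (dot u u).

Definition Derive3 (f : R -> V3) (s : R) : V3 :=
  (Derive (fun a => fst (fst (f a))) s,
   Derive (fun a => snd (fst (f a))) s,
   Derive (fun a => snd (f a)) s).

Definition on_S2 (x : V3) : Prop := dot x x = 1.

(* A smooth function on the closed set [0,T], resp. S^2 x [0,T], is the
   restriction of a C^oo function on an open neighbourhood of [0,T], resp. on
   R^3 x R.  Values of the functions outside these sets are irrelevant everywhere
   below: [action] only sees the interior of the time interval and points of S^2. *)

Definition smooth_on_interval (T : R) (r : R -> R) : Prop :=
  exists (delta : R) (g : R -> R),
    0 < delta /\
    (forall (n : nat) (t : R), - delta < t < T + delta -> ex_derive_n g n t) /\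
    (forall t, 0 <= t <= T -> r t = g t).

(* C^k on R^4, through iterated partial derivatives. *)
Fixpoint Ck4 (k : nat) (f : R -> R -> R -> R -> R) : Prop :=
  match k with
  | O => forall p : R * R * R * R,
      continuous (fun q : R * R * R * R =>
        let '(x, y, z, t) := q in f x y z t) p
  | S k' =>
      (forall x y z t,
         ex_derive (fun s => f s y z t) x /\
         ex_derive (fun s => f x s z t) y /\
         ex_derive (fun s => f x y s t) z /\
         ex_derive (fun s => f x y z s) t) /\
      Ck4 k' (fun x y z t => Derive (fun s => f s y z t) x) /\
      Ck4 k' (fun x y z t => Derive (fun s => f x s z t) y) /\
      Ck4 k' (fun x y z t => Derive (fun s => f x y s t) z) /\
      Ck4 k' (fun x y z t => Derive (fun s => f x y z s) t)
  end.

Definition smooth_on_S2_interval (T : R) (rho : V3 -> R -> R) : Prop :=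
  exists g : R -> R -> R -> R -> R,
    (forall k : nat, Ck4 k g) /\
    (forall x y z t, on_S2 (x, y, z) -> 0 <= t <= T ->
       rho (x, y, z) t = g x y z t).

(* Spherical coordinates, theta in (0,PI), psi in (0,2*PI): a parametrization of
   S^2 up to a null set, with X_theta x X_psi = (sin theta) X pointing outwards. *)
Definition sph (theta psi : R) : V3 :=
  (sin theta * cos psi, sin theta * sin psi, cos theta).

Definition chart (phi : V3 -> R -> V3) (theta psi t : R) : V3 := phi (sph theta psi) t.

Definition d_th (phi : V3 -> R -> V3) (theta psi t : R) : V3 :=
  Derive3 (fun a => chart phi a psi t) theta.
Definition d_ps (phi : V3 -> R -> V3) (theta psi t : R) : V3 :=
  Derive3 (fun a => chart phi theta a t) psi.
Definition d_t (phi : V3 -> R -> V3) (theta psi t : R) : V3 :=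
  Derive3 (fun a => chart phi theta psi a) t.

Definition d_thth (phi : V3 -> R -> V3) (theta psi t : R) : V3 :=
  Derive3 (fun a => d_th phi a psi t) theta.
Definition d_thps (phi : V3 -> R -> V3) (theta psi t : R) : V3 :=
  Derive3 (fun a => d_th phi theta a t) psi.
Definition d_psps (phi : V3 -> R -> V3) (theta psi t : R) : V3 :=
  Derive3 (fun a => d_ps phi theta a t) psi.

Definition g11 (phi : V3 -> R -> V3) (theta psi t : R) : R :=
  dot (d_th phi theta psi t) (d_th phi theta psi t).
Definition g12 (phi : V3 -> R -> V3) (theta psi t : R) : R :=
  dot (d_th phi theta psi t) (d_ps phi theta psi t).
Definition g22 (phi : V3 -> R -> V3) (theta psi t : R) : R :=
  dot (d_ps phi theta psi t) (d_ps phi theta psi t).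
Definition detg (phi : V3 -> R -> V3) (theta psi t : R) : R :=
  g11 phi theta psi t * g22 phi theta psi t - (g12 phi theta psi t) ^ 2.

(* The inner unit normal for embeddings which, like every radial graph with
   positive radius, induce the outward orientation.  For the other embeddings
   this is the outer normal; its sign cancels in [action]. *)
Definition normal (phi : V3 -> R -> V3) (theta psi t : R) : V3 :=
  let n := cross (d_th phi theta psi t) (d_ps phi theta psi t) in
  scale3 (- / norm3 n) n.

Definition h11 (phi : V3 -> R -> V3) (theta psi t : R) : R :=
  dot (d_thth phi theta psi t) (normal phi theta psi t).
Definition h12 (phi : V3 -> R -> V3) (theta psi t : R) : R :=
  dot (d_thps phi theta psi t) (normal phi theta psi t).
Definition h22 (phi : V3 -> R -> V3) (theta psi t : R) : R :=
  dot (d_psps phi theta psi t) (normal phi theta psi t).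

(* H = g^{ij} h_{ij}, which is 2/r on the round sphere of radius r. *)
Definition mean_curvature (phi : V3 -> R -> V3) (theta psi t : R) : R :=
  (g22 phi theta psi t * h11 phi theta psi t
   - 2 * g12 phi theta psi t * h12 phi theta psi t
   + g11 phi theta psi t * h22 phi theta psi t) / detg phi theta psi t.

Definition normal_velocity (phi : V3 -> R -> V3) (theta psi t : R) : R :=
  dot (d_t phi theta psi t) (normal phi theta psi t).

Definition area_integral (phi : V3 -> R -> V3) (f : R -> R -> R -> R) (t : R) : R :=
  RInt (fun theta =>
    RInt (fun psi => f theta psi t * sqrt (detg phi theta psi t)) 0 (2 * PI)) 0 PI.

Definition action (phi : V3 -> R -> V3) (T : R) : R :=
  RInt (area_integral phi (fun theta psi t =>
    (normal_velocity phi theta psi t) ^ 2 + (mean_curvature phi theta psi t) ^ 2)) 0 T.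

Definition radial_graph (r : V3 -> R -> R) : V3 -> R -> V3 :=
  fun x t => scale3 (r x t) x.

Definition spherical (r : R -> R) : V3 -> R -> V3 :=
  radial_graph (fun _ t => r t).

Definition spherical_trajectory (R0 RT T : R) (r : R -> R) : Prop :=
  smooth_on_interval T r /\
  (forall t, 0 <= t <= T -> 0 < r t) /\
  r 0 = R0 /\ r T = RT.

Definition optimal_spherical_trajectory (R0 RT T : R) (r0 : R -> R) : Prop :=
  spherical_trajectory R0 RT T r0 /\
  forall r, spherical_trajectory R0 RT T r ->
    action (spherical r0) T <= action (spherical r) T.

Definition admissible_variation (T : R) (rho : V3 -> R -> R) : Prop :=
  smooth_on_S2_interval T rho /\
  (forall x, on_S2 x -> rho x 0 = 0 /\ rho x T = 0).

Definition local_minimizer (T : R) (r0 : R -> R) : Prop :=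
  forall rho, admissible_variation T rho ->
    exists eps0, 0 < eps0 /\
      forall eps, Rabs eps < eps0 ->
        action (spherical r0) T <=
        action (radial_graph (fun x t => r0 t + eps * rho x t)) T.

Definition T_MCF (R0 RT : R) : R := Rabs (R0 ^ 2 - RT ^ 2) / 4.

(* Main.v *)
Require Import Defs.
From Stdlib Require Import Reals Lra Lia FunctionalExtensionality IndefiniteDescription.
From Coquelicot Require Import Coquelicot.
Open Scope R_scope.

(** On a radial graph of radius [r] over the sphere, the integrand of the action is explicit in [r], its
    gradient and its Hessian.  Expanding it at [r0 + eps rho], where [r0^2] is affine in time with slope
    [c], and integrating by parts, the first order term vanishes and the second order one is
      [int int r0^2 rho_t^2 + ((c^2/4) rho^2 + (Lap rho)^2 - (2 + c^2/8) |grad rho|^2) / r0^2].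
    On the eigenspaces of minus the Laplacian the numerator is [(lambda - 2) (lambda - c^2/8) rho^2],
    which is nonnegative for the eigenvalues 0, 2, 6, 12, ... as soon as [c^2 <= 48], that is
    [T >= T_MCF / sqrt 3]; the remaining term is positive unless [rho = 0], also for equality.
    The spectral information is obtained without spherical harmonics: the zonal kernels
    [K_n = (n+1)/(4 pi) ((1 + x.y)/2)^n] are positive definite, converge to the identity, and satisfy
    [- Lap K_n = n (n+1) (K_n - K_(n-1))], which gives [lambda >= 6] on the orthogonal complement of
    1, x_1, x_2, x_3 by induction on [n].
    For small [T] the slope [c] is large, and [rho = t (T - t) x_3^m] with [m] large, depending
    only on the radii, makes the second variation negative. *)

(** * Continuity and integrals depending on a parameter *)

(** Spherical coordinates degenerate at the poles, so a function on the sphere is carried by the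
    components of its gradient and Hessian in an orthonormal frame rather than by its coordinate
    derivatives. The components stay continuous and bounded, and [sin theta] survives as the area
    weight and as the factor that kills boundary terms. Local minimality concerns one variation at a
    time, so a second order expansion whose remainder [K * |eps|^3] is uniform in all parameters
    decides the sign. The powers of [1 + x.y] are chosen because one more factor preserves
    positivity while the Laplacian lowers the exponent by one: the spectral gap becomes a two-term
    recursion. On the unstable side the kinetic term is of order [T^3] and the gain of order
    [c^2 T^5], which is again [T^3] since [c = (RT^2 - R0^2) / T]. Small [T] alone therefore does
    not fix the sign: a large exponent [m] must make the gain win, and smallness of [T] tames
    [(Lap rho)^2], whose coefficient does not grow with [c]. *)

(* Coquelicot states equalities of integrals in the carrier of [R_NormedModule]. *)
Ltac eqR := match goal with |- @eq _ ?x ?y => change (@eq R x y) end.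

Section ContinuityRules.
Context {U : UniformSpace}.
Implicit Types f g : U -> R.

Lemma cont_plus f g p : continuous f p -> continuous g p -> continuous (fun q => f q + g q) p.
Proof. intros Hf Hg. exact (continuous_plus (V := R_NormedModule) f g p Hf Hg). Qed.

Lemma cont_opp f p : continuous f p -> continuous (fun q => - f q) p.
Proof. intros Hf. exact (continuous_opp (V := R_NormedModule) f p Hf). Qed.

Lemma cont_minus f g p : continuous f p -> continuous g p -> continuous (fun q => f q - g q) p.
Proof. intros Hf Hg. apply cont_plus; [exact Hf | apply cont_opp, Hg]. Qed.

Lemma cont_mult f g p : continuous f p -> continuous g p -> continuous (fun q => f q * g q) p.
Proof. intros Hf Hg. exact (continuous_mult (K := R_AbsRing) f g p Hf Hg). Qed.

Lemma cont_const (c : R) p : continuous (fun _ : U => c) p.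
Proof. apply continuous_const. Qed.

Lemma cont_pow f n p : continuous f p -> continuous (fun q => f q ^ n) p.
Proof.
  intros Hf. induction n as [|n IH]; simpl.
  - apply continuous_const.
  - apply cont_mult; assumption.
Qed.

Lemma cont_comp (h : R -> R) f p : continuous h (f p) -> continuous f p ->
  continuous (fun q => h (f q)) p.
Proof. intros Hh Hf. apply (continuous_comp f h); assumption. Qed.

Lemma cont_sin f p : continuous f p -> continuous (fun q => sin (f q)) p.
Proof. intros. apply cont_comp; trivial. apply continuous_sin. Qed.

Lemma cont_cos f p : continuous f p -> continuous (fun q => cos (f q)) p.
Proof. intros. apply cont_comp; trivial. apply continuous_cos. Qed.

Lemma cont_sqrt f p : continuous f p -> continuous (fun q => sqrt (f q)) p.
Proof. intros. apply cont_comp; trivial. apply continuous_sqrt. Qed.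

Lemma cont_inv f p : f p <> 0 -> continuous f p -> continuous (fun q => / f q) p.
Proof. intros. apply (cont_comp (fun y => / y)); trivial. apply continuous_Rinv; trivial. Qed.

Lemma cont_div f g p : g p <> 0 -> continuous f p -> continuous g p ->
  continuous (fun q => f q / g q) p.
Proof. intros. apply cont_mult; trivial. apply cont_inv; trivial. Qed.

Lemma cont_pair {V W : UniformSpace} (f : U -> V) (g : U -> W) p :
  continuous f p -> continuous g p -> continuous (fun q => (f q, g q)) p.
Proof.
  intros Hf Hg.
  apply (continuous_comp_2 f g (fun a b => (a, b)) p Hf Hg).
  apply continuous_ext with (f := fun z : V * W => z).
  - intros [a b]; reflexivity.
  - apply continuous_id.
Qed.
End ContinuityRules.

Ltac cont_step :=
  match goal with
  | |- continuous (fun _ => ?c) _ => apply continuous_const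
  | |- continuous (fun q => q) _ => apply continuous_id
  | |- continuous (fun q => @?f q + @?g q) _ => apply (cont_plus f g)
  | |- continuous (fun q => @?f q - @?g q) _ => apply (cont_minus f g)
  | |- continuous (fun q => @?f q * @?g q) _ => apply (cont_mult f g)
  | |- continuous (fun q => @?f q / @?g q) _ => apply (cont_div f g)
  | |- continuous (fun q => - @?f q) _ => apply (cont_opp f)
  | |- continuous (fun q => / @?f q) _ => apply (cont_inv f)
  | |- continuous (fun q => @?f q ^ ?n) _ => apply (cont_pow f n)
  | |- continuous (fun q => sin (@?f q)) _ => apply (cont_sin f)
  | |- continuous (fun q => cos (@?f q)) _ => apply (cont_cos f)
  | |- continuous (fun q => sqrt (@?f q)) _ => apply (cont_sqrt f)
  | |- continuous (fun q => (@?f q, @?g q)) _ => apply (cont_pair f g)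
  | |- continuous fst _ => apply continuous_fst
  | |- continuous snd _ => apply continuous_snd
  | |- continuous (fun q => fst (@?f q)) _ =>
      apply (continuous_comp f fst); [ | apply continuous_fst]
  | |- continuous (fun q => snd (@?f q)) _ =>
      apply (continuous_comp f snd); [ | apply continuous_snd]
  end.

(** Joint continuity on the whole plane, poles and ends of the period included, so that slices and
    integrals over any range are regular without side conditions. *)
Definition cont2 (f : R -> R -> R) : Prop :=
  forall p : R * R, continuous (fun q : R * R => f (fst q) (snd q)) p.

Definition cont3 (f : R -> R -> R -> R) : Prop :=
  forall p : R * R * R,
    continuous (fun q : R * R * R => f (fst (fst q)) (snd (fst q)) (snd q)) p.

Lemma cont2_comp {U : UniformSpace} f (a b : U -> R) p : cont2 f ->
  continuous a p -> continuous b p -> continuous (fun q => f (a q) (b q)) p.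
Proof.
  intros Hf Ha Hb.
  apply (continuous_comp (fun q => (a q, b q)) (fun z : R * R => f (fst z) (snd z))).
  - apply cont_pair; assumption.
  - apply Hf.
Qed.

Lemma cont3_comp {U : UniformSpace} f (a b c : U -> R) p : cont3 f ->
  continuous a p -> continuous b p -> continuous c p ->
  continuous (fun q => f (a q) (b q) (c q)) p.
Proof.
  intros Hf Ha Hb Hc.
  apply (continuous_comp (fun q => (a q, b q, c q))
    (fun z : R * R * R => f (fst (fst z)) (snd (fst z)) (snd z))).
  - apply cont_pair; trivial. apply cont_pair; trivial.
  - apply Hf.
Qed.

Ltac cont :=
  repeat first
    [ assumption
    | cont_step
    | match goal with
      | H : cont2 ?f |- continuous (fun q => ?f (@?a q) (@?b q)) _ => apply (cont2_comp f a b _ H)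
      | H : cont3 ?f |- continuous (fun q => ?f (@?a q) (@?b q) (@?c q)) _ =>
          apply (cont3_comp f a b c _ H)
      end ].

Lemma ex_RInt_cont (f : R -> R) a b : (forall x, continuous f x) -> ex_RInt f a b.
Proof. intros H. apply (ex_RInt_continuous (V := R_CompleteNormedModule)). intros; apply H. Qed.

(** A tube argument: continuity at each [(u0, y)] gives a radius, and compactness of [[a, b]] a
    common one. The parameter ranges over an arbitrary uniform space so that the lemma applies to
    pairs and can be iterated for multiple integrals. *)
Lemma continuous_RInt_param {U : UniformSpace} (f : U -> R -> R) (a b : R) :
  a <= b ->
  (forall p : U * R, continuous (fun q : U * R => f (fst q) (snd q)) p) ->
  forall u0, continuous (fun u => RInt (f u) a b) u0.
Proof.
  intros Hab Hf u0.
  assert (Hfu : forall u y, continuous (f u) y).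
  { intros u y.
    apply (continuous_comp (fun y : R => (u, y)) (fun q : U * R => f (fst q) (snd q))).
    - apply cont_pair; cont.
    - apply Hf. }
  apply filterlim_locally. intros eps.
  (* The summand 1 keeps the denominator positive when [a = b]. *)
  set (e := eps / (2 * (b - a + 1))).
  assert (He : 0 < e).
  { unfold e. apply Rdiv_lt_0_compat; [apply cond_pos | lra]. }
  assert (Hloc : forall y, exists d : posreal, forall u y',
      ball u0 d u -> Rabs (y' - y) < d -> Rabs (f u y' - f u0 y') < e).
  { intros y.
    assert (H := Hf (u0, y)). unfold continuous in H.
    apply filterlim_locally with (eps := mkposreal (e / 2) ltac:(lra)) in H.
    destruct H as [d Hd]. exists d. intros u y' Hu Hy.
    assert (H1 := Hd (u, y') (conj Hu Hy)).
    assert (H2 := Hd (u0, y') (conj (ball_center u0 d) Hy)).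
    change (Rabs (f u y' - f u0 y) < e / 2) in H1.
    change (Rabs (f u0 y' - f u0 y) < e / 2) in H2.
    replace (f u y' - f u0 y') with ((f u y' - f u0 y) + - (f u0 y' - f u0 y)) by ring.
    eapply Rle_lt_trans; [apply Rabs_triang|]. rewrite Rabs_Ropp. lra. }
  apply functional_choice in Hloc. destruct Hloc as [delta Hdelta].
  destruct (compactness_value_1d a b delta) as [d Hd].
  exists d. intros u Hu.
  change (Rabs (RInt (f u) a b - RInt (f u0) a b) < eps).
  assert (Hb : Rabs (RInt (fun y => f u y - f u0 y) a b) <= (b - a) * e).
  { apply abs_RInt_le_const; trivial.
    - apply ex_RInt_cont. intros y. apply cont_minus; apply Hfu.
    (* Compactness yields only a double negation, which suffices to refute a strict inequality. *)
    - intros y Hy. apply Rnot_lt_le. intros Hlt.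
      apply (Hd y Hy). intros [y' [Hy' [Hyy' Hdd]]].
      apply (Rlt_not_le _ _ Hlt). left.
      apply (Hdelta y'); trivial. eapply ball_le; [apply Hdd|exact Hu]. }
  replace (RInt (f u) a b - RInt (f u0) a b) with (RInt (fun y => f u y - f u0 y) a b).
  2: { apply (RInt_minus (V := R_CompleteNormedModule) (f u) (f u0));
       apply ex_RInt_cont; apply Hfu. }
  eapply Rle_lt_trans; [apply Hb|].
  assert (e * (2 * (b - a + 1)) = eps) by (unfold e; field; lra).
  nra.
Qed.

Lemma continuous_slice1 f y x : cont2 f -> continuous (fun x => f x y) x.
Proof. intros Hf. cont. Qed.

Lemma continuous_slice2 f x y : cont2 f -> continuous (fun y => f x y) y.
Proof. intros Hf. cont. Qed.

Lemma is_derive_RInt_upper (f : R -> R) a x :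
  (forall y, continuous f y) -> is_derive (fun x => RInt f a x) x (f x).
Proof.
  intros Hf. apply (is_derive_RInt (V := R_NormedModule) f (fun x => RInt f a x) a x).
  - apply filter_forall. intros y.
    apply (RInt_correct (V := R_CompleteNormedModule)). apply ex_RInt_cont, Hf.
  - apply Hf.
Qed.

(** As functions of the upper limit of the outer variable, both sides vanish at [a] and have the
    same derivative, so their difference [Phi] is constant. *)
Lemma RInt_swap (f : R -> R -> R) a b c d : a <= b -> c <= d -> cont2 f ->
  RInt (fun x => RInt (fun y => f x y) c d) a b =
  RInt (fun y => RInt (fun x => f x y) a b) c d.
Proof.
  intros Hab Hcd Hf.
  assert (Hin : forall x, continuous (fun x => RInt (fun y => f x y) c d) x)
    by (apply continuous_RInt_param; assumption).
  set (Phi := fun z => RInt (fun x => RInt (fun y => f x y) c d) a z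
                 - RInt (fun y => RInt (fun x => f x y) a z) c d).
  assert (Hder : forall z y, is_derive (fun u => RInt (fun x => f x y) a u) z (f z y)).
  { intros z y. apply (is_derive_RInt_upper (fun x => f x y)).
    intros x. apply continuous_slice1, Hf. }
  assert (Hslice : forall x y, a <= x -> continuous (fun y => RInt (fun x => f x y) a x) y).
  { intros x y Hx. apply (continuous_RInt_param (fun y x => f x y)); trivial.
    intros p. cont. }
  (* Upper limits [z < a] occur too, because differentiating at [z] asks for integrability on a
     neighbourhood; the orientation is reversed there. *)
  assert (Hexs : forall z, ex_RInt (fun y => RInt (fun x => f x y) a z) c d).
  { intros z. apply ex_RInt_cont. intros y.
    destruct (Rle_dec a z) as [H|H]; [apply Hslice, H|].
    apply continuous_ext with (f := fun y => - RInt (fun x => f x y) z a).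
    - intros y'. apply (opp_RInt_swap (V := R_CompleteNormedModule) (fun x => f x y')).
      apply ex_RInt_cont. intros. apply continuous_slice1, Hf.
    - apply cont_opp. apply (continuous_RInt_param (fun y x => f x y)); [lra|].
      intros p. cont. }
  assert (HPhi : forall z, is_derive Phi z 0).
  { intros z.
    replace 0 with (RInt (fun y => f z y) c d
       - RInt (fun y => Derive (fun u => RInt (fun x => f x y) a u) z) c d).
    - apply (is_derive_minus (V := R_NormedModule)).
      + apply (is_derive_RInt_upper (fun x => RInt (fun y => f x y) c d)). apply Hin.
      + apply is_derive_RInt_param.
        * apply filter_forall. intros z' y _. eexists; apply Hder.
        * intros y _. apply continuity_2d_pt_ext with (f := f).
          { intros u v. symmetry. apply is_derive_unique, Hder. }
          apply continuity_2d_pt_filterlim. apply (Hf (z, y)).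
        * apply filter_forall. apply Hexs.
    - apply Rminus_diag_eq. apply RInt_ext. intros y _. symmetry. apply is_derive_unique, Hder. }
  assert (HPhi_eq : Phi a = Phi b).
  { destruct Hab as [Hab| ->]; [|reflexivity].
    apply (eq_is_derive (V := R_NormedModule) Phi a b); [intros; apply HPhi | exact Hab]. }
  unfold Phi in HPhi_eq.
  rewrite RInt_point in HPhi_eq.
  rewrite (RInt_ext (V := R_CompleteNormedModule) (fun y => RInt (fun x => f x y) a a) (fun _ => 0)) in HPhi_eq.
  2: { intros; apply (RInt_point (V := R_CompleteNormedModule)). }
  rewrite RInt_const in HPhi_eq.
  change (0 - (d - c) * 0 =
    RInt (fun x => RInt (fun y => f x y) c d) a b - RInt (fun y => RInt (fun x => f x y) a b) c d)
    in HPhi_eq.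
  lra.
Qed.

Lemma RInt_plus_cont (f g : R -> R) a b : (forall x, continuous f x) -> (forall x, continuous g x) ->
  RInt (fun x => f x + g x) a b = RInt f a b + RInt g a b.
Proof. intros Hf Hg. apply (RInt_plus (V := R_CompleteNormedModule)); apply ex_RInt_cont; assumption. Qed.

Lemma RInt_scal_cont (f : R -> R) a b c : (forall x, continuous f x) ->
  RInt (fun x => c * f x) a b = c * RInt f a b.
Proof. intros Hf. apply (RInt_scal (V := R_CompleteNormedModule)), ex_RInt_cont, Hf. Qed.

Lemma RInt_const_R (c a b : R) : RInt (fun _ => c) a b = (b - a) * c.
Proof. apply (RInt_const (V := R_CompleteNormedModule)). Qed.

(** The local radius is also taken below [1 / (|f| + 1)]. Compactness gives a positive lower bound
    [d] of the radii in use, and its inverse then bounds [|f|] everywhere. *)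
Lemma bounded_on_box (f : R -> R -> R -> R -> R) (T : R) :
  (forall p : R * R * R * R,
     continuous (fun q : R * R * R * R => let '(x, y, z, t) := q in f x y z t) p) ->
  exists M, 0 < M /\ forall x y z t, -1 <= x <= 1 -> -1 <= y <= 1 -> -1 <= z <= 1 ->
    0 <= t <= T -> Rabs (f x y z t) <= M.
Proof.
  intros Hf.
  assert (Hloc : forall v : Compactness.Tn 4 R, exists d : posreal,
     let '(x, (y, (z, (t, _)))) := v in
     d * (Rabs (f x y z t) + 1) <= 1 /\
     forall x' y' z' t', Rabs (x' - x) < d -> Rabs (y' - y) < d -> Rabs (z' - z) < d ->
       Rabs (t' - t) < d -> Rabs (f x' y' z' t') <= Rabs (f x y z t) + 1).
  { intros (x, (y, (z, (t, [])))).
    assert (H := Hf (x, y, z, t)). unfold continuous in H.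
    apply filterlim_locally with (eps := mkposreal 1 Rlt_0_1) in H.
    destruct H as [d Hd].
    assert (Hp : 0 < / (Rabs (f x y z t) + 1)).
    { apply Rinv_0_lt_compat. assert (H := Rabs_pos (f x y z t)). lra. }
    assert (Hm : 0 < Rmin d (/ (Rabs (f x y z t) + 1))).
    { apply Rmin_pos; [apply cond_pos | exact Hp]. }
    exists (mkposreal _ Hm). simpl. split.
    - apply Rle_trans with (/ (Rabs (f x y z t) + 1) * (Rabs (f x y z t) + 1)).
      + apply Rmult_le_compat_r; [assert (H := Rabs_pos (f x y z t)); lra | apply Rmin_r].
      + right. apply Rinv_l. assert (H := Rabs_pos (f x y z t)); lra.
    - intros x' y' z' t' Hx Hy Hz Ht.
      assert (H := Rmin_l d (/ (Rabs (f x y z t) + 1))).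
      assert (Hball : ball (x, y, z, t) d (x', y', z', t')).
      { repeat split; simpl;
        match goal with |- ball ?u _ ?v => change (Rabs (v - u) < d) end; lra. }
      apply Hd in Hball.
      change (Rabs (f x' y' z' t' - f x y z t) < 1) in Hball.
      assert (Hinv := Rabs_triang_inv (f x' y' z' t') (f x y z t)). lra. }
  apply functional_choice in Hloc. destruct Hloc as [delta Hdelta].
  destruct (compactness_value 4 (-1, (-1, (-1, (0, tt)))) (1, (1, (1, (T, tt)))) delta) as [d Hd].
  exists (/ d). split; [apply Rinv_0_lt_compat, cond_pos|].
  intros x y z t Hx Hy Hz Ht. apply Rnot_lt_le. intros Hlt.
  apply (Hd (x, (y, (z, (t, tt))))); [repeat split; simpl; tauto|].
  intros [(x', (y', (z', (t', [])))) [_ [Hc Hdd]]].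
  simpl in Hc. destruct Hc as (H1 & H2 & H3 & H4 & _).
  assert (HD := Hdelta (x', (y', (z', (t', tt))))). cbv beta iota in HD.
  destruct HD as [HD1 HD2].
  specialize (HD2 x y z t H1 H2 H3 H4).
  apply (Rlt_not_le _ _ Hlt). eapply Rle_trans; [apply HD2|].
  set (e := delta (x', (y', (z', (t', tt))))) in *.
  assert (Hd0 := cond_pos d).
  assert (Hr := Rabs_pos (f x' y' z' t')).
  apply Rmult_le_reg_l with d; trivial. rewrite Rinv_r by lra.
  eapply Rle_trans; [|apply HD1]. apply Rmult_le_compat_r; [lra | exact Hdd].
Qed.

(** * Integration over the unit sphere in spherical coordinates *)

Definition sint (F : R -> R -> R) : R :=
  RInt (fun th => RInt (fun ps => F th ps * sin th) 0 (2 * PI)) 0 PI.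

Lemma two_PI_pos : 0 <= 2 * PI.
Proof. assert (H := PI_RGT_0). lra. Qed.

Lemma PI_nonneg : 0 <= PI.
Proof. assert (H := PI_RGT_0). lra. Qed.

Lemma continuous_inner_sint F th : cont2 F ->
  continuous (fun th => RInt (fun ps => F th ps * sin th) 0 (2 * PI)) th.
Proof.
  intros HF. apply continuous_RInt_param; [apply two_PI_pos|].
  intros p. cont.
Qed.

Lemma ex_inner_sint F th : cont2 F -> ex_RInt (fun ps => F th ps * sin th) 0 (2 * PI).
Proof. intros HF. apply ex_RInt_cont. intros ps. cont. Qed.

Lemma ex_sint F : cont2 F -> ex_RInt (fun th => RInt (fun ps => F th ps * sin th) 0 (2 * PI)) 0 PI.
Proof. intros HF. apply ex_RInt_cont. intros; apply continuous_inner_sint, HF. Qed.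

(** The integral does not see the boundary of the coordinate rectangle. This admits identities that
    are obtained only after dividing by [sin th]. *)
Lemma sint_ext_open F G :
  (forall th ps, 0 < th < PI -> 0 < ps < 2 * PI -> F th ps = G th ps) -> sint F = sint G.
Proof.
  intros H. unfold sint. apply RInt_ext. intros th Hth.
  assert (HPI := PI_RGT_0). rewrite Rmin_left, Rmax_right in Hth by lra.
  apply RInt_ext. intros ps Hps. rewrite Rmin_left, Rmax_right in Hps by lra.
  rewrite H; trivial.
Qed.

Lemma sint_ext F G : (forall th ps, F th ps = G th ps) -> sint F = sint G.
Proof. intros H. apply sint_ext_open. auto. Qed.

Lemma sint_plus F G : cont2 F -> cont2 G ->
  sint (fun th ps => F th ps + G th ps) = sint F + sint G.
Proof.
  intros HF HG. unfold sint.
  rewrite <- (RInt_plus (V := R_CompleteNormedModule)); try (apply ex_sint; assumption).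
  apply RInt_ext. intros th _.
  rewrite <- (RInt_plus (V := R_CompleteNormedModule)); try (apply ex_inner_sint; assumption).
  apply RInt_ext. intros ps _. apply Rmult_plus_distr_r.
Qed.

Lemma sint_scal c F : cont2 F -> sint (fun th ps => c * F th ps) = c * sint F.
Proof.
  intros HF. unfold sint.
  rewrite <- (RInt_scal (V := R_CompleteNormedModule)); try (apply ex_sint; assumption).
  apply RInt_ext. intros th _.
  rewrite <- (RInt_scal (V := R_CompleteNormedModule)); try (apply ex_inner_sint; assumption).
  apply RInt_ext. intros ps _. apply Rmult_assoc.
Qed.

Lemma sint_minus F G : cont2 F -> cont2 G ->
  sint (fun th ps => F th ps - G th ps) = sint F - sint G.
Proof.
  intros HF HG.
  rewrite (sint_ext _ (fun th ps => F th ps + (-1) * G th ps)) by (intros; ring).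
  rewrite sint_plus, sint_scal; trivial; [ring|].
  intros p. cont.
Qed.

Lemma sint_le F G : cont2 F -> cont2 G ->
  (forall th ps, F th ps <= G th ps) -> sint F <= sint G.
Proof.
  intros HF HG H. unfold sint.
  apply RInt_le; try (apply ex_sint; assumption); [apply PI_nonneg|].
  intros th Hth.
  apply RInt_le; try (apply ex_inner_sint; assumption); [apply two_PI_pos|].
  intros ps _. apply Rmult_le_compat_r; [|apply H].
  apply Rlt_le, sin_gt_0; apply Hth.
Qed.

Lemma RInt_sin_0_PI : RInt sin 0 PI = 2.
Proof.
  apply (is_RInt_unique (V := R_CompleteNormedModule)).
  replace 2 with (minus (- cos PI) (- cos 0)).
  - apply (is_RInt_derive (V := R_CompleteNormedModule) (fun x => - cos x) sin).
    + intros x _. auto_derive; trivial. ring.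
    + intros x _. apply continuous_sin.
  - rewrite cos_PI, cos_0. unfold minus, plus, opp; simpl. ring.
Qed.

Lemma sint_theta (h : R -> R) : (forall x, continuous h x) ->
  sint (fun th _ => h th) = 2 * PI * RInt (fun th => h th * sin th) 0 PI.
Proof.
  intros Hh. unfold sint.
  rewrite <- (RInt_scal (V := R_CompleteNormedModule)).
  - apply RInt_ext. intros th _. rewrite (RInt_const (V := R_CompleteNormedModule)).
    change ((2 * PI - 0) * (h th * sin th) = 2 * PI * (h th * sin th)). ring.
  - apply ex_RInt_cont. intros x. cont; apply Hh.
Qed.

Lemma sint_const c : sint (fun _ _ => c) = 4 * PI * c.
Proof.
  rewrite (sint_theta (fun _ => c)) by (intros; apply continuous_const).
  rewrite (RInt_scal (V := R_CompleteNormedModule) sin).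
  - rewrite RInt_sin_0_PI. change (2 * PI * (c * 2) = 4 * PI * c). ring.
  - apply ex_RInt_cont. intros. apply continuous_sin.
Qed.

Lemma continuous_sint {U : UniformSpace} (F : U -> R -> R -> R) :
  (forall p : U * R * R, continuous (fun q : U * R * R => F (fst (fst q)) (snd (fst q)) (snd q)) p) ->
  forall u, continuous (fun u => sint (F u)) u.
Proof.
  intros HF. unfold sint.
  apply (continuous_RInt_param (fun u th => RInt (fun ps => F u th ps * sin th) 0 (2 * PI)));
    [apply PI_nonneg|].
  apply (continuous_RInt_param (U := prod_UniformSpace U R_UniformSpace)
    (fun v ps => F (fst v) (snd v) ps * sin (snd v))); [apply two_PI_pos|].
  intros p. cont. apply HF.
Qed.

(** A positive value persists on a small interval by continuity and would make the integral
    positive. *)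
Lemma RInt_zero_nonneg (h : R -> R) a b : a < b -> (forall x, continuous h x) ->
  (forall x, a <= x <= b -> 0 <= h x) -> RInt h a b <= 0 -> forall x, a < x < b -> h x = 0.
Proof.
  intros Hab Hc Hp Hi x Hx.
  destruct (Hp x ltac:(lra)) as [Hpos|]; [exfalso|auto].
  assert (Hl := Hc x). unfold continuous in Hl.
  apply filterlim_locally with (eps := mkposreal _ Hpos) in Hl.
  destruct Hl as [d Hd].
  set (e := Rmin (d / 2) (Rmin (x - a) (b - x))).
  assert (He : 0 < e).
  { unfold e. apply Rmin_pos; [assert (H := cond_pos d); lra|]. apply Rmin_pos; lra. }
  assert (e <= d / 2) by apply Rmin_l.
  assert (e <= x - a) by (eapply Rle_trans; [apply Rmin_r | apply Rmin_l]).
  assert (e <= b - x) by (eapply Rle_trans; [apply Rmin_r | apply Rmin_r]).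
  assert (Hex : forall u v, ex_RInt h u v) by (intros; apply ex_RInt_cont, Hc).
  assert (HC1 := RInt_Chasles (V := R_CompleteNormedModule) h a (x - e) b (Hex _ _) (Hex _ _)).
  assert (HC2 := RInt_Chasles (V := R_CompleteNormedModule) h (x - e) (x + e) b (Hex _ _) (Hex _ _)).
  change (RInt h a (x - e) + RInt h (x - e) b = RInt h a b) in HC1.
  change (RInt h (x - e) (x + e) + RInt h (x + e) b = RInt h (x - e) b) in HC2.
  assert (0 <= RInt h a (x - e)) by (apply RInt_ge_0; trivial; [lra | intros; apply Hp; lra]).
  assert (0 <= RInt h (x + e) b) by (apply RInt_ge_0; trivial; [lra | intros; apply Hp; lra]).
  assert (0 < RInt h (x - e) (x + e)).
  { apply RInt_gt_0; [lra | | intros; apply Hc].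
    intros y Hy.
    assert (Hb : ball x d y).
    { change (Rabs (y - x) < d). apply Rabs_def1; lra. }
    apply Hd in Hb. change (Rabs (h y - h x) < h x) in Hb.
    apply Rabs_def2 in Hb. lra. }
  lra.
Qed.

Lemma sint_zero_nonneg F : cont2 F -> (forall th ps, 0 <= F th ps) -> sint F <= 0 ->
  forall th ps, 0 < th < PI -> 0 < ps < 2 * PI -> F th ps = 0.
Proof.
  intros HF Hp Hi th ps Hth Hps.
  assert (HPI := PI_RGT_0).
  assert (Hs : 0 < sin th) by (apply sin_gt_0; apply Hth).
  assert (Hz : RInt (fun ps => F th ps * sin th) 0 (2 * PI) = 0).
  { apply (RInt_zero_nonneg (fun th => RInt (fun ps => F th ps * sin th) 0 (2 * PI)) 0 PI); trivial.
    - intros; apply continuous_inner_sint, HF.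
    - intros x Hx. apply RInt_ge_0; [lra | apply ex_inner_sint, HF |].
      intros. apply Rmult_le_pos; [apply Hp | apply sin_ge_0; apply Hx]. }
  assert (Hz2 : F th ps * sin th = 0).
  { apply (RInt_zero_nonneg (fun ps => F th ps * sin th) 0 (2 * PI)); trivial; try lra.
    - intros x. cont.
    - intros. apply Rmult_le_pos; [apply Hp | lra]. }
  apply Rmult_integral in Hz2. destruct Hz2; trivial; lra.
Qed.

(** * Calculus on the sphere *)

(* In the orthonormal frame [e1 = X_theta], [e2 = X_psi / sin theta] of the sphere, [p] and [k]
   are the components of the gradient of [F], and [A], [D] the diagonal entries of its Hessian,
   so that [A + D] is the spherical Laplacian.  All of them are continuous up to the poles. *)
Record sph_fun (F p k A D : R -> R -> R) : Prop := {
  sf_cF : cont2 F;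
  sf_cp : cont2 p;
  sf_ck : cont2 k;
  sf_cA : cont2 A;
  sf_cD : cont2 D;
  sf_Fth : forall th ps, is_derive (fun a => F a ps) th (p th ps);
  sf_Fps : forall th ps, is_derive (fun a => F th a) ps (sin th * k th ps);
  sf_pth : forall th ps, is_derive (fun a => p a ps) th (A th ps);
  sf_kps : forall th ps,
    is_derive (fun a => k th a) ps (sin th * D th ps - cos th * p th ps);
  sf_perF : forall th, F th (2 * PI) = F th 0;
  sf_perk : forall th, k th (2 * PI) = k th 0 }.

Lemma RInt_derive_eq (f df : R -> R) a b : (forall x, is_derive f x (df x)) ->
  (forall x, continuous df x) -> RInt df a b = f b - f a.
Proof.
  intros Hd Hc. apply (is_RInt_unique (V := R_CompleteNormedModule)).
  apply (is_RInt_derive (V := R_CompleteNormedModule)); auto.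
Qed.

(** Multiplied by [sin th], the divergence of [G grad F] is [P + Q], where [P] is the theta
    derivative of [sin th * G * p] and [Q] the psi derivative of [G * k]; the two terms
    [cos th * G * p] cancel. [P] integrates to zero because the sine vanishes at both poles, and [Q]
    by periodicity. *)
Lemma green F p k A D G q l B E : sph_fun F p k A D -> sph_fun G q l B E ->
  sint (fun th ps => G th ps * (A th ps + D th ps)) =
  - sint (fun th ps => q th ps * p th ps + l th ps * k th ps).
Proof.
  intros [cF cp ck cA cD Fth Fps pth kps perF perk] [cG cq cl cB cE Gth Gps qth lps perG perl].
  set (P := fun th ps => cos th * (G th ps * p th ps)
     + sin th * (q th ps * p th ps + G th ps * A th ps)).
  set (Q := fun th ps => (sin th * l th ps) * k th ps
     + G th ps * (sin th * D th ps - cos th * p th ps)).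
  assert (HcP : cont2 P) by (unfold P; intros v; cont).
  assert (HcQ : cont2 Q) by (unfold Q; intros v; cont).
  assert (HQ : forall th, RInt (fun ps => Q th ps) 0 (2 * PI) = 0).
  { intros th. rewrite (RInt_derive_eq (fun ps => G th ps * k th ps)).
    - rewrite perG, perk. eqR. ring.
    - intros ps. apply (is_derive_mult (fun ps => G th ps) (fun ps => k th ps) ps); auto.
      intros; apply Rmult_comm.
    - intros ps. apply continuous_slice2, HcQ. }
  assert (HP : RInt (fun th => RInt (fun ps => P th ps) 0 (2 * PI)) 0 PI = 0).
  { rewrite RInt_swap; [|apply PI_nonneg|apply two_PI_pos|exact HcP].
    rewrite (RInt_ext (V := R_CompleteNormedModule) _ (fun _ => 0)).
    - rewrite (RInt_const (V := R_CompleteNormedModule)). apply Rmult_0_r.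
    - intros ps _.
      rewrite (RInt_derive_eq (fun th => sin th * (G th ps * p th ps))).
      + rewrite sin_PI, sin_0. eqR. ring.
      + intros th.
        apply (is_derive_mult sin (fun th => G th ps * p th ps) th (cos th)).
        * auto_derive; trivial. ring.
        * apply (is_derive_mult (fun th => G th ps) (fun th => p th ps) th); auto.
          intros; apply Rmult_comm.
        * intros; apply Rmult_comm.
      + intros th. apply continuous_slice1, HcP. }
  assert (H0 : sint (fun th ps => G th ps * (A th ps + D th ps)
             + (q th ps * p th ps + l th ps * k th ps)) = 0).
  { unfold sint. etransitivity; [|exact HP]. apply RInt_ext. intros th _.
    transitivity (RInt (fun ps => P th ps) 0 (2 * PI) + RInt (fun ps => Q th ps) 0 (2 * PI));
      [|rewrite HQ; apply Rplus_0_r].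
    rewrite <- (RInt_plus (V := R_CompleteNormedModule)).
    - apply RInt_ext. intros ps _. unfold P, Q, plus; simpl. ring.
    - apply ex_RInt_cont. intros ps. apply continuous_slice2, HcP.
    - apply ex_RInt_cont. intros ps. apply continuous_slice2, HcQ. }
  rewrite sint_plus in H0 by (intros v; cont). lra.
Qed.

Lemma green_sym F p k A D G q l B E : sph_fun F p k A D -> sph_fun G q l B E ->
  sint (fun th ps => G th ps * (A th ps + D th ps)) =
  sint (fun th ps => F th ps * (B th ps + E th ps)).
Proof.
  intros HF HG. rewrite (green _ _ _ _ _ _ _ _ _ _ HF HG), (green _ _ _ _ _ _ _ _ _ _ HG HF).
  f_equal. apply sint_ext. intros; ring.
Qed.

(** The linear function with coefficients [(a, b, c)] restricted to the sphere; [lin1] and [lin2]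
    are the components of its gradient. Together they are the coordinates of the vector [(a, b, c)]
    in the moving frame. *)
Definition lin (a b c th ps : R) : R := sin th * cos ps * a + sin th * sin ps * b + cos th * c.
Definition lin1 (a b c th ps : R) : R := cos th * cos ps * a + cos th * sin ps * b - sin th * c.
Definition lin2 (a b c th ps : R) : R := cos ps * b - sin ps * a.

Lemma sin_sqr x : sin x ^ 2 = 1 - cos x ^ 2.
Proof. rewrite <- !Rsqr_pow2, <- (sin2_cos2 x). ring. Qed.

Lemma sincos2 x : sin x * sin x = 1 - cos x * cos x.
Proof. assert (H := sin2_cos2 x). unfold Rsqr in H. lra. Qed.

Lemma cont2_lin a b c : cont2 (lin a b c).
Proof. intros p. unfold lin. cont. Qed.

Lemma sph_fun_const c : sph_fun (fun _ _ => c) (fun _ _ => 0) (fun _ _ => 0) (fun _ _ => 0) (fun _ _ => 0).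
Proof.
  split; try (intros p; solve [cont]); try reflexivity; intros; auto_derive; trivial; ring.
Qed.

Lemma sph_fun_plus F p k A D G q l B E : sph_fun F p k A D -> sph_fun G q l B E ->
  sph_fun (fun th ps => F th ps + G th ps) (fun th ps => p th ps + q th ps)
    (fun th ps => k th ps + l th ps) (fun th ps => A th ps + B th ps)
    (fun th ps => D th ps + E th ps).
Proof.
  intros [cF cp ck cA cD Fth Fps pth kps perF perk] [cG cq cl cB cE Gth Gps qth lps perG perl].
  split; try (intros v; solve [cont]).
  - intros. apply (is_derive_plus (V := R_NormedModule) (fun a => F a ps)); auto.
  - intros. rewrite Rmult_plus_distr_l.
    apply (is_derive_plus (V := R_NormedModule) (fun a => F th a)); auto.
  - intros. apply (is_derive_plus (V := R_NormedModule) (fun a => p a ps)); auto.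
  - intros th ps.
    replace (_ - _) with ((sin th * D th ps - cos th * p th ps) + (sin th * E th ps - cos th * q th ps))
      by ring.
    apply (is_derive_plus (V := R_NormedModule) (fun a => k th a)); auto.
  - intros. rewrite perF, perG; reflexivity.
  - intros. rewrite perk, perl; reflexivity.
Qed.

(** The Hessian of a linear function on the sphere is minus the function times the metric, so these
    are eigenfunctions of minus the Laplacian for the eigenvalue 2. *)
Lemma sph_fun_lin a b c :
  sph_fun (lin a b c) (lin1 a b c) (lin2 a b c) (fun th ps => - lin a b c th ps)
    (fun th ps => - lin a b c th ps).
Proof.
  unfold lin, lin1, lin2.
  split; try (intros p; solve [cont]).
  - intros; auto_derive; trivial; ring.
  - intros; auto_derive; trivial; ring.
  - intros; auto_derive; trivial; ring.
  - intros; auto_derive; trivial.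
    transitivity (- (cos ps * a + sin ps * b) * (sin th * sin th + cos th * cos th)).
    + rewrite sincos2; ring.
    + ring.
  - intros. rewrite sin_2PI, cos_2PI, sin_0, cos_0. reflexivity.
  - intros. rewrite sin_2PI, cos_2PI, sin_0, cos_0. reflexivity.
Qed.

(** The truncated predecessors are harmless: each wrong power comes with a factor [INR n] or
    [INR (pred n)] that vanishes. *)
Lemma sph_fun_pow F p k A D n : sph_fun F p k A D ->
  sph_fun (fun th ps => F th ps ^ n)
    (fun th ps => INR n * F th ps ^ pred n * p th ps)
    (fun th ps => INR n * F th ps ^ pred n * k th ps)
    (fun th ps => INR n * (INR (pred n) * F th ps ^ pred (pred n) * p th ps * p th ps
        + F th ps ^ pred n * A th ps))
    (fun th ps => INR n * (INR (pred n) * F th ps ^ pred (pred n) * k th ps * k th ps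
        + F th ps ^ pred n * D th ps)).
Proof.
  intros [cF cp ck cA cD Fth Fps pth kps perF perk].
  assert (Hpow : forall (f : R -> R) (x l : R) m, is_derive f x l ->
    is_derive (fun y => f y ^ m) x (INR m * f x ^ pred m * l)).
  { intros f x l m Hf.
    replace (INR m * f x ^ pred m * l) with (INR m * l * f x ^ pred m) by ring.
    apply is_derive_pow, Hf. }
  assert (Hpp : forall (f g : R -> R) (x l l' : R) m, is_derive f x l -> is_derive g x l' ->
    is_derive (fun y => INR n * f y ^ m * g y) x
      (INR n * (INR m * f x ^ pred m * l * g x + f x ^ m * l'))).
  { intros f g x l l' m Hf Hg.
    apply is_derive_ext with (f := fun y => INR n * (f y ^ m * g y)).
    - intros t. symmetry; apply Rmult_assoc.
    - apply is_derive_scal. apply (is_derive_mult (fun y => f y ^ m) g); auto.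
      intros; apply Rmult_comm. }
  split; try (intros v; solve [cont]).
  - intros. apply (Hpow (fun a => F a ps)); auto.
  - intros th ps. replace (sin th * _) with (INR n * F th ps ^ pred n * (sin th * k th ps)) by ring.
    apply (Hpow (fun a => F th a)); auto.
  - intros. apply (Hpp (fun a => F a ps) (fun a => p a ps)); auto.
  - intros th ps.
    replace (_ - _) with (INR n * (INR (pred n) * F th ps ^ pred (pred n) * (sin th * k th ps) * k th ps
       + F th ps ^ pred n * (sin th * D th ps - cos th * p th ps))) by ring.
    apply (Hpp (fun a => F th a) (fun a => k th a)); auto.
  - intros. rewrite perF; reflexivity.
  - intros. rewrite perF, perk; reflexivity.
Qed.

(** * Zonal kernels and the spectral gap *)

Definition x1 (th ps : R) : R := sin th * cos ps.
Definition x2 (th ps : R) : R := sin th * sin ps.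
Definition x3 (th ps : R) : R := cos th.

Definition xdot (th' ps' th ps : R) : R := lin (x1 th' ps') (x2 th' ps') (x3 th' ps') th ps.

(** The primed angles give the point [x] at which the smoothed function is evaluated. The kernel is
    a bare power of [1 + x.y]; its normalisation is kept apart in [kmass]. *)
Definition kint (n : nat) (F : R -> R -> R) (th' ps' : R) : R :=
  sint (fun th ps => (1 + xdot th' ps' th ps) ^ n * F th ps).

Definition kform (n : nat) (F G : R -> R -> R) : R :=
  sint (fun th ps => G th ps * kint n F th ps).

Lemma cont2_xdot th' ps' : cont2 (xdot th' ps').
Proof. apply cont2_lin. Qed.

Lemma cont2_kint n F : cont2 F -> cont2 (kint n F).
Proof.
  intros HF. intros p. unfold kint.
  apply (continuous_sint (U := prod_UniformSpace R_UniformSpace R_UniformSpace)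
    (fun v th ps => (1 + xdot (fst v) (snd v) th ps) ^ n * F th ps)).
  intros q. unfold xdot, lin, x1, x2, x3. cont.
Qed.

Lemma cont2_x1 : cont2 x1. Proof. intros p; unfold x1; cont. Qed.
Lemma cont2_x2 : cont2 x2. Proof. intros p; unfold x2; cont. Qed.
Lemma cont2_x3 : cont2 x3. Proof. intros p; unfold x3; cont. Qed.

Lemma cont2_mult F G : cont2 F -> cont2 G -> cont2 (fun th ps => F th ps * G th ps).
Proof. intros HF HG p. cont. Qed.

Lemma cont2_plus F G : cont2 F -> cont2 G -> cont2 (fun th ps => F th ps + G th ps).
Proof. intros HF HG p. cont. Qed.

Lemma cont2_scal c F : cont2 F -> cont2 (fun th ps => c * F th ps).
Proof. intros HF p. cont. Qed.

#[local] Hint Resolve cont2_kint cont2_xdot cont2_lin cont2_x1 cont2_x2 cont2_x3 cont2_mult cont2_plus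
  cont2_scal : cont2.

Lemma kint_lin n c F G th' ps' : cont2 F -> cont2 G ->
  kint n (fun th ps => F th ps + c * G th ps) th' ps' = kint n F th' ps' + c * kint n G th' ps'.
Proof.
  intros HF HG. unfold kint.
  assert (Hx := cont2_xdot th' ps').
  rewrite <- sint_scal, <- sint_plus; try (intros p; solve [cont]).
  apply sint_ext; intros; ring.
Qed.

Lemma kint_succ n F th' ps' : cont2 F ->
  kint (S n) F th' ps' = kint n F th' ps'
    + x1 th' ps' * kint n (fun th ps => x1 th ps * F th ps) th' ps'
    + x2 th' ps' * kint n (fun th ps => x2 th ps * F th ps) th' ps'
    + x3 th' ps' * kint n (fun th ps => x3 th ps * F th ps) th' ps'.
Proof.
  intros HF. unfold kint.
  assert (Hx := cont2_xdot th' ps').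
  assert (H1 := cont2_x1). assert (H2 := cont2_x2). assert (H3 := cont2_x3).
  rewrite <- !sint_scal, <- !sint_plus; try (intros p; solve [cont]).
  apply sint_ext; intros th ps. simpl. unfold xdot at 1, lin. fold (x1 th ps) (x2 th ps) (x3 th ps).
  ring.
Qed.

Lemma kform_0 F G : cont2 F -> cont2 G -> kform 0 F G = sint F * sint G.
Proof.
  intros HF HG. unfold kform.
  rewrite (sint_ext _ (fun th ps => sint F * G th ps)).
  - apply sint_scal, HG.
  - intros th ps. rewrite Rmult_comm. f_equal. apply sint_ext. intros; simpl; ring.
Qed.

(** One factor of the kernel is opened as [1 + x_1 y_1 + x_2 y_2 + x_3 y_3], which splits the form
    into four forms of lower degree. Symmetry and positivity are inherited along this recursion. *)
Lemma kform_succ n F G : cont2 F -> cont2 G ->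
  kform (S n) F G = kform n F G
    + kform n (fun th ps => x1 th ps * F th ps) (fun th ps => x1 th ps * G th ps)
    + kform n (fun th ps => x2 th ps * F th ps) (fun th ps => x2 th ps * G th ps)
    + kform n (fun th ps => x3 th ps * F th ps) (fun th ps => x3 th ps * G th ps).
Proof.
  intros HF HG. unfold kform.
  rewrite <- !sint_plus by auto 10 with cont2.
  apply sint_ext. intros. rewrite kint_succ by trivial. ring.
Qed.

(** Induction along [kform_succ] takes the place of exchanging integrals over a product of two
    spheres. *)
Lemma kform_sym n : forall F G, cont2 F -> cont2 G -> kform n F G = kform n G F.
Proof.
  induction n as [|n IH]; intros F G HF HG.
  - rewrite !kform_0 by trivial. ring.
  - rewrite !kform_succ by trivial.
    rewrite (IH F G), (IH (fun th ps => x1 th ps * F th ps)),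
      (IH (fun th ps => x2 th ps * F th ps)), (IH (fun th ps => x3 th ps * F th ps))
      by auto with cont2.
    reflexivity.
Qed.

(* Schur's product theorem for the factor [1 + x . y], one multiplication at a time. *)
Lemma kform_nonneg n : forall F, cont2 F -> 0 <= kform n F F.
Proof.
  induction n as [|n IH]; intros F HF.
  - rewrite kform_0 by trivial. nra.
  - rewrite kform_succ by trivial.
    assert (H0 := IH F HF).
    assert (H1 := IH (fun th ps => x1 th ps * F th ps) ltac:(auto with cont2)).
    assert (H2 := IH (fun th ps => x2 th ps * F th ps) ltac:(auto with cont2)).
    assert (H3 := IH (fun th ps => x3 th ps * F th ps) ltac:(auto with cont2)).
    lra.
Qed.

Lemma kform_lin_l n c F G H : cont2 F -> cont2 G -> cont2 H ->
  kform n (fun th ps => F th ps + c * G th ps) H = kform n F H + c * kform n G H.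
Proof.
  intros HF HG HH. unfold kform.
  rewrite <- sint_scal, <- sint_plus by auto with cont2.
  apply sint_ext. intros. rewrite kint_lin by trivial. ring.
Qed.

Lemma kform_lin_r n c F G H : cont2 F -> cont2 G -> cont2 H ->
  kform n H (fun th ps => F th ps + c * G th ps) = kform n H F + c * kform n H G.
Proof.
  intros HF HG HH.
  rewrite kform_sym, kform_lin_l by auto with cont2.
  rewrite (kform_sym n F H), (kform_sym n G H) by trivial. reflexivity.
Qed.

(** The scalar product of two fixed vectors, computed in the orthonormal frame. For [s = x.y] with
    [x] fixed it yields [|grad s|^2 = 1 - s^2]. *)
Lemma lin_frame a b c th ps a' b' c' :
  lin a b c th ps * lin a' b' c' th ps + lin1 a b c th ps * lin1 a' b' c' th ps
  + lin2 a b c th ps * lin2 a' b' c' th ps = a * a' + b * b' + c * c'.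
Proof.
  unfold lin, lin1, lin2. ring_simplify.
  rewrite ?(sin_sqr th).
  rewrite ?(sin_sqr ps).
  ring.
Qed.

Lemma x_unit th ps : x1 th ps * x1 th ps + x2 th ps * x2 th ps + x3 th ps * x3 th ps = 1.
Proof.
  unfold x1, x2, x3.
  transitivity (sin th * sin th * (sin ps * sin ps + cos ps * cos ps) + cos th * cos th); [ring|].
  rewrite !sincos2. ring.
Qed.

(* With [s = x . y], the Laplacian of [(1+s)^n] is [((1-s^2) n (1+s)^(n-1))']. *)
Lemma kint_laplacian n F p k A D th' ps' : sph_fun F p k A D ->
  kint n (fun th ps => A th ps + D th ps) th' ps' =
  - (INR n * (INR n + 1)) * kint n F th' ps' + 2 * INR n * INR n * kint (pred n) F th' ps'.
Proof.
  intros HF. unfold kint.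
  assert (HP := sph_fun_plus _ _ _ _ _ _ _ _ _ _ (sph_fun_const 1)
      (sph_fun_lin (x1 th' ps') (x2 th' ps') (x3 th' ps'))).
  apply (sph_fun_pow _ _ _ _ _ n) in HP.
  unfold xdot.
  (* The Laplacian is moved from [F] to the kernel, a power of an affine function. *)
  rewrite (green_sym _ _ _ _ _ _ _ _ _ _ HF HP).
  assert (Hx := cont2_xdot th' ps').
  assert (cF := sf_cF _ _ _ _ _ HF).
  unfold xdot in Hx.
  rewrite <- !sint_scal, <- sint_plus; try (intros v; cont).
  apply sint_ext. intros th ps.
  assert (Hu := lin_frame (x1 th' ps') (x2 th' ps') (x3 th' ps') th ps
                 (x1 th' ps') (x2 th' ps') (x3 th' ps')).
  rewrite x_unit in Hu.
  set (u := lin _ _ _ th ps) in *. set (u1 := lin1 _ _ _ th ps) in *.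
  set (u2 := lin2 _ _ _ th ps) in *.
  assert (Hu2 : u2 * u2 = 1 - u * u - u1 * u1) by lra.
  (* Exponents 0 and 1 are separated because the predecessors truncate there. *)
  destruct n as [|[|n]]; simpl pred.
  - simpl. ring.
  - simpl. ring.
  - rewrite (S_INR (S n)).
    replace (F th ps * _) with (F th ps * (INR (S n) + 1) * (INR (S n) * (1 + u) ^ n * (u1 * u1 + u2 * u2)
      - 2 * u * (1 + u) ^ S n)) by ring.
    rewrite Hu2. simpl pow. ring.
Qed.

Lemma kform_laplacian n F p k A D G : sph_fun F p k A D -> cont2 G ->
  kform n (fun th ps => A th ps + D th ps) G =
  - (INR n * (INR n + 1)) * kform n F G + 2 * INR n * INR n * kform (pred n) F G.
Proof.
  intros HF HG. unfold kform.
  assert (cF := sf_cF _ _ _ _ _ HF).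
  rewrite <- !sint_scal, <- sint_plus by auto with cont2.
  apply sint_ext. intros. rewrite (kint_laplacian n _ _ _ _ _ _ _ HF). ring.
Qed.

(** The integral of [(1 + x.y)^n] over the sphere is [4 PI * 2^n / (n + 1)], so with this factor the
    kernel has mean value 1. *)
Definition kmass (n : nat) : R := (INR n + 1) / 2 ^ n.

Lemma kmass_pos n : 0 < kmass n.
Proof.
  unfold kmass. apply Rdiv_lt_0_compat; [|apply pow_lt; lra].
  assert (H := pos_INR n). lra.
Qed.

Lemma kmass_succ n : kmass (S n) * (2 * INR (S n)) = (INR (S n) + 1) * kmass n.
Proof.
  unfold kmass. simpl pow. rewrite S_INR. field. apply pow_nonzero. lra.
Qed.

(** Applying the Laplacian identity to the constant 1 turns it into a recursion for the masses,
    which replaces an explicit integration. *)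
Lemma kint_one n th' ps' : kmass n * kint n (fun _ _ => 1) th' ps' = 4 * PI.
Proof.
  induction n as [|n IH].
  - unfold kint, kmass. simpl. rewrite (sint_ext _ (fun _ _ => 1)) by (intros; ring).
    rewrite sint_const. field.
  - assert (H := kint_laplacian (S n) _ _ _ _ _ th' ps' (sph_fun_const 1)).
    assert (H0 : kint (S n) (fun _ _ => 0 + 0) th' ps' = 0).
    { unfold kint. rewrite (sint_ext _ (fun _ _ => 0)) by (intros; ring).
      rewrite sint_const. ring. }
    cbv beta in H. rewrite H0 in H. simpl pred in H. rewrite <- IH.
    assert (Hn : 0 < INR (S n)) by (apply lt_0_INR; lia).
    assert (Hm := kmass_succ n).
    apply Rmult_eq_reg_l with (INR (S n) * (INR (S n) + 1)); [|nra].
    replace (INR (S n) * (INR (S n) + 1) * (kmass n * kint n (fun _ _ => 1) th' ps'))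
      with (INR (S n) * ((INR (S n) + 1) * kmass n) * kint n (fun _ _ => 1) th' ps') by ring.
    rewrite <- Hm.
    apply (f_equal (fun v => kmass (S n) * v)) in H. lra.
Qed.

Lemma sint_abs_le F G : cont2 F -> cont2 G -> (forall th ps, Rabs (F th ps) <= G th ps) ->
  Rabs (sint F) <= sint G.
Proof.
  intros HF HG H. apply Rabs_le. split.
  - replace (- sint G) with (sint (fun th ps => -1 * G th ps)) by (rewrite sint_scal; trivial; ring).
    apply sint_le; auto with cont2. intros th ps.
    assert (H1 := H th ps). apply Rabs_le_between in H1. lra.
  - apply sint_le; trivial. intros th ps. eapply Rle_trans; [apply Rle_abs | apply H].
Qed.

(** The square of [x.y] is one of three squares that sum to 1 in the frame. *)
Lemma xdot_bound th' ps' th ps : -1 <= xdot th' ps' th ps <= 1.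
Proof.
  assert (Hu := lin_frame (x1 th' ps') (x2 th' ps') (x3 th' ps') th ps
                 (x1 th' ps') (x2 th' ps') (x3 th' ps')).
  rewrite x_unit in Hu. unfold xdot. nra.
Qed.

(** Writing [1 - s = 2 - (1 + s)] expresses this first moment through two consecutive masses. It
    tends to zero, which is the concentration of the kernels on the diagonal. *)
Lemma kint_defect n th' ps' :
  kmass n * kint n (fun th ps => 1 - xdot th' ps' th ps) th' ps' = 8 * PI / (INR n + 2).
Proof.
  assert (Hx := cont2_xdot th' ps').
  assert (H : kint n (fun th ps => 1 - xdot th' ps' th ps) th' ps' =
     2 * kint n (fun _ _ => 1) th' ps' - kint (S n) (fun _ _ => 1) th' ps').
  { unfold kint. rewrite <- sint_scal, <- sint_minus; try (intros p; solve [cont]).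
    apply sint_ext. intros; simpl; ring. }
  rewrite H.
  assert (H0 := kint_one n th' ps'). assert (H1 := kint_one (S n) th' ps').
  assert (Hm := kmass_succ n). rewrite S_INR in Hm.
  assert (Hn := pos_INR n).
  assert (HS : kmass n * kint (S n) (fun _ _ => 1) th' ps' = 2 * (INR n + 1) / (INR n + 2) * (4 * PI)).
  { rewrite <- H1. apply Rmult_eq_reg_l with (INR n + 2); [|lra].
    replace ((INR n + 2) * (kmass n * kint (S n) (fun _ _ => 1) th' ps')) with
      ((INR n + 1 + 1) * kmass n * kint (S n) (fun _ _ => 1) th' ps') by ring.
    rewrite <- Hm. field. lra. }
  rewrite Rmult_minus_distr_l, HS.
  replace (kmass n * (2 * kint n (fun _ _ => 1) th' ps'))
    with (2 * (kmass n * kint n (fun _ _ => 1) th' ps')) by ring.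
  rewrite H0. field. lra.
Qed.

(* A modulus of continuity, quadratic in the chordal distance [|x - y|^2 = 2 (1 - x . y)]. *)
Definition sph_modulus (F : R -> R -> R) : Prop :=
  forall d, 0 < d -> exists C, 0 <= C /\ forall th' ps' th ps,
    Rabs (F th ps - F th' ps') <= d + C * (1 - xdot th' ps' th ps).

(** Averaging the modulus [d + C * (1 - x.y)] costs [4 PI * d], which is [e / 2] for
    [d = e / (8 PI)], plus [8 PI * C / (n + 2)], which is at most [e / 2] once [n] exceeds
    [16 PI * C / e]. The rank obtained is uniform in the point. *)
Lemma kint_approximates F : cont2 F -> sph_modulus F -> forall e, 0 < e ->
  exists N, forall n, (N <= n)%nat -> forall th' ps',
    Rabs (kmass n * kint n F th' ps' - 4 * PI * F th' ps') <= e.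
Proof.
  intros HF HM e He.
  assert (HPI := PI_RGT_0).
  destruct (HM (e / (8 * PI))) as [C [HC Hmod]].
  { apply Rdiv_lt_0_compat; lra. }
  destruct (nfloor_ex (16 * PI * C / e)) as [N HN].
  { apply Rmult_le_pos; [nra|]. left. apply Rinv_0_lt_compat; lra. }
  exists (S N). intros n Hn th' ps'.
  assert (Hx := cont2_xdot th' ps').
  assert (Hk := kmass_pos n).
  set (d := e / (8 * PI)) in *.
  assert (H : Rabs (kint n F th' ps' - F th' ps' * kint n (fun _ _ => 1) th' ps')
    <= d * kint n (fun _ _ => 1) th' ps'
       + C * kint n (fun th ps => 1 - xdot th' ps' th ps) th' ps').
  { unfold kint. rewrite <- !sint_scal, <- sint_minus, <- sint_plus; try (intros p; solve [cont]).
    apply sint_abs_le; try (intros p; solve [cont]).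
    intros th ps. assert (Hb := xdot_bound th' ps' th ps).
    assert (Hp : 0 <= (1 + xdot th' ps' th ps) ^ n) by (apply pow_le; lra).
    replace (_ - _) with ((1 + xdot th' ps' th ps) ^ n * (F th ps - F th' ps')) by ring.
    rewrite Rabs_mult, (Rabs_pos_eq _ Hp).
    eapply Rle_trans; [apply Rmult_le_compat_l; [exact Hp | apply Hmod]|].
    right; ring. }
  assert (H1 := kint_one n th' ps').
  assert (H2 := kint_defect n th' ps').
  replace (kmass n * kint n F th' ps' - 4 * PI * F th' ps') with
    (kmass n * (kint n F th' ps' - F th' ps' * kint n (fun _ _ => 1) th' ps'))
    by (rewrite <- H1; ring).
  rewrite Rabs_mult, (Rabs_pos_eq (kmass n)) by lra.
  eapply Rle_trans; [apply Rmult_le_compat_l; [lra | exact H]|].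
  replace (kmass n * (d * kint n (fun _ _ => 1) th' ps'
      + C * kint n (fun th ps => 1 - xdot th' ps' th ps) th' ps'))
    with (d * (kmass n * kint n (fun _ _ => 1) th' ps')
      + C * (kmass n * kint n (fun th ps => 1 - xdot th' ps' th ps) th' ps')) by ring.
  rewrite H1, H2.
  assert (Hd : d * (4 * PI) = e / 2) by (unfold d; field; lra).
  rewrite Hd.
  assert (Hn2 : 16 * PI * C / e < INR n + 2).
  { apply le_INR in Hn. rewrite S_INR in Hn. lra. }
  assert (C * (8 * PI / (INR n + 2)) <= e / 2); [|lra].
  assert (Hnp := pos_INR n).
  apply Rmult_le_reg_r with (INR n + 2); [lra|].
  replace (C * (8 * PI / (INR n + 2)) * (INR n + 2)) with (C * (8 * PI)) by (field; lra).
  apply (Rmult_lt_compat_r e) in Hn2; [|lra].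
  replace (16 * PI * C / e * e) with (16 * PI * C) in Hn2 by (field; lra). lra.
Qed.

Lemma kform_limit F G : cont2 F -> cont2 G -> sph_modulus F -> forall e, 0 < e ->
  exists N, forall n, (N <= n)%nat ->
    Rabs (kmass n * kform n F G - 4 * PI * sint (fun th ps => F th ps * G th ps)) <= e.
Proof.
  intros HF HG HM e He.
  assert (cG : cont2 (fun th ps => Rabs (G th ps))).
  { intros p. apply (cont_comp Rabs); [apply continuous_Rabs | cont]. }
  set (I := sint (fun th ps => Rabs (G th ps))).
  assert (HI : 0 <= I).
  { unfold I. rewrite <- (Rmult_0_r (4 * PI)), <- sint_const. apply sint_le; trivial.
    - intros p; cont.
    - intros; apply Rabs_pos. }
  destruct (kint_approximates F HF HM (e / (I + 1))) as [N HN].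
  { apply Rdiv_lt_0_compat; lra. }
  exists N. intros n Hn.
  assert (cK := cont2_kint n F HF).
  unfold kform. rewrite <- !sint_scal, <- sint_minus; try (intros p; solve [cont]).
  apply Rle_trans with (sint (fun th ps => e / (I + 1) * Rabs (G th ps))).
  - apply sint_abs_le; [intros p; cont | auto with cont2 |].
    intros th ps.
    replace (_ - _) with ((kmass n * kint n F th ps - 4 * PI * F th ps) * G th ps) by ring.
    rewrite Rabs_mult. apply Rmult_le_compat_r; [apply Rabs_pos | apply HN, Hn].
  - rewrite sint_scal by trivial. fold I.
    apply Rmult_le_reg_r with (I + 1); [lra|].
    replace (e / (I + 1) * I * (I + 1)) with (e * I) by (field; lra). nra.
Qed.

Definition orth (F G : R -> R -> R) : Prop := sint (fun th ps => F th ps * G th ps) = 0.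

(* The eigenvalue gap above first order harmonics.  For the forms [u n = kmass n * kform n F F],
   [v n] (with [-L F] in one slot) and [w n] (in both slots), [kform_laplacian] gives
   [v n = n(n+1) (u n - u (n-1))] and [w n = n(n+1) (v n - v (n-1))], so that
   [(n(n+1) - 6) (v n - 6 u n) = n(n+1) (v (n-1) - 6 u (n-1)) + (w n - 12 v n + 36 u n)]. *)
Lemma kform_gap F p k A D : sph_fun F p k A D -> sint F = 0 ->
  orth x1 F -> orth x2 F -> orth x3 F -> forall n, (1 <= n)%nat ->
  6 * (kmass n * kform n F F) <= - (kmass n * kform n (fun th ps => A th ps + D th ps) F).
Proof.
  intros HF H0 H1 H2 H3.
  assert (cF := sf_cF _ _ _ _ _ HF). assert (cA := sf_cA _ _ _ _ _ HF).
  assert (cD := sf_cD _ _ _ _ _ HF).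
  set (L := fun th ps => A th ps + D th ps).
  assert (cL : cont2 L) by (unfold L; auto with cont2).
  set (u := fun n => kmass n * kform n F F).
  set (v := fun n => - (kmass n * kform n L F)).
  set (w := fun n => kmass n * kform n L L).
  (* With the normalisation both coefficients of [kform_laplacian] become equal up to sign, so the
     Laplacian acts as a difference in [n]. *)
  assert (Hrec : forall n G, cont2 G -> kmass (S n) * kform (S n) L G =
     - (INR (S n) * (INR (S n) + 1)) * (kmass (S n) * kform (S n) F G - kmass n * kform n F G)).
  { intros n G HG. unfold L. rewrite (kform_laplacian (S n) _ _ _ _ _ _ HF HG). simpl pred.
    replace (- (INR (S n) * (INR (S n) + 1)) * (kmass (S n) * kform (S n) F G - kmass n * kform n F G))
      with (- (INR (S n) * (INR (S n) + 1)) * (kmass (S n) * kform (S n) F G)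
        + INR (S n) * ((INR (S n) + 1) * kmass n) * kform n F G) by ring.
    rewrite <- kmass_succ. ring. }
  assert (Hv : forall n, v (S n) = INR (S n) * (INR (S n) + 1) * (u (S n) - u n)).
  { intros n. unfold v, u. rewrite Hrec by trivial. ring. }
  assert (Hw : forall n, w (S n) = INR (S n) * (INR (S n) + 1) * (v (S n) - v n)).
  { intros n. unfold v, w. rewrite Hrec by trivial.
    rewrite (kform_sym (S n) F L), (kform_sym n F L) by trivial. ring. }
  assert (Hpsd : forall n, 0 <= w n - 12 * v n + 36 * u n).
  { intros n. assert (H := kform_nonneg n (fun th ps => L th ps + 6 * F th ps) ltac:(auto with cont2)).
    rewrite kform_lin_l, !kform_lin_r, (kform_sym n F L) in H by auto with cont2.
    assert (Hk := kmass_pos n). unfold u, v, w.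
    apply (Rmult_le_compat_l (kmass n)) in H; [|lra]. lra. }
  (* The form of degree 0 is the square of the integral of [F]; degree 1 adds the squares of its
     first moments. *)
  assert (Hu0 : u 0%nat = 0).
  { unfold u. rewrite kform_0, H0 by trivial. ring. }
  assert (Hu1 : u 1%nat = 0).
  { unfold u. rewrite kform_succ, !kform_0, H0 by auto with cont2.
    unfold orth in *. rewrite H1, H2, H3. ring. }
  (* At level 1 both sides vanish. At level 2 the factor [n (n + 1)] is 6 and equality holds. From
     level 3 on the factor is at least 12, so [m - 6] is positive and the recursion propagates the
     bound. *)
  assert (Hmain : forall n, 6 * u (S n) <= v (S n)).
  { induction n as [|[|n] IH].
    - rewrite Hv, Hu0, Hu1. lra.
    - rewrite Hv, Hu1. rewrite !S_INR. simpl. lra.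
    - assert (Hp := Hpsd (S (S (S n)))). assert (HV := Hv (S (S n))). assert (HW := Hw (S (S n))).
      set (m := INR (S (S (S n))) * (INR (S (S (S n))) + 1)) in *.
      assert (Hm : 12 <= m).
      { unfold m. rewrite !S_INR. assert (Hn := pos_INR n). nra. }
      apply Rmult_le_reg_l with (m - 6); [lra|].
      assert (Hk : (m - 6) * (v (S (S (S n))) - 6 * u (S (S (S n)))) =
         m * (v (S (S n)) - 6 * u (S (S n)))
         + (w (S (S (S n))) - 12 * v (S (S (S n))) + 36 * u (S (S (S n))))).
      { rewrite HW.
        replace (36 * u (S (S (S n)))) with (36 * u (S (S (S n)))
           + 6 * (v (S (S (S n))) - m * (u (S (S (S n))) - u (S (S n))))) by (rewrite <- HV; ring).
        ring. }
      nra. }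
  intros [|n] Hn; [lia | apply Hmain].
Qed.

(** The limit of [kform_gap] as the kernels concentrate on the diagonal. *)
Lemma spectral_gap F p k A D : sph_fun F p k A D -> sph_modulus F -> sint F = 0 ->
  orth x1 F -> orth x2 F -> orth x3 F ->
  6 * sint (fun th ps => F th ps * F th ps) <= - sint (fun th ps => F th ps * (A th ps + D th ps)).
Proof.
  intros HF HM H0 H1 H2 H3.
  assert (cF := sf_cF _ _ _ _ _ HF). assert (cA := sf_cA _ _ _ _ _ HF).
  assert (cD := sf_cD _ _ _ _ _ HF).
  assert (cL : cont2 (fun th ps => A th ps + D th ps)) by auto with cont2.
  apply Rle_plus_epsilon. intros e He.
  assert (HPI := PI_RGT_0).
  (* The first limit is used with the factor 6 and the second with the factor 1, hence the
     sevenths. *)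
  destruct (kform_limit F F cF cF HM (4 * PI * e / 7)) as [N1 HN1]; [nra|].
  destruct (kform_limit F _ cF cL HM (4 * PI * e / 7)) as [N2 HN2]; [nra|].
  set (n := S (N1 + N2)).
  assert (Hg := kform_gap _ _ _ _ _ HF H0 H1 H2 H3 n ltac:(lia)).
  assert (Hl1 := HN1 n ltac:(lia)). assert (Hl2 := HN2 n ltac:(lia)).
  (* [kform_limit] takes a modulus of continuity for its first slot, and it is [F] that comes with
     one. *)
  rewrite (kform_sym n (fun th ps => A th ps + D th ps) F) in Hg by trivial.
  apply Rabs_le_between in Hl1. apply Rabs_le_between in Hl2.
  apply Rmult_le_reg_l with (4 * PI); [lra|]. nra.
Qed.

(** Young's inequality [C |y| <= d / 3 + 3 C^2 / (4 d) y^2] in each coordinate; the three squares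
    sum to [2 (1 - x.y)]. *)
Lemma lipschitz_modulus F C : 0 <= C ->
  (forall th' ps' th ps, Rabs (F th ps - F th' ps') <=
     C * (Rabs (x1 th ps - x1 th' ps') + Rabs (x2 th ps - x2 th' ps') + Rabs (x3 th ps - x3 th' ps'))) ->
  sph_modulus F.
Proof.
  intros HC HL d Hd.
  exists (3 * C ^ 2 / (2 * d)). split.
  { apply Rmult_le_pos; [nra | left; apply Rinv_0_lt_compat; lra]. }
  intros th' ps' th ps.
  eapply Rle_trans; [apply HL|].
  assert (Hs : (x1 th ps - x1 th' ps') ^ 2 + (x2 th ps - x2 th' ps') ^ 2 + (x3 th ps - x3 th' ps') ^ 2
     = 2 * (1 - xdot th' ps' th ps)).
  { assert (H1 := x_unit th ps). assert (H2 := x_unit th' ps').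
    unfold xdot, lin. fold (x1 th ps) (x2 th ps) (x3 th ps). nra. }
  assert (HA : forall y, C * Rabs y <= d / 3 + 3 * C ^ 2 / (4 * d) * y ^ 2).
  { intros y. rewrite <- (pow2_abs y). apply Rmult_le_reg_l with (12 * d); [lra|].
    replace (12 * d * (d / 3 + 3 * C ^ 2 / (4 * d) * Rabs y ^ 2)) with
      (4 * d ^ 2 + 9 * C ^ 2 * Rabs y ^ 2) by (field; lra).
    assert (H := pow2_ge_0 (2 * d - 3 * C * Rabs y)). lra. }
  assert (HA1 := HA (x1 th ps - x1 th' ps')). assert (HA2 := HA (x2 th ps - x2 th' ps')).
  assert (HA3 := HA (x3 th ps - x3 th' ps')).
  replace (3 * C ^ 2 / (2 * d) * (1 - xdot th' ps' th ps)) with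
    (3 * C ^ 2 / (4 * d) * (2 * (1 - xdot th' ps' th ps))) by (field; lra).
  rewrite <- Hs. lra.
Qed.

Lemma sph_modulus_plus F G : sph_modulus F -> sph_modulus G ->
  sph_modulus (fun th ps => F th ps + G th ps).
Proof.
  intros HF HG d Hd.
  destruct (HF (d / 2)) as [C [HC HC']]; [lra|].
  destruct (HG (d / 2)) as [E [HE HE']]; [lra|].
  exists (C + E). split; [lra|]. intros th' ps' th ps.
  replace (_ - _) with ((F th ps - F th' ps') + (G th ps - G th' ps')) by ring.
  eapply Rle_trans; [apply Rabs_triang|].
  specialize (HC' th' ps' th ps). specialize (HE' th' ps' th ps). lra.
Qed.

Lemma sph_modulus_const c : sph_modulus (fun _ _ => c).
Proof.
  intros d Hd. exists 0. split; [lra|]. intros. rewrite Rminus_diag, Rabs_R0. lra.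
Qed.

Lemma sph_modulus_lin a b c : sph_modulus (lin a b c).
Proof.
  apply lipschitz_modulus with (Rabs a + Rabs b + Rabs c).
  { assert (H1 := Rabs_pos a). assert (H2 := Rabs_pos b). assert (H3 := Rabs_pos c). lra. }
  intros th' ps' th ps. unfold lin. fold (x1 th ps) (x2 th ps) (x3 th ps) (x1 th' ps') (x2 th' ps') (x3 th' ps').
  set (y1 := x1 th ps - x1 th' ps'). set (y2 := x2 th ps - x2 th' ps'). set (y3 := x3 th ps - x3 th' ps').
  replace (_ - _) with (a * y1 + b * y2 + c * y3) by (unfold y1, y2, y3; ring).
  eapply Rle_trans; [apply Rabs_triang|].
  assert (H := Rabs_triang (a * y1) (b * y2)).
  rewrite !Rabs_mult in *.
  assert (Ha := Rabs_pos a). assert (Hb := Rabs_pos b). assert (Hc := Rabs_pos c).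
  assert (H1 := Rabs_pos y1). assert (H2 := Rabs_pos y2). assert (H3 := Rabs_pos y3). nra.
Qed.

(** * Splitting off the harmonics of degree 0 and 1 *)

Lemma sint_lin a b c : sint (lin a b c) = 0.
Proof.
  assert (H := green_sym _ _ _ _ _ _ _ _ _ _ (sph_fun_lin a b c) (sph_fun_const 1)).
  rewrite (sint_ext _ (fun th ps => -2 * lin a b c th ps)) in H by (intros; ring).
  rewrite (sint_ext (fun th ps => lin a b c th ps * (0 + 0)) (fun _ _ => 0)) in H by (intros; ring).
  rewrite sint_scal, sint_const in H by auto with cont2. lra.
Qed.

(** Green's formula gives [2 int l l' = int <grad l, grad l'>], while [lin_frame] makes
    [l l' + <grad l, grad l'>] constant; together they determine the integral. *)
Lemma sint_lin_lin a b c a' b' c' :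
  sint (fun th ps => lin a b c th ps * lin a' b' c' th ps) = 4 * PI / 3 * (a * a' + b * b' + c * c').
Proof.
  assert (H := green _ _ _ _ _ _ _ _ _ _ (sph_fun_lin a' b' c') (sph_fun_lin a b c)).
  rewrite (sint_ext (fun th ps => _ * (_ + _)) (fun th ps => -2 * (lin a b c th ps * lin a' b' c' th ps))) in H
    by (intros; ring).
  rewrite (sint_ext (fun th ps => lin1 _ _ _ th ps * _ + _)
    (fun th ps => (a * a' + b * b' + c * c') + -1 * (lin a b c th ps * lin a' b' c' th ps))) in H.
  2: { intros. rewrite <- (lin_frame a b c th ps a' b' c'). ring. }
  rewrite sint_plus, !sint_scal, sint_const in H; auto with cont2.
  2: { intros p; cont. }
  lra.
Qed.

(** The spectral polynomial [(lambda - 2) (lambda - 6 tau)] equals [(lambda - 6)^2 + (10 - 6 tau)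
    (lambda - 6) + 24 (1 - tau)]: a square, the gap with a positive coefficient, and a nonnegative
    multiple of the mass. *)
Lemma sphere_inequality_orth F p k A D tau : sph_fun F p k A D -> sph_modulus F -> sint F = 0 ->
  orth x1 F -> orth x2 F -> orth x3 F -> 0 <= tau <= 1 ->
  0 <= sint (fun th ps => (A th ps + D th ps) ^ 2 + (2 + 6 * tau) * (F th ps * (A th ps + D th ps))
       + 12 * tau * (F th ps * F th ps)).
Proof.
  intros HF HM H0 H1 H2 H3 Htau.
  assert (cF := sf_cF _ _ _ _ _ HF). assert (cA := sf_cA _ _ _ _ _ HF).
  assert (cD := sf_cD _ _ _ _ _ HF).
  assert (Hgap := spectral_gap _ _ _ _ _ HF HM H0 H1 H2 H3).
  assert (Hsq : 0 <= sint (fun th ps => (A th ps + D th ps + 6 * F th ps) ^ 2)).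
  { rewrite <- (Rmult_0_r (4 * PI)), <- sint_const. apply sint_le; try (intros v; solve [cont]).
    intros; apply pow2_ge_0. }
  assert (HF2 : 0 <= sint (fun th ps => F th ps * F th ps)).
  { rewrite <- (Rmult_0_r (4 * PI)), <- sint_const. apply sint_le; try (intros v; solve [cont]).
    intros; nra. }
  rewrite (sint_ext _ (fun th ps => (A th ps + D th ps + 6 * F th ps) ^ 2
     + (-(10 - 6 * tau)) * (F th ps * (A th ps + D th ps)) + (-(36 - 12 * tau)) * (F th ps * F th ps)))
    by (intros; ring).
  rewrite !sint_plus, !sint_scal by (intros v; cont).
  nra.
Qed.

(* In spectral terms, [(lambda - 2) (lambda - 6 tau) >= 0] for the eigenvalues [lambda] in
   [{0, 2, 6, 12, ...}] of minus the Laplacian. *)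
Lemma sphere_inequality F p k A D tau : sph_fun F p k A D -> sph_modulus F -> 0 <= tau <= 1 ->
  0 <= sint (fun th ps => (A th ps + D th ps) ^ 2 - (2 + 6 * tau) * (p th ps ^ 2 + k th ps ^ 2)
       + 12 * tau * F th ps ^ 2).
Proof.
  intros HF HM Htau.
  assert (cF := sf_cF _ _ _ _ _ HF). assert (cA := sf_cA _ _ _ _ _ HF).
  assert (cD := sf_cD _ _ _ _ _ HF). assert (cp := sf_cp _ _ _ _ _ HF).
  assert (ck := sf_ck _ _ _ _ _ HF).
  assert (HPI := PI_RGT_0).
  (* [m] is the mean and the [b_i] are the projection coefficients onto the [x_i], whose squares
     integrate to [4 PI / 3]; [h] is the remaining component. *)
  set (m := sint F / (4 * PI)).
  set (b1 := 3 / (4 * PI) * sint (fun th ps => x1 th ps * F th ps)).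
  set (b2 := 3 / (4 * PI) * sint (fun th ps => x2 th ps * F th ps)).
  set (b3 := 3 / (4 * PI) * sint (fun th ps => x3 th ps * F th ps)).
  assert (HH := sph_fun_plus _ _ _ _ _ _ _ _ _ _
     (sph_fun_plus _ _ _ _ _ _ _ _ _ _ HF (sph_fun_const (- m))) (sph_fun_lin (- b1) (- b2) (- b3))).
  assert (HHM := sph_modulus_plus _ _ (sph_modulus_plus _ _ HM (sph_modulus_const (- m)))
     (sph_modulus_lin (- b1) (- b2) (- b3))).
  cbv beta in HH, HHM.
  set (h := fun th ps => F th ps + - m + lin (- b1) (- b2) (- b3) th ps) in *.
  assert (ch := sf_cF _ _ _ _ _ HH).
  assert (Hlin : forall a b c, sint (fun th ps => lin a b c th ps * h th ps) =
     a * (sint (fun th ps => x1 th ps * F th ps) - 4 * PI / 3 * b1)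
     + b * (sint (fun th ps => x2 th ps * F th ps) - 4 * PI / 3 * b2)
     + c * (sint (fun th ps => x3 th ps * F th ps) - 4 * PI / 3 * b3)).
  { intros a b c.
    rewrite (sint_ext _ (fun th ps => a * (x1 th ps * F th ps) + b * (x2 th ps * F th ps)
      + c * (x3 th ps * F th ps) + (- m) * lin a b c th ps
      + lin a b c th ps * lin (- b1) (- b2) (- b3) th ps))
      by (intros; unfold h, lin, x1, x2, x3; ring).
    rewrite !sint_plus, !sint_scal, sint_lin, sint_lin_lin by auto 10 with cont2. field. }
  assert (Hb : forall a b c, sint (fun th ps => lin a b c th ps * h th ps) = 0).
  { intros a b c. rewrite Hlin. unfold b1, b2, b3. field. lra. }
  assert (h0 : sint h = 0).
  { unfold h. rewrite !sint_plus, sint_lin, sint_const; auto with cont2.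
    - unfold m. field. lra.
    - intros v; cont.
    - intros v; cont. }
  assert (h1 : orth x1 h).
  { unfold orth. rewrite <- (Hb 1 0 0). apply sint_ext. intros; unfold lin, x1; ring. }
  assert (h2 : orth x2 h).
  { unfold orth. rewrite <- (Hb 0 1 0). apply sint_ext. intros; unfold lin, x2; ring. }
  assert (h3 : orth x3 h).
  { unfold orth. rewrite <- (Hb 0 0 1). apply sint_ext. intros; unfold lin, x3; ring. }
  assert (Hineq := sphere_inequality_orth _ _ _ _ _ tau HH HHM h0 h1 h2 h3 Htau).
  assert (HG := green _ _ _ _ _ _ _ _ _ _ HF HF).
  assert (HL := green_sym _ _ _ _ _ _ _ _ _ _ HF (sph_fun_const 1)).
  cbv beta in HL.
  rewrite (sint_ext (fun th ps => F th ps * (0 + 0)) (fun _ _ => 0)) in HL by (intros; ring).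
  rewrite sint_const in HL.
  assert (Hl := green_sym _ _ _ _ _ _ _ _ _ _ HF (sph_fun_lin b1 b2 b3)).
  cbv beta in HL, Hl.
  assert (Hh := Hb b1 b2 b3).
  set (l := lin b1 b2 b3) in *.
  assert (cl : cont2 l) by apply cont2_lin.
  assert (Hl' : sint (fun th ps => l th ps * (A th ps + D th ps)) + 2 * sint (fun th ps => l th ps * F th ps) = 0).
  { rewrite Hl, <- sint_scal, <- sint_plus by (intros v; cont).
    rewrite (sint_ext _ (fun _ _ => 0)) by (intros; ring). rewrite sint_const; ring. }
  cbv beta in Hineq.
  set (E := fun th ps => _) in Hineq.
  assert (cE : cont2 E).
  { assert (clm := cont2_lin (- b1) (- b2) (- b3)). unfold E. intros v; cont. }
  (* The form splits along the decomposition: degree 1 contributes nothing because 2 is a root of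
     the spectral polynomial, and degree 0 contributes the nonnegative [48 PI tau m^2]. *)
  assert (HE : forall th ps, (A th ps + D th ps) ^ 2 + (2 + 6 * tau) * (F th ps * (A th ps + D th ps))
       + 12 * tau * (F th ps * F th ps) = E th ps
      + (6 * tau - 2) * (l th ps * (A th ps + D th ps) + 2 * (l th ps * F th ps))
      + (2 + 6 * tau) * m * (1 * (A th ps + D th ps))
      + (4 + 12 * tau) * m * l th ps
      + 24 * tau * m * h th ps + 12 * tau * m * m).
  { intros th ps. unfold E, h.
    replace (lin (- b1) (- b2) (- b3) th ps) with (- l th ps) by (unfold l, lin; ring). ring. }
  assert (HEint : sint (fun th ps => (A th ps + D th ps) ^ 2
       + (2 + 6 * tau) * (F th ps * (A th ps + D th ps)) + 12 * tau * (F th ps * F th ps)) =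
     sint E + 48 * PI * tau * (m * m)).
  { rewrite (sint_ext _ _ HE).
    repeat (rewrite ?sint_plus, ?sint_scal by (intros v; cont)).
    rewrite sint_scal, sint_plus in HL by (intros v; cont).
    replace (sint A) with (- sint D) by lra.
    replace (sint l) with 0 by (symmetry; apply sint_lin).
    rewrite sint_const, h0.
    replace (sint (fun th ps => l th ps * (A th ps + D th ps))) with
      (- (2 * sint (fun th ps => l th ps * F th ps))) by lra.
    ring. }
  assert (Hfin : sint (fun th ps => (A th ps + D th ps) ^ 2 - (2 + 6 * tau) * (p th ps ^ 2 + k th ps ^ 2)
       + 12 * tau * F th ps ^ 2) = sint E + 48 * PI * tau * (m * m)).
  { rewrite <- HEint.
    rewrite (sint_ext _ (fun th ps => (A th ps + D th ps) ^ 2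
      + -(2 + 6 * tau) * (p th ps * p th ps + k th ps * k th ps) + 12 * tau * (F th ps * F th ps)))
      by (intros; ring).
    repeat (rewrite ?sint_plus, ?sint_scal by (intros v; cont)).
    rewrite HG, sint_plus by (intros v; cont). ring. }
  rewrite Hfin.
  assert (0 <= PI * tau) by nra. nra.
Qed.

(** * Geometry of radial graphs *)

(* The vector with coordinates [a], [b], [c] in the orthonormal frame [X, e1, e2], [X = e1 x e2]. *)
Definition fr (th ps a b c : R) : V3 :=
  (a * (sin th * cos ps) + b * (cos th * cos ps) - c * sin ps,
   a * (sin th * sin ps) + b * (cos th * sin ps) + c * cos ps,
   a * cos th - b * sin th).

Lemma dot_fr th ps a b c a' b' c' :
  dot (fr th ps a b c) (fr th ps a' b' c') = a * a' + b * b' + c * c'.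
Proof.
  unfold dot, fr. ring_simplify.
  rewrite ?(sin_sqr th).
  rewrite ?(sin_sqr ps).
  ring.
Qed.

Lemma cross_fr th ps a b c a' b' c' :
  cross (fr th ps a b c) (fr th ps a' b' c') =
  fr th ps (b * c' - c * b') (c * a' - a * c') (a * b' - b * a').
Proof.
  unfold cross, fr. f_equal; [f_equal|]; ring_simplify;
  rewrite ?(sin_sqr th);
  rewrite ?(sin_sqr ps);
  ring.
Qed.

Lemma scale3_fr th ps m a b c : scale3 m (fr th ps a b c) = fr th ps (m * a) (m * b) (m * c).
Proof. unfold scale3, fr. f_equal; [f_equal|]; ring. Qed.

Lemma der_mult (f g : R -> R) x l l' : is_derive f x l -> is_derive g x l' ->
  is_derive (fun y => f y * g y) x (l * g x + f x * l').
Proof. intros Hf Hg. apply (is_derive_mult f g); trivial. intros; apply Rmult_comm. Qed.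

Lemma der_plus (f g : R -> R) x l l' : is_derive f x l -> is_derive g x l' ->
  is_derive (fun y => f y + g y) x (l + l').
Proof. intros Hf Hg. apply (is_derive_plus (V := R_NormedModule) f g); trivial. Qed.

Lemma der_minus (f g : R -> R) x l l' : is_derive f x l -> is_derive g x l' ->
  is_derive (fun y => f y - g y) x (l - l').
Proof. intros Hf Hg. apply (is_derive_minus (V := R_NormedModule) f g); trivial. Qed.

Lemma der_eq (f : R -> R) (x l l' : R) : is_derive f x l -> l = l' -> is_derive f x l'.
Proof. intros H <-. exact H. Qed.

Lemma Derive3_unique (f : R -> V3) x l1 l2 l3 :
  is_derive (fun a => fst (fst (f a))) x l1 -> is_derive (fun a => snd (fst (f a))) x l2 ->
  is_derive (fun a => snd (f a)) x l3 -> Derive3 f x = (l1, l2, l3).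
Proof.
  intros H1 H2 H3. unfold Derive3.
  apply (f_equal2 pair); [apply (f_equal2 pair)|]; apply is_derive_unique; assumption.
Qed.

Ltac der :=
  repeat match goal with
  | |- is_derive (fun y => @?f y + @?g y) _ _ => apply (der_plus f g)
  | |- is_derive (fun y => @?f y - @?g y) _ _ => apply (der_minus f g)
  | |- is_derive (fun y => @?f y * @?g y) _ _ => apply (der_mult f g)
  | |- is_derive (fun y => sin y) _ _ => apply is_derive_sin
  | |- is_derive (fun y => cos y) _ _ => apply is_derive_cos
  | |- is_derive (fun _ => ?c) _ _ => apply (is_derive_const (V := R_NormedModule))
  | |- is_derive _ _ _ => eassumption
  end.

(** In the direction of theta the frame moves by [X' = e1], [e1' = - X], [e2' = 0]. *)
Lemma Derive3_fr_th (a b c : R -> R) th ps a' b' c' :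
  is_derive a th a' -> is_derive b th b' -> is_derive c th c' ->
  Derive3 (fun s => fr s ps (a s) (b s) (c s)) th = fr th ps (a' - b th) (b' + a th) c'.
Proof.
  intros Ha Hb Hc. apply Derive3_unique; unfold fr; simpl; (eapply der_eq; [der | unfold zero; simpl; ring]).
Qed.

(** In the direction of psi the frame moves by [X' = sin th e2], [e1' = cos th e2],
    [e2' = - sin th X - cos th e1]. *)
Lemma Derive3_fr_ps (a b c : R -> R) th ps a' b' c' :
  is_derive a ps a' -> is_derive b ps b' -> is_derive c ps c' ->
  Derive3 (fun s => fr th s (a s) (b s) (c s)) ps =
  fr th ps (a' - sin th * c ps) (b' - cos th * c ps) (c' + sin th * a ps + cos th * b ps).
Proof.
  intros Ha Hb Hc.
  assert (Hs := sincos2 th).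
  apply Derive3_unique; unfold fr; simpl; eapply der_eq.
  1,3,5: der.
  all: unfold zero; simpl.
  - transitivity ((a' * sin th + b' * cos th - c ps * (sin th * sin th + cos th * cos th)) * cos ps
      - (a ps * sin th + b ps * cos th + c') * sin ps); [rewrite Hs|]; ring.
  - transitivity ((a' * sin th + b' * cos th - c ps * (sin th * sin th + cos th * cos th)) * sin ps
      + (a ps * sin th + b ps * cos th + c') * cos ps); [rewrite Hs|]; ring.
  - ring.
Qed.

Lemma Derive3_fr_t (a b c : R -> R) th ps t a' b' c' :
  is_derive a t a' -> is_derive b t b' -> is_derive c t c' ->
  Derive3 (fun s => fr th ps (a s) (b s) (c s)) t = fr th ps a' b' c'.
Proof.
  intros Ha Hb Hc. apply Derive3_unique; unfold fr; simpl; (eapply der_eq; [der | unfold zero; simpl; ring]).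
Qed.

(** [B] is the mixed entry of the Hessian in the frame, and [cos th * k] in [rd_pps] comes from the
    rotation of the frame. [rd_t] is restricted to the open interval because data frozen outside
    [[0, T]] may have corners at its ends. *)
Record radial_data (T : R) (F Ft p k A B D : R -> R -> R -> R) : Prop := {
  rd_sph : forall t, 0 <= t <= T -> sph_fun (fun th ps => F th ps t) (fun th ps => p th ps t)
    (fun th ps => k th ps t) (fun th ps => A th ps t) (fun th ps => D th ps t);
  rd_pps : forall th ps t, 0 <= t <= T ->
    is_derive (fun a => p th a t) ps (sin th * B th ps t + cos th * k th ps t);
  rd_t : forall th ps t, 0 < t < T -> is_derive (fun a => F th ps a) t (Ft th ps t) }.

(** The density with respect to the round area measure. The graph has area element [r W sin th],
    normal velocity [- rt r / W], and mean curvature equal to the squared numerator's base divided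
    by [r W^3]. *)
Definition radial_density (r rt p k A B D : R) : R :=
  let W := sqrt (r ^ 2 + p ^ 2 + k ^ 2) in
  rt ^ 2 * r ^ 3 / W +
  (2 * r ^ 3 + 3 * r * (p ^ 2 + k ^ 2)
   - (r ^ 2 * (A + D) + k ^ 2 * A - 2 * p * k * B + p ^ 2 * D)) ^ 2 / (r * W ^ 5).

Lemma radial_integrand r T F Ft p k A B D th ps t : radial_data T F Ft p k A B D ->
  (forall th ps t, 0 <= t <= T -> r (sph th ps) t = F th ps t) ->
  0 < t < T -> 0 < th < PI -> 0 < F th ps t ->
  ((normal_velocity (radial_graph r) th ps t) ^ 2 + (mean_curvature (radial_graph r) th ps t) ^ 2)
    * sqrt (detg (radial_graph r) th ps t) =
  radial_density (F th ps t) (Ft th ps t) (p th ps t) (k th ps t) (A th ps t) (B th ps t) (D th ps t)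
    * sin th.
Proof.
  intros HD Hr Ht Hth HF.
  assert (Ht' : 0 <= t <= T) by lra.
  destruct (rd_sph _ _ _ _ _ _ _ _ HD t Ht') as [_ _ _ _ _ Fth Fps pth kps _ _].
  assert (pps := fun th ps => rd_pps _ _ _ _ _ _ _ _ HD th ps t Ht').
  set (phi := radial_graph r).
  assert (Hc : forall th ps s, 0 <= s <= T -> chart phi th ps s = fr th ps (F th ps s) 0 0).
  { intros th' ps' s Hs. unfold chart, phi, radial_graph. rewrite Hr by trivial.
    unfold sph, scale3, fr. f_equal; [f_equal|]; ring. }
  assert (Hdth : forall th ps, d_th phi th ps t = fr th ps (p th ps t) (F th ps t) 0).
  { intros th' ps'. unfold d_th.
    rewrite (functional_extensionality (fun a => chart phi a ps' t)
      (fun a => fr a ps' (F a ps' t) 0 0)) by (intros; apply Hc, Ht').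
    rewrite (Derive3_fr_th (fun a => F a ps' t) (fun _ => 0) (fun _ => 0) th' ps' (p th' ps' t) 0 0);
      [f_equal; ring | apply Fth | apply (is_derive_const (V := R_NormedModule)) .. ]. }
  assert (Hdps : forall th ps, d_ps phi th ps t = fr th ps (sin th * k th ps t) 0 (sin th * F th ps t)).
  { intros th' ps'. unfold d_ps.
    rewrite (functional_extensionality (fun a => chart phi th' a t)
      (fun a => fr th' a (F th' a t) 0 0)) by (intros; apply Hc, Ht').
    rewrite (Derive3_fr_ps (fun a => F th' a t) (fun _ => 0) (fun _ => 0) th' ps' (sin th' * k th' ps' t) 0 0);
      [f_equal; ring | apply Fps | apply (is_derive_const (V := R_NormedModule)) .. ]. }
  (* The formula for the chart holds for times in [[0, T]], so in this variable it is used near [t]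
     instead of as an equality of functions. *)
  assert (Hdt : d_t phi th ps t = fr th ps (Ft th ps t) 0 0).
  { unfold d_t.
    transitivity (Derive3 (fun s => fr th ps (F th ps s) 0 0) t).
    - assert (Hloc : locally t (fun s => chart phi th ps s = fr th ps (F th ps s) 0 0)).
      { assert (Hd : 0 < Rmin t (T - t)) by (apply Rmin_pos; lra).
        exists (mkposreal _ Hd). intros s Hs.
        change (Rabs (s - t) < Rmin t (T - t)) in Hs. apply Rabs_def2 in Hs.
        assert (H1 := Rmin_l t (T - t)). assert (H2 := Rmin_r t (T - t)).
        apply Hc. lra. }
      unfold Derive3. f_equal; [f_equal|]; apply Derive_ext_loc;
      (eapply filter_imp; [|exact Hloc]); intros s Hs; cbv beta in Hs; rewrite Hs; reflexivity.
    - apply (Derive3_fr_t (fun s => F th ps s) (fun _ => 0) (fun _ => 0));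
        [apply (rd_t _ _ _ _ _ _ _ _ HD); trivial | apply (is_derive_const (V := R_NormedModule)) ..]. }
  assert (Hdthth : d_thth phi th ps t = fr th ps (A th ps t - F th ps t) (2 * p th ps t) 0).
  { unfold d_thth.
    rewrite (functional_extensionality (fun a => d_th phi a ps t)
      (fun a => fr a ps (p a ps t) (F a ps t) 0)) by (intros; apply Hdth).
    rewrite (Derive3_fr_th (fun a => p a ps t) (fun a => F a ps t) (fun _ => 0) th ps (A th ps t) (p th ps t) 0);
      [f_equal; ring | apply pth | apply Fth | apply (is_derive_const (V := R_NormedModule)) ]. }
  assert (Hdthps : d_thps phi th ps t = fr th ps (sin th * B th ps t + cos th * k th ps t)
     (sin th * k th ps t) (sin th * p th ps t + cos th * F th ps t)).
  { unfold d_thps.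
    rewrite (functional_extensionality (fun a => d_th phi th a t)
      (fun a => fr th a (p th a t) (F th a t) 0)) by (intros; apply Hdth).
    rewrite (Derive3_fr_ps (fun a => p th a t) (fun a => F th a t) (fun _ => 0) th ps
        (sin th * B th ps t + cos th * k th ps t) (sin th * k th ps t) 0);
      [f_equal; ring | apply pps | apply Fps | apply (is_derive_const (V := R_NormedModule)) ]. }
  assert (Hdpsps : d_psps phi th ps t =
     fr th ps (sin th * (sin th * D th ps t - cos th * p th ps t) - sin th * (sin th * F th ps t))
       (- cos th * (sin th * F th ps t)) (2 * (sin th * (sin th * k th ps t)))).
  { unfold d_psps.
    rewrite (functional_extensionality (fun a => d_ps phi th a t)
      (fun a => fr th a (sin th * k th a t) 0 (sin th * F th a t))) by (intros; apply Hdps).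
    rewrite (Derive3_fr_ps (fun a => sin th * k th a t) (fun _ => 0) (fun a => sin th * F th a t) th ps
        (sin th * (sin th * D th ps t - cos th * p th ps t)) 0 (sin th * (sin th * k th ps t)));
      [f_equal; ring | apply is_derive_scal, kps | apply (is_derive_const (V := R_NormedModule))
      | apply is_derive_scal, Fps]. }
  assert (Hs : 0 < sin th) by (apply sin_gt_0; apply Hth).
  unfold normal_velocity, mean_curvature, detg, h11, h12, h22, g11, g12, g22, normal.
  rewrite !Hdth, !Hdps, Hdt, Hdthth, Hdthps, Hdpsps, cross_fr.
  unfold norm3. rewrite !dot_fr, scale3_fr, !dot_fr.
  clear - HF Hs. unfold radial_density.
  generalize dependent (F th ps t). intros r HF.
  generalize (Ft th ps t) (p th ps t) (k th ps t) (A th ps t) (B th ps t) (D th ps t).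
  intros rt q l a b d. generalize dependent (sin th). intros s Hs. generalize (cos th). intros c.
  set (W := sqrt (r ^ 2 + q ^ 2 + l ^ 2)).
  assert (HW2 : W * W = r ^ 2 + q ^ 2 + l ^ 2) by (apply sqrt_sqrt; nra).
  assert (HW : 0 < W) by (apply sqrt_lt_R0; nra).
  assert (Hsq : forall y, y = (r * s * W) * (r * s * W) -> sqrt y = r * s * W).
  { intros y ->. apply sqrt_square. left. repeat apply Rmult_lt_0_compat; trivial. }
  (* Lagrange's identity: [detg] is the squared length of the cross product, which is
     [r s (r X - q e1 - l e2)] and has length [r s W]. *)
  assert (E1 : (q * q + r * r + 0 * 0) * (s * l * (s * l) + 0 * 0 + s * r * (s * r)) -
    (q * (s * l) + r * 0 + 0 * (s * r)) ^ 2 = (r * s * W) * (r * s * W)).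
  { transitivity (r * r * s * s * (W * W)); [rewrite HW2|]; ring. }
  rewrite (Hsq _ E1), E1.
  rewrite Hsq.
  2: { transitivity (r * r * s * s * (W * W)); [rewrite HW2|]; ring. }
  set (X := 2 * r ^ 3 + 3 * r * (q ^ 2 + l ^ 2)
    - (r ^ 2 * (a + d) + l ^ 2 * a - 2 * q * l * b + q ^ 2 * d)).
  set (i := - / (r * s * W)).
  assert (Hv : rt * (i * (r * (s * r) - 0 * 0)) + 0 * (i * (0 * (s * l) - q * (s * r)))
      + 0 * (i * (q * 0 - r * (s * l))) = - (rt * r / W)).
  { unfold i. field. repeat split; lra. }
  rewrite Hv.
  match goal with |- (_ + (?M / _) ^ 2) * _ = _ =>
    replace M with (- i * (r ^ 2 * s ^ 3 * X)) by (unfold X; ring) end.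
  unfold i. generalize X. intros Y. field. repeat split; lra.
Qed.

Lemma action_radial r T F Ft p k A B D : 0 < T -> radial_data T F Ft p k A B D ->
  (forall th ps t, 0 <= t <= T -> r (sph th ps) t = F th ps t) ->
  (forall th ps t, 0 <= t <= T -> 0 < F th ps t) ->
  action (radial_graph r) T = RInt (fun t => sint (fun th ps =>
    radial_density (F th ps t) (Ft th ps t) (p th ps t) (k th ps t)
      (A th ps t) (B th ps t) (D th ps t))) 0 T.
Proof.
  intros HT HD Hr HF. unfold action, area_integral, sint.
  assert (HPI := PI_RGT_0).
  apply RInt_ext. intros t Ht. rewrite Rmin_left, Rmax_right in Ht by lra.
  apply RInt_ext. intros th Hth. rewrite Rmin_left, Rmax_right in Hth by lra.
  apply RInt_ext. intros ps _.
  apply (radial_integrand r T); trivial. apply HF. lra.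
Qed.

(** * Uniform Taylor expansions *)

Section Jets.
Context {P : Type}.
Implicit Types f g : P -> R.
Implicit Types u v : P -> R -> R.

Definition bounded_fun f : Prop := exists M, forall x, Rabs (f x) <= M.

Lemma bounded_pos f : bounded_fun f -> exists M, 0 < M /\ forall x, Rabs (f x) <= M.
Proof.
  intros [M HM]. exists (Rabs M + 1). assert (H := Rabs_pos M). split; [lra|].
  intros x. assert (H1 := HM x). assert (H2 := Rle_abs M). lra.
Qed.

Lemma bounded_const c : bounded_fun (fun _ => c).
Proof. exists (Rabs c). intros _. apply Rle_refl. Qed.

Lemma bounded_plus f g : bounded_fun f -> bounded_fun g -> bounded_fun (fun x => f x + g x).
Proof.
  intros [M HM] [N HN]. exists (M + N). intros x.
  eapply Rle_trans; [apply Rabs_triang|]. apply Rplus_le_compat; auto.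
Qed.

Lemma bounded_mult f g : bounded_fun f -> bounded_fun g -> bounded_fun (fun x => f x * g x).
Proof.
  intros Hf Hg. destruct (bounded_pos _ Hf) as [M [H0 HM]]. destruct (bounded_pos _ Hg) as [N [H1 HN]].
  exists (M * N). intros x. rewrite Rabs_mult.
  apply Rmult_le_compat; auto using Rabs_pos.
Qed.

Lemma bounded_opp f : bounded_fun f -> bounded_fun (fun x => - f x).
Proof. intros [M HM]. exists M. intros x. rewrite Rabs_Ropp. apply HM. Qed.

Lemma bounded_minus f g : bounded_fun f -> bounded_fun g -> bounded_fun (fun x => f x - g x).
Proof. intros. apply bounded_plus; trivial. apply bounded_opp; trivial. Qed.

Lemma bounded_pow f n : bounded_fun f -> bounded_fun (fun x => f x ^ n).
Proof.
  intros Hf. induction n; simpl; [apply bounded_const | apply bounded_mult; trivial].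
Qed.

Lemma bounded_inv f m : 0 < m -> (forall x, m <= f x) -> bounded_fun (fun x => / f x).
Proof.
  intros Hm Hf. exists (/ m). intros x. assert (H := Hf x).
  rewrite Rabs_pos_eq.
  - apply Rinv_le_contravar; trivial.
  - left. apply Rinv_0_lt_compat. lra.
Qed.

(** A second order expansion in [e] with cubic remainder, uniform over the parameters. Bounded
    coefficients and [d <= 1] are built in so that products of expansions remain expansions. *)
Definition jet u f0 f1 f2 : Prop :=
  bounded_fun f0 /\ bounded_fun f1 /\ bounded_fun f2 /\
  exists K d, 0 < d <= 1 /\ 0 <= K /\ forall x e, Rabs e <= d ->
    Rabs (u x e - (f0 x + e * f1 x + e ^ 2 * f2 x)) <= K * Rabs e ^ 3.

Lemma jet_ext u v f0 f1 f2 g0 g1 g2 : jet u f0 f1 f2 ->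
  (forall x e, u x e = v x e) -> (forall x, f0 x = g0 x) -> (forall x, f1 x = g1 x) ->
  (forall x, f2 x = g2 x) -> jet v g0 g1 g2.
Proof.
  intros [H0 [H1 [H2 [K [d [Hd [HK H]]]]]]] E E0 E1 E2.
  repeat split; try (destruct H0 as [M HM]; exists M; intros x; rewrite <- E0; apply HM);
  try (destruct H1 as [M HM]; exists M; intros x; rewrite <- E1; apply HM);
  try (destruct H2 as [M HM]; exists M; intros x; rewrite <- E2; apply HM).
  exists K, d. split; [|split]; trivial.
  intros x e He. rewrite <- E, <- E0, <- E1, <- E2. apply H, He.
Qed.

Lemma jet_poly f0 f1 f2 : bounded_fun f0 -> bounded_fun f1 -> bounded_fun f2 ->
  jet (fun x e => f0 x + e * f1 x + e ^ 2 * f2 x) f0 f1 f2.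
Proof.
  intros. repeat split; trivial. exists 0, 1. repeat split; try lra.
  intros. rewrite Rminus_diag, Rabs_R0. lra.
Qed.

Lemma jet_affine f0 f1 : bounded_fun f0 -> bounded_fun f1 ->
  jet (fun x e => f0 x + e * f1 x) f0 f1 (fun _ => 0).
Proof.
  intros. apply (jet_ext (fun x e => f0 x + e * f1 x + e ^ 2 * 0) _ f0 f1 (fun _ => 0)); auto.
  - apply (jet_poly f0 f1 (fun _ => 0)); trivial. apply bounded_const.
  - intros; ring.
Qed.

Lemma jet_const c : jet (fun _ _ => c) (fun _ => c) (fun _ => 0) (fun _ => 0).
Proof.
  apply (jet_ext (fun x e => c + e * 0) _ (fun _ => c) (fun _ => 0) (fun _ => 0)); auto.
  - apply (jet_affine (fun _ => c) (fun _ => 0)); apply bounded_const.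
  - intros; ring.
Qed.

Lemma jet_linear f : bounded_fun f -> jet (fun x e => e * f x) (fun _ => 0) f (fun _ => 0).
Proof.
  intros. apply (jet_ext (fun x e => 0 + e * f x) _ (fun _ => 0) f (fun _ => 0)); auto.
  - apply (jet_affine (fun _ => 0) f); trivial. apply bounded_const.
  - intros; ring.
Qed.

Lemma jet_plus u v f0 f1 f2 g0 g1 g2 : jet u f0 f1 f2 -> jet v g0 g1 g2 ->
  jet (fun x e => u x e + v x e) (fun x => f0 x + g0 x) (fun x => f1 x + g1 x) (fun x => f2 x + g2 x).
Proof.
  intros [H0 [H1 [H2 [K [d [Hd [HK H]]]]]]] [G0 [G1 [G2 [K' [d' [Hd' [HK' H']]]]]]].
  repeat split; try (apply bounded_plus; trivial).
  exists (K + K'), (Rmin d d').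
  assert (Hl := Rmin_l d d'). assert (Hr := Rmin_r d d').
  assert (0 < Rmin d d') by (apply Rmin_pos; lra).
  split; [lra|split; [lra|]].
  intros x e He.
  replace (_ - _) with ((u x e - (f0 x + e * f1 x + e ^ 2 * f2 x)) + (v x e - (g0 x + e * g1 x + e ^ 2 * g2 x)))
    by ring.
  eapply Rle_trans; [apply Rabs_triang|]. rewrite Rmult_plus_distr_r.
  apply Rplus_le_compat; [apply H | apply H']; lra.
Qed.

Lemma jet_mult u v f0 f1 f2 g0 g1 g2 : jet u f0 f1 f2 -> jet v g0 g1 g2 ->
  jet (fun x e => u x e * v x e) (fun x => f0 x * g0 x) (fun x => f0 x * g1 x + f1 x * g0 x)
    (fun x => f0 x * g2 x + f1 x * g1 x + f2 x * g0 x).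
Proof.
  intros [H0 [H1 [H2 [K [d [Hd [HK H]]]]]]] [G0 [G1 [G2 [K' [d' [Hd' [HK' H']]]]]]].
  repeat split; try (repeat first [apply bounded_plus | apply bounded_mult]; trivial).
  destruct (bounded_pos _ H0) as [M0 [P0 B0]]. destruct (bounded_pos _ H1) as [M1 [P1 B1]].
  destruct (bounded_pos _ H2) as [M2 [P2 B2]]. destruct (bounded_pos _ G0) as [N0 [Q0 C0]].
  destruct (bounded_pos _ G1) as [N1 [Q1 C1]]. destruct (bounded_pos _ G2) as [N2 [Q2 C2]].
  exists (K * (N0 + N1 + N2 + K') + (M0 + M1 + M2) * K' + (M1 * N2 + M2 * N1 + M2 * N2)), (Rmin d d').
  assert (Hl := Rmin_l d d'). assert (Hr := Rmin_r d d').
  assert (0 < Rmin d d') by (apply Rmin_pos; lra).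
  split; [lra|split].
  { repeat apply Rplus_le_le_0_compat; repeat apply Rmult_le_pos; lra. }
  intros x e He.
  assert (Ha := Rabs_pos e). set (a := Rabs e) in *.
  assert (Ha1 : a <= 1) by lra.
  assert (Ha2 : a ^ 2 <= 1) by (simpl; nra).
  assert (Ha20 : 0 <= a ^ 2) by (apply pow_le; lra).
  assert (Ha3 : 0 <= a ^ 3) by (apply pow_le; lra).
  assert (Ha31 : a ^ 3 <= 1) by (simpl; nra).
  assert (Hu := H x e ltac:(fold a; lra)). assert (Hv := H' x e ltac:(fold a; lra)). fold a in Hu, Hv.
  assert (Hpoly : forall r0 r1 r2 L0 L1 L2, Rabs r0 <= L0 -> Rabs r1 <= L1 -> Rabs r2 <= L2 ->
    Rabs (r0 + e * r1 + e ^ 2 * r2) <= L0 + L1 + L2).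
  { intros r0 r1 r2 L0 L1 L2 E0 E1 E2.
    eapply Rle_trans; [apply Rabs_triang|]. apply Rplus_le_compat.
    - eapply Rle_trans; [apply Rabs_triang|]. apply Rplus_le_compat; trivial.
      rewrite Rabs_mult. fold a. assert (Hp := Rabs_pos r1). nra.
    - rewrite Rabs_mult, <- RPow_abs. fold a. assert (Hp := Rabs_pos r2). nra. }
  set (U := f0 x + e * f1 x + e ^ 2 * f2 x) in *.
  set (V := g0 x + e * g1 x + e ^ 2 * g2 x) in *.
  assert (HU : Rabs U <= M0 + M1 + M2) by (apply Hpoly; auto).
  assert (HV : Rabs (v x e) <= N0 + N1 + N2 + K').
  { replace (v x e) with (V + (v x e - V)) by ring.
    eapply Rle_trans; [apply Rabs_triang|]. apply Rplus_le_compat; [apply Hpoly; auto|]. nra. }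
  (* Three errors, matching the three summands of the constant: that of [u], that of [v], and the
     terms of degree at least 3 dropped from the product of the polynomials. *)
  replace (_ - _) with ((u x e - U) * v x e + (U * (v x e - V)
     + e ^ 3 * (f1 x * g2 x + f2 x * g1 x + e * (f2 x * g2 x)))) by (unfold U, V; ring).
  eapply Rle_trans; [apply Rabs_triang|].
  rewrite (Rplus_assoc (K * _)), Rmult_plus_distr_r.
  apply Rplus_le_compat.
  { rewrite Rabs_mult.
    replace (K * (N0 + N1 + N2 + K') * a ^ 3) with (K * a ^ 3 * (N0 + N1 + N2 + K')) by ring.
    apply Rmult_le_compat; auto using Rabs_pos. }
  eapply Rle_trans; [apply Rabs_triang|].
  rewrite Rmult_plus_distr_r.
  apply Rplus_le_compat.
  { rewrite Rabs_mult, Rmult_assoc. apply Rmult_le_compat; auto using Rabs_pos. }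
  rewrite Rabs_mult, <- RPow_abs. fold a. rewrite Rmult_comm.
  apply Rmult_le_compat_r; trivial.
  assert (HM : forall y z Y Z, Rabs y <= Y -> Rabs z <= Z -> Rabs (y * z) <= Y * Z).
  { intros. rewrite Rabs_mult. apply Rmult_le_compat; auto using Rabs_pos. }
  eapply Rle_trans; [apply Rabs_triang|]. apply Rplus_le_compat.
  - eapply Rle_trans; [apply Rabs_triang|]. apply Rplus_le_compat; apply HM; auto.
  - rewrite Rabs_mult. fold a. assert (E := HM _ _ _ _ (B2 x) (C2 x)).
    assert (E' := Rabs_pos (f2 x * g2 x)). nra.
Qed.

Lemma jet_lower u f0 f1 f2 m : jet u f0 f1 f2 -> 0 < m -> (forall x, m <= f0 x) ->
  exists d, 0 < d <= 1 /\ forall x e, Rabs e <= d -> m / 2 <= u x e.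
Proof.
  intros [H0 [H1 [H2 [K [d [Hd [HK H]]]]]]] Hm Hf.
  destruct (bounded_pos _ H1) as [M1 [P1 B1]]. destruct (bounded_pos _ H2) as [M2 [P2 B2]].
  set (d' := Rmin d (m / (2 * (M1 + M2 + K)))).
  assert (Hq : 0 < m / (2 * (M1 + M2 + K))) by (apply Rdiv_lt_0_compat; lra).
  exists d'. assert (Hl := Rmin_l d (m / (2 * (M1 + M2 + K)))).
  assert (Hr := Rmin_r d (m / (2 * (M1 + M2 + K)))). fold d' in Hl, Hr.
  assert (0 < d') by (apply Rmin_pos; lra).
  split; [lra|]. intros x e He.
  assert (Hu := H x e ltac:(lra)).
  assert (Ha := Rabs_pos e). set (a := Rabs e) in *.
  assert (Ha1 : a <= 1) by lra.
  assert (Ham : a * (M1 + M2 + K) <= m / 2).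
  { apply Rle_trans with (m / (2 * (M1 + M2 + K)) * (M1 + M2 + K)).
    - apply Rmult_le_compat_r; lra.
    - right; field; lra. }
  assert (E1 : Rabs (e * f1 x) <= a * M1).
  { rewrite Rabs_mult. apply Rmult_le_compat_l; trivial. }
  assert (E2 : Rabs (e ^ 2 * f2 x) <= a * M2).
  { rewrite Rabs_mult, <- RPow_abs. fold a.
    apply Rmult_le_compat; auto using Rabs_pos; simpl; nra. }
  assert (E3 : K * a ^ 3 <= a * K).
  { simpl. assert (0 <= a * a <= 1) by nra. assert (0 <= K * a) by nra. nra. }
  apply Rabs_le_between in Hu. apply Rabs_le_between in E1. apply Rabs_le_between in E2.
  specialize (Hf x). lra.
Qed.

Lemma jet_diff u v f0 f1 f2 : jet u f0 f1 f2 -> jet v f0 f1 f2 ->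
  exists K d, 0 < d <= 1 /\ 0 <= K /\ forall x e, Rabs e <= d -> Rabs (u x e - v x e) <= K * Rabs e ^ 3.
Proof.
  intros [H0 [H1 [H2 [K [d [Hd [HK H]]]]]]] [_ [_ [_ [K' [d' [Hd' [HK' H']]]]]]].
  exists (K + K'), (Rmin d d').
  assert (Hl := Rmin_l d d'). assert (Hr := Rmin_r d d').
  assert (0 < Rmin d d') by (apply Rmin_pos; lra).
  split; [lra|split; [lra|]].
  intros x e He.
  assert (E := H x e ltac:(lra)). assert (E' := H' x e ltac:(lra)).
  replace (u x e - v x e) with ((u x e - (f0 x + e * f1 x + e ^ 2 * f2 x)) + - (v x e - (f0 x + e * f1 x + e ^ 2 * f2 x)))
    by ring.
  eapply Rle_trans; [apply Rabs_triang|]. rewrite Rabs_Ropp. lra.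
Qed.

(** The candidate coefficients are only checked: they make [u * Y] equal to 1 up to third order, and
    [1 / u - Y = - (u * Y - 1) / u] with [u] bounded below. *)
Lemma jet_inv u f0 f1 f2 y0 y1 y2 m : jet u f0 f1 f2 -> 0 < m -> (forall x, m <= f0 x) ->
  bounded_fun y0 -> bounded_fun y1 -> bounded_fun y2 ->
  (forall x, f0 x * y0 x = 1) -> (forall x, f0 x * y1 x + f1 x * y0 x = 0) ->
  (forall x, f0 x * y2 x + f1 x * y1 x + f2 x * y0 x = 0) ->
  jet (fun x e => / u x e) y0 y1 y2.
Proof.
  intros Hu Hm Hf Y0 Y1 Y2 E0 E1 E2.
  repeat split; trivial.
  destruct (jet_lower _ _ _ _ _ Hu Hm Hf) as [d1 [Hd1 Hlow]].
  assert (Hy := jet_mult _ _ _ _ _ _ _ _ Hu (jet_poly y0 y1 y2 Y0 Y1 Y2)).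
  apply (jet_ext _ (fun x e => u x e * (y0 x + e * y1 x + e ^ 2 * y2 x)) _ _ _ _ _ _) with
    (2 := fun x e => eq_refl) (3 := E0) (4 := E1) (5 := E2) in Hy.
  destruct (jet_diff _ _ _ _ _ Hy (jet_const 1)) as [K [d [Hd [HK H]]]].
  exists (2 / m * K), (Rmin d d1).
  assert (Hl := Rmin_l d d1). assert (Hr := Rmin_r d d1).
  assert (0 < Rmin d d1) by (apply Rmin_pos; lra).
  assert (Hm2 : 0 < 2 / m) by (apply Rdiv_lt_0_compat; lra).
  split; [lra|split; [nra|]].
  intros x e He. assert (HL := Hlow x e ltac:(lra)). assert (HE := H x e ltac:(lra)).
  set (Y := y0 x + e * y1 x + e ^ 2 * y2 x) in *.
  replace (/ u x e - Y) with (- (/ u x e * (u x e * Y - 1))) by (field; lra).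
  rewrite Rabs_Ropp, Rabs_mult, Rmult_assoc.
  apply Rmult_le_compat; auto using Rabs_pos.
  rewrite Rabs_pos_eq by (left; apply Rinv_0_lt_compat; lra).
  replace (2 / m) with (/ (m / 2)) by (field; lra).
  apply Rinv_le_contravar; lra.
Qed.

(** The difference is [sqrt u - Y = (u - Y^2) / (sqrt u + Y)], where the denominator is bounded
    below and [Y^2] has the jet of [u]. *)
Lemma jet_sqrt u f0 f1 f2 y0 y1 y2 m : jet u f0 f1 f2 -> 0 < m -> (forall x, m <= y0 x) ->
  bounded_fun y0 -> bounded_fun y1 -> bounded_fun y2 ->
  (forall x, y0 x * y0 x = f0 x) -> (forall x, y0 x * y1 x + y1 x * y0 x = f1 x) ->
  (forall x, y0 x * y2 x + y1 x * y1 x + y2 x * y0 x = f2 x) ->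
  jet (fun x e => sqrt (u x e)) y0 y1 y2.
Proof.
  intros Hu Hm Hf Y0 Y1 Y2 E0 E1 E2.
  repeat split; trivial.
  assert (HY := jet_poly y0 y1 y2 Y0 Y1 Y2).
  destruct (jet_lower _ _ _ _ _ HY Hm Hf) as [d1 [Hd1 Hlow]].
  destruct (jet_lower _ _ _ _ (m * m) Hu) as [d2 [Hd2 Hlowu]].
  { nra. }
  { intros x. rewrite <- E0. specialize (Hf x). nra. }
  assert (Hy := jet_mult _ _ _ _ _ _ _ _ HY HY).
  apply (jet_ext _ (fun x e => (y0 x + e * y1 x + e ^ 2 * y2 x) * (y0 x + e * y1 x + e ^ 2 * y2 x)) _ _ _ _ _ _) with
    (2 := fun x e => eq_refl) (3 := E0) (4 := E1) (5 := E2) in Hy.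
  destruct (jet_diff _ _ _ _ _ Hu Hy) as [K [d [Hd [HK H]]]].
  exists (2 / m * K), (Rmin d (Rmin d1 d2)).
  assert (Hl := Rmin_l d (Rmin d1 d2)). assert (Hr := Rmin_r d (Rmin d1 d2)).
  assert (Hl' := Rmin_l d1 d2). assert (Hr' := Rmin_r d1 d2).
  assert (0 < Rmin d (Rmin d1 d2)) by (repeat apply Rmin_pos; lra).
  assert (Hm2 : 0 < 2 / m) by (apply Rdiv_lt_0_compat; lra).
  split; [lra|split; [nra|]].
  intros x e He. assert (HL := Hlow x e ltac:(lra)). assert (HE := H x e ltac:(lra)).
  assert (HLu := Hlowu x e ltac:(lra)).
  set (Y := y0 x + e * y1 x + e ^ 2 * y2 x) in *.
  assert (Hs := sqrt_pos (u x e)).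
  assert (Hss : sqrt (u x e) * sqrt (u x e) = u x e) by (apply sqrt_sqrt; nra).
  replace (sqrt (u x e) - Y) with (/ (sqrt (u x e) + Y) * (u x e - Y * Y)).
  2: { rewrite <- Hss at 2. field. lra. }
  rewrite Rabs_mult, Rmult_assoc.
  apply Rmult_le_compat; auto using Rabs_pos.
  rewrite Rabs_pos_eq by (left; apply Rinv_0_lt_compat; lra).
  replace (2 / m) with (/ (m / 2)) by (field; lra).
  apply Rinv_le_contravar; lra.
Qed.

Lemma jet_pow2 u f0 f1 f2 : jet u f0 f1 f2 ->
  jet (fun x e => u x e ^ 2) (fun x => f0 x * f0 x) (fun x => 2 * f0 x * f1 x)
    (fun x => 2 * f0 x * f2 x + f1 x * f1 x).
Proof.
  intros H. eapply jet_ext; [exact (jet_mult _ _ _ _ _ _ _ _ H H) | intros; simpl; ring ..].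
Qed.

Lemma jet_pow3 u f0 f1 f2 : jet u f0 f1 f2 ->
  jet (fun x e => u x e ^ 3) (fun x => f0 x ^ 3) (fun x => 3 * f0 x ^ 2 * f1 x)
    (fun x => 3 * f0 x ^ 2 * f2 x + 3 * f0 x * f1 x ^ 2).
Proof.
  intros H. eapply jet_ext; [exact (jet_mult _ _ _ _ _ _ _ _ H (jet_pow2 _ _ _ _ H)) | intros; simpl; ring ..].
Qed.

Lemma jet_pow5 u f0 f1 f2 : jet u f0 f1 f2 ->
  jet (fun x e => u x e ^ 5) (fun x => f0 x ^ 5) (fun x => 5 * f0 x ^ 4 * f1 x)
    (fun x => 5 * f0 x ^ 4 * f2 x + 10 * f0 x ^ 3 * f1 x ^ 2).
Proof.
  intros H. eapply jet_ext;
    [exact (jet_mult _ _ _ _ _ _ _ _ (jet_pow2 _ _ _ _ H) (jet_pow3 _ _ _ _ H)) | intros; simpl; ring ..].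
Qed.
End Jets.

Ltac bdd := repeat first [ assumption | apply bounded_const | apply bounded_plus
  | apply bounded_minus | apply bounded_opp | apply bounded_mult | apply bounded_pow ].

(** Up to third order [W] is [a + e f + e^2 (p^2 + k^2) / (2 a)]; the rest are products, powers and
    inverses of known jets. *)
Lemma density_jet {P : Type} (a a' f ft p k A B D : P -> R) m :
  0 < m -> (forall x, m <= a x) ->
  bounded_fun a -> bounded_fun a' -> bounded_fun f -> bounded_fun ft -> bounded_fun p -> bounded_fun k ->
  bounded_fun A -> bounded_fun B -> bounded_fun D ->
  jet (fun x e => radial_density (a x + e * f x) (a' x + e * ft x) (e * p x) (e * k x)
         (e * A x) (e * B x) (e * D x))
    (fun x => (a x * a' x) ^ 2 + 4)
    (fun x => 2 * (a x * a' x) * (a x * ft x + a' x * f x) - 4 * (A x + D x) / a x)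
    (fun x => (a x * ft x + a' x * f x) ^ 2 + 2 * (a x * a' x) * (f x * ft x)
       - a' x ^ 2 * (p x ^ 2 + k x ^ 2) / 2
       + ((A x + D x) ^ 2 + 2 * (p x ^ 2 + k x ^ 2) + 4 * f x * (A x + D x)) / a x ^ 2).
Proof.
  intros Hm Ha ba ba' bf bft bp bk bA bB bD.
  assert (bi : bounded_fun (fun x => / a x)) by (apply bounded_inv with m; trivial).
  assert (Hpos : forall x, 0 < a x) by (intros x; specialize (Ha x); lra).
  assert (JR := jet_affine a f ba bf).
  assert (JRt := jet_affine a' ft ba' bft).
  assert (JN : jet (fun x e => (e * p x) ^ 2 + (e * k x) ^ 2) (fun _ => 0) (fun _ => 0)
      (fun x => p x ^ 2 + k x ^ 2)).
  { eapply jet_ext; [exact (jet_plus _ _ _ _ _ _ _ _ (jet_pow2 _ _ _ _ (jet_linear p bp))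
      (jet_pow2 _ _ _ _ (jet_linear k bk))) | intros; simpl; ring ..]. }
  assert (JW : jet (fun x e => sqrt ((a x + e * f x) ^ 2 + (e * p x) ^ 2 + (e * k x) ^ 2)) a f
     (fun x => (p x ^ 2 + k x ^ 2) * / a x / 2)).
  { eapply (jet_sqrt _ _ _ _ a f (fun x => (p x ^ 2 + k x ^ 2) * / a x / 2) m).
    - eapply jet_ext; [exact (jet_plus _ _ _ _ _ _ _ _ (jet_pow2 _ _ _ _ JR) JN)
        | intros; simpl; ring | reflexivity ..].
    - exact Hm.
    - exact Ha.
    - exact ba.
    - exact bf.
    - apply (bounded_mult (fun x => (p x ^ 2 + k x ^ 2) * / a x) (fun _ => / 2)); bdd.
    - intros; simpl; ring.
    - intros; simpl; ring.
    - intros x; simpl; field. apply Rgt_not_eq, Hpos. }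
  assert (JiR : jet (fun x e => / (a x + e * f x)) (fun x => / a x)
     (fun x => - f x * (/ a x) ^ 2) (fun x => f x ^ 2 * (/ a x) ^ 3)).
  { eapply jet_inv; [exact JR | exact Hm | exact Ha | bdd | bdd | bdd | intros x .. ];
    simpl; field; apply Rgt_not_eq, Hpos. }
  assert (JiW : jet (fun x e => / sqrt ((a x + e * f x) ^ 2 + (e * p x) ^ 2 + (e * k x) ^ 2))
     (fun x => / a x) (fun x => - f x * (/ a x) ^ 2)
     (fun x => f x ^ 2 * (/ a x) ^ 3 - (p x ^ 2 + k x ^ 2) * (/ 2 * (/ a x) ^ 3))).
  { eapply jet_inv; [exact JW | exact Hm | exact Ha | bdd | bdd | | intros x .. ].
    - apply bounded_minus; bdd.
    - simpl; field; apply Rgt_not_eq, Hpos.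
    - simpl; field; apply Rgt_not_eq, Hpos.
    - simpl; field; apply Rgt_not_eq, Hpos. }
  (* These terms of the curvature numerator are cubic in [e], which is why [B] is absent from the
     expansion. *)
  assert (JC : jet (fun x e => (e * k x) ^ 2 * (e * A x) - 2 * (e * p x) * (e * k x) * (e * B x)
       + (e * p x) ^ 2 * (e * D x)) (fun _ => 0) (fun _ => 0) (fun _ => 0)).
  { assert (bC : bounded_fun (fun x => k x ^ 2 * A x - 2 * p x * k x * B x + p x ^ 2 * D x)) by bdd.
    eapply jet_ext; [exact (jet_mult _ _ _ _ _ _ _ _ (jet_pow2 _ _ _ _ (jet_linear (fun _ => 1) (bounded_const 1)))
        (jet_linear _ bC)) | intros; simpl; ring ..]. }
  assert (bL : bounded_fun (fun x => A x + D x)) by bdd.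
  assert (JX : jet (fun x e => 2 * (a x + e * f x) ^ 3
      + 3 * (a x + e * f x) * ((e * p x) ^ 2 + (e * k x) ^ 2)
      - ((a x + e * f x) ^ 2 * (e * A x + e * D x) + (e * k x) ^ 2 * (e * A x)
         - 2 * (e * p x) * (e * k x) * (e * B x) + (e * p x) ^ 2 * (e * D x)))
     (fun x => 2 * a x ^ 3) (fun x => 6 * a x ^ 2 * f x - a x ^ 2 * (A x + D x))
     (fun x => 6 * a x * f x ^ 2 + 3 * a x * (p x ^ 2 + k x ^ 2) - 2 * a x * f x * (A x + D x))).
  { eapply jet_ext; [exact (jet_plus _ _ _ _ _ _ _ _
       (jet_plus _ _ _ _ _ _ _ _
         (jet_mult _ _ _ _ _ _ _ _ (jet_const 2) (jet_pow3 _ _ _ _ JR))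
         (jet_mult _ _ _ _ _ _ _ _ (jet_mult _ _ _ _ _ _ _ _ (jet_const 3) JR) JN))
       (jet_mult _ _ _ _ _ _ _ _ (jet_const (-1))
         (jet_plus _ _ _ _ _ _ _ _
           (jet_mult _ _ _ _ _ _ _ _ (jet_pow2 _ _ _ _ JR) (jet_linear _ bL)) JC)))
     | intros; simpl; ring ..]. }
  eapply jet_ext;
    [ exact (jet_plus _ _ _ _ _ _ _ _
       (jet_mult _ _ _ _ _ _ _ _
         (jet_mult _ _ _ _ _ _ _ _ (jet_pow2 _ _ _ _ JRt) (jet_pow3 _ _ _ _ JR)) JiW)
       (jet_mult _ _ _ _ _ _ _ _ (jet_pow2 _ _ _ _ JX)
          (jet_mult _ _ _ _ _ _ _ _ JiR (jet_pow5 _ _ _ _ JiW))))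
    | intros x e; unfold radial_density, Rdiv; rewrite Rinv_mult, pow_inv; reflexivity
    | intros x; cbv beta; field; apply Rgt_not_eq, Hpos .. ].
Qed.

(** * The second variation of the action *)

Definition tint (T : R) (H : R -> R -> R -> R) : R :=
  RInt (fun t => sint (fun th ps => H th ps t)) 0 T.

Lemma cont3_slice H t : cont3 H -> cont2 (fun th ps => H th ps t).
Proof. intros HH p. cont. Qed.

Lemma continuous_sint_t H t : cont3 H -> continuous (fun t => sint (fun th ps => H th ps t)) t.
Proof.
  intros HH. apply (continuous_sint (fun t th ps => H th ps t)). intros p. cont.
Qed.

Lemma ex_tint T H : cont3 H -> ex_RInt (fun t => sint (fun th ps => H th ps t)) 0 T.
Proof. intros HH. apply ex_RInt_cont. intros; apply continuous_sint_t, HH. Qed.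

Lemma cont3_plus F G : cont3 F -> cont3 G -> cont3 (fun th ps t => F th ps t + G th ps t).
Proof. intros HF HG p. cont. Qed.

Lemma cont3_scal c F : cont3 F -> cont3 (fun th ps t => c * F th ps t).
Proof. intros HF p. cont. Qed.

Lemma tint_plus T F G : cont3 F -> cont3 G ->
  tint T (fun th ps t => F th ps t + G th ps t) = tint T F + tint T G.
Proof.
  intros HF HG. unfold tint.
  rewrite <- (RInt_plus (V := R_CompleteNormedModule)); try (apply ex_tint; assumption).
  apply RInt_ext. intros t _. apply (sint_plus (fun th ps => F th ps t));
    apply cont3_slice; assumption.
Qed.

Lemma tint_scal T c F : cont3 F -> tint T (fun th ps t => c * F th ps t) = c * tint T F.
Proof.
  intros HF. unfold tint.
  rewrite <- (RInt_scal (V := R_CompleteNormedModule)); try (apply ex_tint; assumption).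
  apply RInt_ext. intros t _. apply sint_scal, cont3_slice, HF.
Qed.

Lemma tint_ext T F G : 0 < T -> (forall th ps t, 0 < t < T -> F th ps t = G th ps t) ->
  tint T F = tint T G.
Proof.
  intros HT H. apply RInt_ext. intros t Ht. rewrite Rmin_left, Rmax_right in Ht by lra.
  apply sint_ext. intros; apply H, Ht.
Qed.

Lemma tint_le T F G : 0 < T -> cont3 F -> cont3 G ->
  (forall t, 0 < t < T -> sint (fun th ps => F th ps t) <= sint (fun th ps => G th ps t)) ->
  tint T F <= tint T G.
Proof.
  intros HT HF HG H. apply RInt_le; try (apply ex_tint; assumption); [lra | exact H].
Qed.

Lemma tint_const T c : tint T (fun _ _ _ => c) = 4 * PI * c * T.
Proof.
  unfold tint. rewrite (RInt_ext (V := R_CompleteNormedModule) _ (fun _ => 4 * PI * c)).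
  - rewrite (RInt_const (V := R_CompleteNormedModule)).
    change ((T - 0) * (4 * PI * c) = 4 * PI * c * T). ring.
  - intros. apply sint_const.
Qed.

Lemma tint_abs_le T F M : 0 < T -> cont3 F ->
  (forall th ps t, 0 < t < T -> Rabs (F th ps t) <= M) -> Rabs (tint T F) <= 4 * PI * M * T.
Proof.
  intros HT HF H. apply Rabs_le. split.
  - replace (- (4 * PI * M * T)) with (tint T (fun _ _ _ => - M)) by (rewrite tint_const; ring).
    apply tint_le; trivial; [intros p; cont|]. intros t Ht.
    apply sint_le; [intros p; cont | apply cont3_slice, HF|].
    intros th ps. specialize (H th ps t Ht). apply Rabs_le_between in H. lra.
  - rewrite <- tint_const. apply tint_le; trivial; [intros p; cont|]. intros t Ht.
    apply sint_le; [apply cont3_slice, HF | intros p; cont |].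
    intros th ps. specialize (H th ps t Ht). apply Rabs_le_between in H. lra.
Qed.

Lemma RInt_derive_open (f df : R -> R) a b : a < b ->
  (forall x, a < x < b -> is_derive f x (df x)) -> (forall x, continuous f x) ->
  (forall x, continuous df x) -> RInt df a b = f b - f a.
Proof.
  intros Hab Hd Hf Hdf.
  destruct (MVT_gen (fun x => f x - RInt df a x) a b (fun _ => 0)) as [c [_ Hc]].
  - intros x Hx. rewrite Rmin_left, Rmax_right in Hx by lra.
    apply der_eq with (df x - df x); [|ring].
    apply der_minus; [apply Hd, Hx | apply is_derive_RInt_upper, Hdf].
  - intros x _. apply continuity_pt_filterlim.
    apply (cont_minus f (fun x => RInt df a x)); [apply Hf|].
    apply (ex_derive_continuous (V := R_NormedModule)). exists (df x).
    apply is_derive_RInt_upper, Hdf.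
  - rewrite (RInt_point (V := R_CompleteNormedModule)) in Hc. unfold zero in Hc; simpl in Hc. lra.
Qed.

(** Two exchanges of integrals bring the time integral innermost, where the boundary values make it
    vanish. *)
Lemma tint_time_derivative T G Gt : 0 < T -> cont3 G -> cont3 Gt ->
  (forall th ps t, 0 < t < T -> is_derive (fun s => G th ps s) t (Gt th ps t)) ->
  (forall th ps, G th ps 0 = 0) -> (forall th ps, G th ps T = 0) -> tint T Gt = 0.
Proof.
  intros HT HG HGt Hd H0 H1. unfold tint, sint.
  rewrite (RInt_swap (fun t th => RInt (fun ps => Gt th ps t * sin th) 0 (2 * PI))).
  - rewrite (RInt_ext (V := R_CompleteNormedModule) _ (fun _ => 0)).
    + rewrite (RInt_const (V := R_CompleteNormedModule)). apply Rmult_0_r.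
    + intros th _.
      rewrite (RInt_swap (fun t ps => Gt th ps t * sin th)).
      * rewrite (RInt_ext (V := R_CompleteNormedModule) _ (fun _ => 0)).
        -- rewrite (RInt_const (V := R_CompleteNormedModule)). apply Rmult_0_r.
        -- intros ps _. rewrite (RInt_derive_open (fun t => G th ps t * sin th)).
           ++ rewrite H0, H1. eqR. ring.
           ++ exact HT.
           ++ intros t Ht. eapply der_eq; [apply der_mult|].
              ** apply Hd, Ht.
              ** apply (is_derive_const (V := R_NormedModule)).
              ** unfold zero; simpl. ring.
           ++ intros t. cont.
           ++ intros t. cont.
      * lra.
      * apply two_PI_pos.
      * intros p. cont.
  - lra.
  - apply PI_nonneg.
  - intros p.
    apply (continuous_RInt_param (U := prod_UniformSpace R_UniformSpace R_UniformSpace)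
      (fun v ps => Gt (snd v) ps (fst v) * sin (snd v))); [apply two_PI_pos|].
    intros q. cont.
Qed.

Definition bounded3 (F : R -> R -> R -> R) : Prop :=
  bounded_fun (fun x : R * R * R => F (fst (fst x)) (snd (fst x)) (snd x)).

Record variation_data (T : R) (F Ft p k A B D : R -> R -> R -> R) : Prop := {
  vd_rd : radial_data T F Ft p k A B D;
  vd_cF : cont3 F; vd_cFt : cont3 Ft; vd_cp : cont3 p; vd_ck : cont3 k;
  vd_cA : cont3 A; vd_cB : cont3 B; vd_cD : cont3 D;
  vd_bF : bounded3 F; vd_bFt : bounded3 Ft; vd_bp : bounded3 p; vd_bk : bounded3 k;
  vd_bA : bounded3 A; vd_bB : bounded3 B; vd_bD : bounded3 D;
  vd_0 : forall th ps, F th ps 0 = 0;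
  vd_T : forall th ps, F th ps T = 0 }.

(** [ra_der] says that [a^2] has constant slope [c] on the open interval. The bounds are asked on
    the whole line, which a radius frozen outside [[0, T]] satisfies. *)
Record radius_data (T c m : R) (a : R -> R) : Prop := {
  ra_pos : 0 < m;
  ra_low : forall t, m <= a t;
  ra_bnd : exists M, forall t, a t <= M;
  ra_cont : forall t, continuous a t;
  ra_der : forall t, 0 < t < T -> is_derive a t (c / (2 * a t)) }.

Lemma sph_fun_affine F p k A D c e : sph_fun F p k A D ->
  sph_fun (fun th ps => c + e * F th ps) (fun th ps => e * p th ps) (fun th ps => e * k th ps)
    (fun th ps => e * A th ps) (fun th ps => e * D th ps).
Proof.
  intros [cF cp ck cA cD Fth Fps pth kps perF perk].
  assert (Haff : forall (f : R -> R) x l, is_derive f x l -> is_derive (fun y => c + e * f y) x (e * l)).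
  { intros f x l Hf. eapply der_eq; [apply der_plus|].
    - apply (is_derive_const (V := R_NormedModule)).
    - apply is_derive_scal, Hf.
    - unfold zero; simpl; ring. }
  split; try (intros v; solve [cont]).
  - intros. apply (Haff (fun a => F a ps)), Fth.
  - intros th ps. apply der_eq with (e * (sin th * k th ps)); [|ring].
    apply (Haff (fun a => F th a)), Fps.
  - intros. apply is_derive_scal, pth.
  - intros th ps. apply der_eq with (e * (sin th * D th ps - cos th * p th ps)); [|ring].
    apply is_derive_scal, kps.
  - intros. rewrite perF; reflexivity.
  - intros. rewrite perk; reflexivity.
Qed.

Lemma radial_data_affine T c m a F Ft p k A B D e : radius_data T c m a ->
  radial_data T F Ft p k A B D ->
  radial_data T (fun th ps t => a t + e * F th ps t) (fun th ps t => c / (2 * a t) + e * Ft th ps t)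
    (fun th ps t => e * p th ps t) (fun th ps t => e * k th ps t) (fun th ps t => e * A th ps t)
    (fun th ps t => e * B th ps t) (fun th ps t => e * D th ps t).
Proof.
  intros Ha [Hs Hp Ht]. split.
  - intros t Ht'. apply (sph_fun_affine (fun th ps => F th ps t)), Hs, Ht'.
  - intros th ps t Ht'.
    apply der_eq with (e * (sin th * B th ps t + cos th * k th ps t)); [|ring].
    apply is_derive_scal, Hp, Ht'.
  - intros th ps t Ht'. apply der_plus; [apply (ra_der _ _ _ _ Ha), Ht' | apply is_derive_scal, Ht, Ht'].
Qed.

(** The coefficient of [e^2], hence half the second derivative of the action, after the terms that
    integrate to zero have been removed. *)
Definition second_variation (T c : R) (a : R -> R) (F Ft p k A D : R -> R -> R -> R) : R :=
  tint T (fun th ps t => a t ^ 2 * Ft th ps t ^ 2 +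
    (c ^ 2 / 4 * F th ps t ^ 2 + (A th ps t + D th ps t) ^ 2
     - (2 + c ^ 2 / 8) * (p th ps t ^ 2 + k th ps t ^ 2)) / a t ^ 2).

Lemma radius_pos T c m a t : radius_data T c m a -> 0 < a t.
Proof. intros [Hm Hlow _ _ _]. specialize (Hlow t). lra. Qed.

Lemma cont_radius T c m a {U : UniformSpace} (f : U -> R) p : radius_data T c m a ->
  continuous f p -> continuous (fun q => a (f q)) p.
Proof. intros Ha. apply cont_comp, (ra_cont _ _ _ _ Ha). Qed.

Ltac cont_rad a Ha :=
  repeat first
    [ cont_step
    | match goal with |- continuous (fun q => a (@?f q)) _ => apply (cont_radius _ _ _ _ f _ Ha) end
    | progress cont ].

(** Since [a a' = c / 2], the coefficient of [e] is [c (a F)_t - 4 Lap F / a], and that of [e^2] is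
    the integrand of [second_variation] plus [c (F^2)_t] and [4 div (F grad F) / a^2]. The extra
    terms vanish by the boundary values in time and by Green's formula. The exact integral is
    returned along with the estimate, for the degenerate case of stability. *)
Lemma action_expansion T c m a F Ft p k A B D r : 0 < T -> radius_data T c m a ->
  variation_data T F Ft p k A B D ->
  (forall e th ps t, 0 <= t <= T -> r e (sph th ps) t = a t + e * F th ps t) ->
  exists K d, 0 < d /\ 0 <= K /\ forall e, Rabs e <= d ->
    action (radial_graph (r e)) T = tint T (fun th ps t =>
      radial_density (a t + e * F th ps t) (c / (2 * a t) + e * Ft th ps t) (e * p th ps t)
        (e * k th ps t) (e * A th ps t) (e * B th ps t) (e * D th ps t)) /\
    Rabs (action (radial_graph (r e)) T
      - (4 * PI * (c ^ 2 / 4 + 4) * T + e ^ 2 * second_variation T c a F Ft p k A D)) <= K * Rabs e ^ 3.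
Proof.
  intros HT Ha HV Hr.
  destruct HV as [rd cF cFt cp ck cA cB cD bF bFt bp bk bA bB bD F0 FT].
  pose proof Ha as [Hm Hlow Hup Hc Hder].
  assert (Hapos := fun t => radius_pos T c m a t Ha).
  assert (Hane : forall t, a t <> 0) by (intros t; apply Rgt_not_eq, Hapos).
  assert (ba : bounded_fun (fun x : R * R * R => a (snd x))).
  { destruct Hup as [M HM]. exists M. intros x. rewrite Rabs_pos_eq; auto. left; auto. }
  assert (ba' : bounded_fun (fun x : R * R * R => c / (2 * a (snd x)))).
  { assert (Hi : bounded_fun (fun x : R * R * R => / (2 * a (snd x)))).
    { apply bounded_inv with m; trivial. intros x. specialize (Hlow (snd x)). lra. }
    apply (bounded_mult (fun _ => c)); [apply bounded_const | exact Hi]. }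
  assert (HJ := density_jet (fun x : R * R * R => a (snd x)) (fun x => c / (2 * a (snd x)))
    _ _ _ _ _ _ _ m Hm (fun x => Hlow (snd x)) ba ba' bF bFt bp bk bA bB bD).
  assert (HJR := jet_affine (fun x : R * R * R => a (snd x)) _ ba bF).
  destruct (jet_lower _ _ _ _ m HJR Hm (fun x => Hlow (snd x))) as [d1 [Hd1 HRlow]].
  destruct HJ as [_ [_ [_ [K [d [Hd [HK HJ]]]]]]].
  exists (4 * PI * K * T), (Rmin d d1).
  assert (Hl := Rmin_l d d1). assert (Hrr := Rmin_r d d1).
  assert (HPI := PI_RGT_0).
  split; [apply Rmin_pos; lra | split; [apply Rmult_le_pos; [apply Rmult_le_pos|]; lra|]].
  intros e He.
  set (I1 := fun th ps t => c * (a t * Ft th ps t + c / (2 * a t) * F th ps t) +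
      -4 * ((A th ps t + D th ps t) / a t)).
  set (I2 := fun th ps t => (a t ^ 2 * Ft th ps t ^ 2 +
    (c ^ 2 / 4 * F th ps t ^ 2 + (A th ps t + D th ps t) ^ 2
     - (2 + c ^ 2 / 8) * (p th ps t ^ 2 + k th ps t ^ 2)) / a t ^ 2)
    + c * (2 * F th ps t * Ft th ps t)
    + 4 * ((F th ps t * (A th ps t + D th ps t) + (p th ps t ^ 2 + k th ps t ^ 2)) / a t ^ 2)).
  set (dens := fun th ps t => radial_density (a t + e * F th ps t) (c / (2 * a t) + e * Ft th ps t)
      (e * p th ps t) (e * k th ps t) (e * A th ps t) (e * B th ps t) (e * D th ps t)).
  assert (HRpos : forall th ps t, 0 < a t + e * F th ps t).
  { intros th ps t. assert (H := HRlow (th, ps, t) e ltac:(lra)). simpl in H. lra. }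
  assert (HWpos : forall th ps t, 0 < sqrt ((a t + e * F th ps t) ^ 2 + (e * p th ps t) ^ 2 + (e * k th ps t) ^ 2)).
  { intros th ps t. apply sqrt_lt_R0. specialize (HRpos th ps t).
    assert (H1 := pow2_ge_0 (e * p th ps t)). assert (H2 := pow2_ge_0 (e * k th ps t)).
    assert (0 < (a t + e * F th ps t) ^ 2) by (apply pow_lt; lra). lra. }
  assert (cdens : cont3 dens).
  { intros q. unfold dens, radial_density.
    cont_rad a Ha; try (apply Rgt_not_eq, HRpos);
    cbv beta; try (apply Rmult_integral_contrapositive_currified; [lra | apply Hane]);
    try (apply Rgt_not_eq, HWpos).
    apply Rmult_integral_contrapositive_currified; [apply Rgt_not_eq, HRpos | apply pow_nonzero, Rgt_not_eq, HWpos]. }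
  assert (cI1 : cont3 I1).
  { intros q. unfold I1. cont_rad a Ha; cbv beta;
    try (apply Rmult_integral_contrapositive_currified; [lra | apply Hane]); try apply Hane. }
  assert (cI2 : cont3 I2).
  { intros q. unfold I2. cont_rad a Ha; cbv beta;
    try (apply pow_nonzero, Hane); lra. }
  assert (cG1 : cont3 (fun th ps t => a t * Ft th ps t + c / (2 * a t) * F th ps t)).
  { intros q. cont_rad a Ha; cbv beta;
    try (apply Rmult_integral_contrapositive_currified; [lra | apply Hane]). }
  assert (cG2 : cont3 (fun th ps t => (A th ps t + D th ps t) / a t)).
  { intros q. cont_rad a Ha; cbv beta; apply Hane. }
  assert (cG3 : cont3 (fun th ps t => 2 * F th ps t * Ft th ps t)) by (intros q; cont).
  assert (cG4 : cont3 (fun th ps t => (F th ps t * (A th ps t + D th ps t)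
      + (p th ps t ^ 2 + k th ps t ^ 2)) / a t ^ 2)).
  { intros q. cont_rad a Ha; cbv beta; apply pow_nonzero, Hane. }
  assert (cSV : cont3 (fun th ps t => a t ^ 2 * Ft th ps t ^ 2 +
    (c ^ 2 / 4 * F th ps t ^ 2 + (A th ps t + D th ps t) ^ 2
     - (2 + c ^ 2 / 8) * (p th ps t ^ 2 + k th ps t ^ 2)) / a t ^ 2)).
  { intros q. cont_rad a Ha; cbv beta;
    try (apply pow_nonzero, Hane); lra. }
  assert (z1 : tint T (fun th ps t => a t * Ft th ps t + c / (2 * a t) * F th ps t) = 0).
  { apply (tint_time_derivative T (fun th ps t => a t * F th ps t)); trivial.
    - intros q. cont_rad a Ha.
    - intros th ps t Ht. eapply der_eq; [apply der_mult; [apply Hder, Ht | apply (rd_t _ _ _ _ _ _ _ _ rd), Ht]|].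
      ring.
    - intros; rewrite F0; ring.
    - intros; rewrite FT; ring. }
  assert (z3 : tint T (fun th ps t => 2 * F th ps t * Ft th ps t) = 0).
  { apply (tint_time_derivative T (fun th ps t => F th ps t * F th ps t)); trivial.
    - intros q. cont.
    - intros th ps t Ht. eapply der_eq; [apply der_mult; apply (rd_t _ _ _ _ _ _ _ _ rd), Ht|].
      ring.
    - intros; rewrite F0; ring.
    - intros; rewrite FT; ring. }
  assert (tint0 : forall H : R -> R -> R -> R, (forall t, 0 < t < T -> sint (fun th ps => H th ps t) = 0) -> tint T H = 0).
  { intros H HH. unfold tint. rewrite (RInt_ext (V := R_CompleteNormedModule) _ (fun _ => 0)).
    - rewrite (RInt_const (V := R_CompleteNormedModule)). apply Rmult_0_r.
    - intros t Ht. rewrite Rmin_left, Rmax_right in Ht by lra. apply HH, Ht. }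
  assert (Hsph : forall t, 0 < t < T -> sph_fun (fun th ps => F th ps t) (fun th ps => p th ps t)
    (fun th ps => k th ps t) (fun th ps => A th ps t) (fun th ps => D th ps t)).
  { intros t Ht. apply (rd_sph _ _ _ _ _ _ _ _ rd). lra. }
  assert (z2 : tint T (fun th ps t => (A th ps t + D th ps t) / a t) = 0).
  { apply tint0. intros t Ht.
    assert (HL := green_sym _ _ _ _ _ _ _ _ _ _ (Hsph t Ht) (sph_fun_const (/ a t))).
    cbv beta in HL.
    rewrite (sint_ext _ (fun th ps => / a t * (A th ps t + D th ps t))) by (intros; unfold Rdiv; ring).
    rewrite HL, (sint_ext _ (fun _ _ => 0)) by (intros; ring). rewrite sint_const. ring. }
  assert (z4 : tint T (fun th ps t => (F th ps t * (A th ps t + D th ps t)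
      + (p th ps t ^ 2 + k th ps t ^ 2)) / a t ^ 2) = 0).
  { apply tint0. intros t Ht.
    assert (HG := green _ _ _ _ _ _ _ _ _ _ (Hsph t Ht) (Hsph t Ht)). cbv beta in HG.
    rewrite (sint_ext _ (fun th ps => / a t ^ 2 * (F th ps t * (A th ps t + D th ps t)
      + (p th ps t * p th ps t + k th ps t * k th ps t)))) by (intros; unfold Rdiv; ring).
    rewrite sint_scal, sint_plus, HG by (intros q; cont). ring. }
  assert (E1 : tint T I1 = 0).
  { unfold I1. rewrite tint_plus, !tint_scal, z1, z2 by auto using cont3_scal. ring. }
  assert (E2 : tint T I2 = second_variation T c a F Ft p k A D).
  { unfold I2. rewrite !tint_plus, !tint_scal, z3, z4 by auto using cont3_scal, cont3_plus.
    unfold second_variation. ring. }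
  assert (E0 : action (radial_graph (r e)) T = tint T dens).
  { apply (action_radial _ T _ _ _ _ _ _ _ HT (radial_data_affine T c m a _ _ _ _ _ _ _ e Ha rd)); [apply Hr | intros; apply HRpos]. }
  split; [exact E0|]. rewrite E0, <- E2.
  replace (4 * PI * (c ^ 2 / 4 + 4) * T + e ^ 2 * tint T I2) with
    (tint T (fun _ _ _ => c ^ 2 / 4 + 4) + e * tint T I1 + e ^ 2 * tint T I2)
    by (rewrite tint_const, E1; ring).
  assert (cK : cont3 (fun _ _ _ : R => c ^ 2 / 4 + 4)) by (intros q; apply cont_const).
  rewrite <- !tint_scal, <- !tint_plus by auto using cont3_scal, cont3_plus.
  assert (Hdiff : forall G, cont3 G -> tint T dens - tint T G = tint T (fun th ps t => dens th ps t + -1 * G th ps t)).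
  { intros G HG. rewrite tint_plus, tint_scal by auto using cont3_scal. ring. }
  rewrite Hdiff by auto using cont3_scal, cont3_plus.
  replace (4 * PI * K * T * Rabs e ^ 3) with (4 * PI * (K * Rabs e ^ 3) * T) by ring.
  apply tint_abs_le; [exact HT | intros q; cont |].
  intros th ps t Ht. assert (HH := HJ (th, ps, t) e ltac:(lra)). simpl fst in HH. simpl snd in HH.
  eapply Rle_trans; [|exact HH]. right. f_equal. unfold dens, I1, I2. field. apply Hane.
Qed.

(** * Variations given by ambient functions *)

Definition D1 (g : R -> R -> R -> R -> R) x y z t := Derive (fun s => g s y z t) x.
Definition D2 (g : R -> R -> R -> R -> R) x y z t := Derive (fun s => g x s z t) y.
Definition D3 (g : R -> R -> R -> R -> R) x y z t := Derive (fun s => g x y s t) z.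
Definition D4 (g : R -> R -> R -> R -> R) x y z t := Derive (fun s => g x y z s) t.

Definition smooth4 (g : R -> R -> R -> R -> R) : Prop := forall k, Ck4 k g.

Lemma smooth4_continuous g : smooth4 g -> forall p : R * R * R * R,
  continuous (fun q : R * R * R * R => let '(x, y, z, t) := q in g x y z t) p.
Proof. intros H. exact (H 0%nat). Qed.

Lemma smooth4_comp {U : UniformSpace} g (a b c d : U -> R) p : smooth4 g ->
  continuous a p -> continuous b p -> continuous c p -> continuous d p ->
  continuous (fun q => g (a q) (b q) (c q) (d q)) p.
Proof.
  intros Hg Ha Hb Hc Hd.
  apply (continuous_comp (fun q => (a q, b q, c q, d q))
    (fun q : R * R * R * R => let '(x, y, z, t) := q in g x y z t)).
  - repeat apply cont_pair; trivial.
  - apply smooth4_continuous, Hg.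
Qed.

Lemma smooth4_D g : smooth4 g -> smooth4 (D1 g) /\ smooth4 (D2 g) /\ smooth4 (D3 g) /\ smooth4 (D4 g).
Proof. intros H. repeat split; intros k; apply (H (S k)). Qed.

Lemma smooth4_derive g : smooth4 g -> forall x y z t,
  is_derive (fun s => g s y z t) x (D1 g x y z t) /\ is_derive (fun s => g x s z t) y (D2 g x y z t) /\
  is_derive (fun s => g x y s t) z (D3 g x y z t) /\ is_derive (fun s => g x y z s) t (D4 g x y z t).
Proof.
  intros H x y z t. destruct (H 1%nat) as [E _]. destruct (E x y z t) as (E1 & E2 & E3 & E4).
  repeat split; apply Derive_correct; assumption.
Qed.

Lemma mean_value (f df : R -> R) a b : (forall x, is_derive f x (df x)) ->
  exists c, (Rmin a b <= c <= Rmax a b) /\ f b - f a = df c * (b - a).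
Proof.
  intros H. apply (MVT_gen f a b df).
  - intros x _. apply H.
  - intros x _. apply continuity_pt_filterlim.
    apply (ex_derive_continuous (V := R_NormedModule)). eexists; apply H.
Qed.

Lemma between_dist a b c : Rmin a b <= c <= Rmax a b -> Rabs (c - a) <= Rabs (b - a).
Proof.
  intros H. unfold Rmin, Rmax in H. destruct (Rle_dec a b).
  - rewrite !Rabs_pos_eq; lra.
  - rewrite !Rabs_left1; lra.
Qed.

(** [Ck4] speaks of partial derivatives, so total differentiability is derived from their
    continuity, with mean values along one coordinate direction at a time; time is a fixed
    parameter. *)
Lemma smooth4_differential g x y z t : smooth4 g -> forall e, 0 < e -> exists d, 0 < d /\
  forall x' y' z', Rabs (x' - x) < d -> Rabs (y' - y) < d -> Rabs (z' - z) < d ->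
  Rabs (g x' y' z' t - g x y z t
     - (D1 g x y z t * (x' - x) + D2 g x y z t * (y' - y) + D3 g x y z t * (z' - z)))
  <= e * (Rabs (x' - x) + Rabs (y' - y) + Rabs (z' - z)).
Proof.
  intros Hg e He.
  destruct (smooth4_D g Hg) as (G1 & G2 & G3 & _).
  assert (Hloc : forall h, smooth4 h -> exists d, 0 < d /\
    forall x' y' z', Rabs (x' - x) < d -> Rabs (y' - y) < d -> Rabs (z' - z) < d ->
      Rabs (h x' y' z' t - h x y z t) <= e).
  { intros h Hh. assert (C := smooth4_continuous h Hh (x, y, z, t)). unfold continuous in C.
    apply filterlim_locally with (eps := mkposreal e He) in C. destruct C as [d Hd].
    exists d. split; [apply cond_pos|]. intros x' y' z' Hx Hy Hz.
    assert (B : ball (x, y, z, t) d (x', y', z', t)).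
    { repeat split; trivial. apply ball_center. }
    apply Hd in B. left. exact B. }
  destruct (Hloc _ G1) as [d1 [Hd1 L1]]. destruct (Hloc _ G2) as [d2 [Hd2 L2]].
  destruct (Hloc _ G3) as [d3 [Hd3 L3]].
  exists (Rmin d1 (Rmin d2 d3)). split; [repeat apply Rmin_pos; trivial|].
  assert (M1 := Rmin_l d1 (Rmin d2 d3)). assert (M2 := Rmin_r d1 (Rmin d2 d3)).
  assert (M3 := Rmin_l d2 d3). assert (M4 := Rmin_r d2 d3).
  intros x' y' z' Hx Hy Hz.
  destruct (mean_value (fun s => g s y' z' t) (fun s => D1 g s y' z' t) x x') as [c1 [B1 E1]];
    [intros; apply smooth4_derive, Hg|].
  destruct (mean_value (fun s => g x s z' t) (fun s => D2 g x s z' t) y y') as [c2 [B2 E2]];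
    [intros; apply smooth4_derive, Hg|].
  destruct (mean_value (fun s => g x y s t) (fun s => D3 g x y s t) z z') as [c3 [B3 E3]];
    [intros; apply smooth4_derive, Hg|].
  apply between_dist in B1, B2, B3.
  assert (Z : forall v, Rabs (v - v) < d1 /\ Rabs (v - v) < d2 /\ Rabs (v - v) < d3).
  { intros v. rewrite Rminus_diag, Rabs_R0. auto. }
  assert (F1 := L1 c1 y' z' ltac:(lra) ltac:(lra) ltac:(lra)).
  assert (F2 := L2 x c2 z' (proj1 (proj2 (Z x))) ltac:(lra) ltac:(lra)).
  assert (F3 := L3 x y c3 (proj2 (proj2 (Z x))) (proj2 (proj2 (Z y))) ltac:(lra)).
  replace (_ - _ - _) with ((D1 g c1 y' z' t - D1 g x y z t) * (x' - x)
     + (D2 g x c2 z' t - D2 g x y z t) * (y' - y) + (D3 g x y c3 t - D3 g x y z t) * (z' - z)) by lra.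
  eapply Rle_trans; [apply Rabs_triang|]. rewrite 2!Rmult_plus_distr_l.
  apply Rplus_le_compat; [eapply Rle_trans; [apply Rabs_triang|]; apply Rplus_le_compat|];
  rewrite Rabs_mult; apply Rmult_le_compat_r; auto using Rabs_pos.
Qed.

Lemma derive_linear_bound (f : R -> R) s l : is_derive f s l -> forall e, 0 < e ->
  exists d, 0 < d /\ forall u, Rabs (u - s) < d -> Rabs (f u - f s - l * (u - s)) <= e * Rabs (u - s).
Proof.
  intros H e He. apply is_derive_Reals in H. destruct (H e He) as [d Hd].
  exists d. split; [apply cond_pos|]. intros u Hu.
  destruct (Req_dec u s) as [->|Hne].
  - rewrite !Rminus_diag, Rmult_0_r, Rminus_diag, Rabs_R0. lra.
  - specialize (Hd (u - s) ltac:(lra) Hu). replace (s + (u - s)) with u in Hd by ring.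
    replace (f u - f s - l * (u - s)) with (((f u - f s) / (u - s) - l) * (u - s)) by (field; lra).
    rewrite Rabs_mult. apply Rmult_le_compat_r; [apply Rabs_pos | lra].
Qed.

Lemma chain_rule3 g (X Y Z : R -> R) t s X' Y' Z' : smooth4 g ->
  is_derive X s X' -> is_derive Y s Y' -> is_derive Z s Z' ->
  is_derive (fun u => g (X u) (Y u) (Z u) t) s
    (D1 g (X s) (Y s) (Z s) t * X' + D2 g (X s) (Y s) (Z s) t * Y' + D3 g (X s) (Y s) (Z s) t * Z').
Proof.
  intros Hg HX HY HZ. apply is_derive_Reals. intros e He.
  set (G1 := D1 g (X s) (Y s) (Z s) t). set (G2 := D2 g (X s) (Y s) (Z s) t).
  set (G3 := D3 g (X s) (Y s) (Z s) t).
  (* [M] dominates the speed of the curve and [N] the gradient of [g], so the remainder of [g] and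
     the remainders of the curve contribute at most [e / 4] each. *)
  set (M := Rabs X' + Rabs Y' + Rabs Z' + 3).
  set (N := Rabs G1 + Rabs G2 + Rabs G3 + 1).
  assert (P1 := Rabs_pos X'). assert (P2 := Rabs_pos Y'). assert (P3 := Rabs_pos Z').
  assert (Q1 := Rabs_pos G1). assert (Q2 := Rabs_pos G2). assert (Q3 := Rabs_pos G3).
  assert (He1 : 0 < e / (4 * M)) by (apply Rdiv_lt_0_compat; unfold M; lra).
  set (e2 := Rmin 1 (e / (4 * N))).
  assert (He2 : 0 < e2).
  { apply Rmin_pos; [lra|]. apply Rdiv_lt_0_compat; unfold N; lra. }
  assert (He21 : e2 <= 1) by apply Rmin_l.
  assert (He2N : e2 * N <= e / 4).
  { apply Rle_trans with (e / (4 * N) * N).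
    - apply Rmult_le_compat_r; [unfold N; lra | apply Rmin_r].
    - right. field. unfold N; lra. }
  destruct (smooth4_differential g (X s) (Y s) (Z s) t Hg _ He1) as [d [Hd HD]].
  destruct (derive_linear_bound X s X' HX e2 He2) as [dx [Hdx HbX]].
  destruct (derive_linear_bound Y s Y' HY e2 He2) as [dy [Hdy HbY]].
  destruct (derive_linear_bound Z s Z' HZ e2 He2) as [dz [Hdz HbZ]].
  set (d0 := Rmin (Rmin dx dy) (Rmin dz (d / M))).
  assert (HdM : 0 < d / M) by (apply Rdiv_lt_0_compat; unfold M; lra).
  assert (Hd0 : 0 < d0) by (repeat apply Rmin_pos; trivial).
  exists (mkposreal _ Hd0). intros h Hh0 Hh. simpl in Hh.
  assert (m1 := Rmin_l (Rmin dx dy) (Rmin dz (d / M))). assert (m2 := Rmin_r (Rmin dx dy) (Rmin dz (d / M))).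
  assert (m3 := Rmin_l dx dy). assert (m4 := Rmin_r dx dy).
  assert (m5 := Rmin_l dz (d / M)). assert (m6 := Rmin_r dz (d / M)). fold d0 in m1, m2.
  assert (Hu : s + h - s = h) by ring.
  assert (BX := HbX (s + h)). assert (BY := HbY (s + h)). assert (BZ := HbZ (s + h)).
  rewrite Hu in BX, BY, BZ.
  specialize (BX ltac:(lra)). specialize (BY ltac:(lra)). specialize (BZ ltac:(lra)).
  assert (Hah : 0 < Rabs h) by (apply Rabs_pos_lt; exact Hh0).
  assert (Hlip : forall W W' : R, Rabs (W - W' * h) <= e2 * Rabs h -> Rabs W <= (Rabs W' + 1) * Rabs h).
  { intros W W' HW. replace W with ((W - W' * h) + W' * h) by ring.
    eapply Rle_trans; [apply Rabs_triang|]. rewrite Rabs_mult. nra. }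
  assert (LX := Hlip _ _ BX). assert (LY := Hlip _ _ BY). assert (LZ := Hlip _ _ BZ).
  assert (HhM : M * Rabs h < d).
  { apply Rlt_le_trans with (M * (d / M)).
    - apply Rmult_lt_compat_l; [unfold M|]; lra.
    - right; field; unfold M; lra. }
  assert (HhM' : forall w, w + 1 <= Rabs X' + Rabs Y' + Rabs Z' + 3 -> (w + 1) * Rabs h < d).
  { intros w Hw. eapply Rle_lt_trans; [|exact HhM]. apply Rmult_le_compat_r; [lra | exact Hw]. }
  assert (SX : Rabs (X (s + h) - X s) < d) by (eapply Rle_lt_trans; [exact LX | apply HhM'; lra]).
  assert (SY : Rabs (Y (s + h) - Y s) < d) by (eapply Rle_lt_trans; [exact LY | apply HhM'; lra]).
  assert (SZ : Rabs (Z (s + h) - Z s) < d) by (eapply Rle_lt_trans; [exact LZ | apply HhM'; lra]).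
  assert (HT := HD _ _ _ SX SY SZ). fold G1 G2 G3 in HT.
  set (dX := X (s + h) - X s) in *. set (dY := Y (s + h) - Y s) in *. set (dZ := Z (s + h) - Z s) in *.
  set (dg := g (X (s + h)) (Y (s + h)) (Z (s + h)) t - g (X s) (Y s) (Z s) t) in *.
  assert (HA : Rabs (dg - (G1 * X' + G2 * Y' + G3 * Z') * h) <= e / 2 * Rabs h).
  { replace (dg - _) with ((dg - (G1 * dX + G2 * dY + G3 * dZ))
       + (G1 * (dX - X' * h) + G2 * (dY - Y' * h) + G3 * (dZ - Z' * h))) by ring.
    eapply Rle_trans; [apply Rabs_triang|].
    assert (T1 : Rabs (dg - (G1 * dX + G2 * dY + G3 * dZ)) <= e / 4 * Rabs h).
    { eapply Rle_trans; [exact HT|].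
      apply Rle_trans with (e / (4 * M) * (M * Rabs h)).
      - apply Rmult_le_compat_l; [lra|]. unfold M. lra.
      - right. field. unfold M; lra. }
    assert (T2 : Rabs (G1 * (dX - X' * h) + G2 * (dY - Y' * h) + G3 * (dZ - Z' * h)) <= e / 4 * Rabs h).
    { apply Rle_trans with (N * (e2 * Rabs h)); [|nra].
      eapply Rle_trans; [apply Rabs_triang|].
      eapply Rle_trans; [apply Rplus_le_compat_r, Rabs_triang|]. rewrite !Rabs_mult.
      assert (U1 : Rabs G1 * Rabs (dX - X' * h) <= Rabs G1 * (e2 * Rabs h)) by (apply Rmult_le_compat_l; trivial).
      assert (U2 : Rabs G2 * Rabs (dY - Y' * h) <= Rabs G2 * (e2 * Rabs h)) by (apply Rmult_le_compat_l; trivial).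
      assert (U3 : Rabs G3 * Rabs (dZ - Z' * h) <= Rabs G3 * (e2 * Rabs h)) by (apply Rmult_le_compat_l; trivial).
      assert (U4 : 0 < e2 * Rabs h) by (apply Rmult_lt_0_compat; trivial).
      unfold N. lra. }
    lra. }
  replace (dg / h - (G1 * X' + G2 * Y' + G3 * Z')) with ((dg - (G1 * X' + G2 * Y' + G3 * Z') * h) / h) by (field; trivial).
  unfold Rdiv. rewrite Rabs_mult, Rabs_inv.
  apply Rle_lt_trans with (e / 2 * Rabs h * / Rabs h).
  - apply Rmult_le_compat_r; trivial. left. apply Rinv_0_lt_compat, Hah.
  - replace (e / 2 * Rabs h * / Rabs h) with (e / 2) by (field; lra). lra.
Qed.

(* The data of a variation are frozen outside [0, T], which makes them continuous and bounded on
   the whole parameter space. *)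
Definition clamp (T t : R) : R := Rmax 0 (Rmin t T).

Lemma clamp_in T t : 0 <= T -> 0 <= clamp T t <= T.
Proof.
  intros HT. unfold clamp. split; [apply Rmax_l|].
  apply Rmax_lub; [exact HT | apply Rmin_r].
Qed.

Lemma clamp_id T t : 0 <= t <= T -> clamp T t = t.
Proof. intros Ht. unfold clamp. rewrite Rmin_left, Rmax_right; lra. Qed.

(** Minimum and maximum are rewritten through absolute values. *)
Lemma continuous_clamp T t : continuous (clamp T) t.
Proof.
  unfold clamp.
  apply continuous_ext with (f := fun t => (0 + (t + T - Rabs (t - T)) / 2 + Rabs (0 - (t + T - Rabs (t - T)) / 2)) / 2).
  { intros s.
    assert (E : Rmin s T = (s + T - Rabs (s - T)) / 2).
    { unfold Rmin. destruct (Rle_dec s T); [rewrite Rabs_left1 | rewrite Rabs_pos_eq]; lra. }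
    rewrite E. unfold Rmax. destruct (Rle_dec 0 ((s + T - Rabs (s - T)) / 2));
      [rewrite (Rabs_left1 (0 - _)) | rewrite (Rabs_pos_eq (0 - _))]; lra. }
  assert (Ha : forall (f : R -> R) x, continuous f x -> continuous (fun y => Rabs (f y)) x).
  { intros f x Hf. apply (cont_comp Rabs); [apply continuous_Rabs | exact Hf]. }
  repeat first [ cont_step
    | match goal with |- continuous (fun q => Rabs (@?f q)) _ => apply (Ha f) end ]; lra.
Qed.

Lemma locally_open_interval (a b t : R) (Q : R -> Prop) : a < t < b ->
  (forall s, a < s < b -> Q s) -> locally t Q.
Proof.
  intros Ht HQ. assert (Hd : 0 < Rmin (t - a) (b - t)) by (apply Rmin_pos; lra).
  exists (mkposreal _ Hd). intros s Hs.
  change (Rabs (s - t) < Rmin (t - a) (b - t)) in Hs. apply Rabs_def2 in Hs.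
  assert (H1 := Rmin_l (t - a) (b - t)). assert (H2 := Rmin_r (t - a) (b - t)).
  apply HQ. lra.
Qed.

Definition on_sphere (T : R) (g : R -> R -> R -> R -> R) (th ps t : R) : R :=
  g (x1 th ps) (x2 th ps) (x3 th ps) (clamp T t).

Lemma cont3_on_sphere T g : smooth4 g -> cont3 (on_sphere T g).
Proof.
  intros Hg p. unfold on_sphere, x1, x2, x3.
  apply (smooth4_comp g); trivial; try (solve [cont]).
  apply (cont_comp (clamp T)); [apply continuous_clamp | cont].
Qed.

Lemma x_range th ps : -1 <= x1 th ps <= 1 /\ -1 <= x2 th ps <= 1 /\ -1 <= x3 th ps <= 1.
Proof.
  assert (H := x_unit th ps).
  assert (E : forall u, u * u <= 1 -> -1 <= u <= 1) by (intros; nra).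
  assert (H1 := Rle_0_sqr (x1 th ps)). assert (H2 := Rle_0_sqr (x2 th ps)).
  assert (H3 := Rle_0_sqr (x3 th ps)). unfold Rsqr in *.
  split; [|split]; apply E; lra.
Qed.

Lemma bounded3_on_sphere T g : 0 <= T -> smooth4 g -> bounded3 (on_sphere T g).
Proof.
  intros HT Hg. destruct (bounded_on_box g T (smooth4_continuous g Hg)) as [M [_ HM]].
  exists M. intros [[th ps] t]. simpl. unfold on_sphere.
  destruct (x_range th ps) as (H1 & H2 & H3). apply HM; trivial. apply clamp_in, HT.
Qed.

Section AmbientData.
Context (T : R) (g : R -> R -> R -> R -> R) (HT : 0 <= T) (Hg : smooth4 g).

Let G i := on_sphere T (match i with O => D1 g | S O => D2 g | _ => D3 g end).
Let H i j := on_sphere T (match i, j with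
  | O, O => D1 (D1 g) | O, S O => D2 (D1 g) | O, _ => D3 (D1 g)
  | S O, O => D1 (D2 g) | S O, S O => D2 (D2 g) | S O, _ => D3 (D2 g)
  | _, O => D1 (D3 g) | _, S O => D2 (D3 g) | _, _ => D3 (D3 g) end).

Definition am_F := on_sphere T g.
Definition am_Ft := on_sphere T (D4 g).
Definition am_dot (a b c : R) (th ps t : R) : R := G 0 th ps t * a + G 1 th ps t * b + G 2 th ps t * c.
Definition am_hess (a b c a' b' c' : R) (th ps t : R) : R :=
  (H 0 0 th ps t * a' + H 0 1 th ps t * b' + H 0 2 th ps t * c') * a
  + (H 1 0 th ps t * a' + H 1 1 th ps t * b' + H 1 2 th ps t * c') * b
  + (H 2 0 th ps t * a' + H 2 1 th ps t * b' + H 2 2 th ps t * c') * c.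
Definition am_p th ps t := am_dot (cos th * cos ps) (cos th * sin ps) (- sin th) th ps t.
Definition am_k th ps t := am_dot (- sin ps) (cos ps) 0 th ps t.
(** The radial derivative of [g]. The Hessian on the sphere is the ambient Hessian minus this
    derivative times the metric, so it corrects the diagonal entries [am_A] and [am_D] but not
    [am_B]. *)
Definition am_x th ps t := am_dot (sin th * cos ps) (sin th * sin ps) (cos th) th ps t.
Definition am_A th ps t :=
  am_hess (cos th * cos ps) (cos th * sin ps) (- sin th)
    (cos th * cos ps) (cos th * sin ps) (- sin th) th ps t - am_x th ps t.
Definition am_B th ps t :=
  am_hess (cos th * cos ps) (cos th * sin ps) (- sin th) (- sin ps) (cos ps) 0 th ps t.
Definition am_D th ps t :=
  am_hess (- sin ps) (cos ps) 0 (- sin ps) (cos ps) 0 th ps t - am_x th ps t.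

Lemma am_smooth : smooth4 (D1 g) /\ smooth4 (D2 g) /\ smooth4 (D3 g) /\ smooth4 (D4 g) /\
  smooth4 (D1 (D1 g)) /\ smooth4 (D2 (D1 g)) /\ smooth4 (D3 (D1 g)) /\
  smooth4 (D1 (D2 g)) /\ smooth4 (D2 (D2 g)) /\ smooth4 (D3 (D2 g)) /\
  smooth4 (D1 (D3 g)) /\ smooth4 (D2 (D3 g)) /\ smooth4 (D3 (D3 g)).
Proof.
  destruct (smooth4_D g Hg) as (G1 & G2 & G3 & G4).
  destruct (smooth4_D _ G1) as (H11 & H12 & H13 & _).
  destruct (smooth4_D _ G2) as (H21 & H22 & H23 & _).
  destruct (smooth4_D _ G3) as (H31 & H32 & H33 & _). tauto.
Qed.

Lemma G_smooth (Q : (R -> R -> R -> R) -> Prop) :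
  (forall h, smooth4 h -> Q (on_sphere T h)) -> forall i, Q (G i).
Proof.
  intros HQ i. destruct am_smooth as (? & ? & ? & _).
  destruct i as [|[|i]]; apply HQ; assumption.
Qed.

Lemma H_smooth (Q : (R -> R -> R -> R) -> Prop) :
  (forall h, smooth4 h -> Q (on_sphere T h)) -> forall i j, Q (H i j).
Proof.
  intros HQ i j. destruct am_smooth as (_ & _ & _ & _ & ? & ? & ? & ? & ? & ? & ? & ? & ?).
  destruct i as [|[|i]]; destruct j as [|[|j]]; apply HQ; assumption.
Qed.

Lemma on_sphere_der_th h th ps t : smooth4 h ->
  is_derive (fun a => on_sphere T h a ps t) th
    (on_sphere T (D1 h) th ps t * (cos th * cos ps) + on_sphere T (D2 h) th ps t * (cos th * sin ps)
     + on_sphere T (D3 h) th ps t * (- sin th)).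
Proof.
  intros Hh. unfold on_sphere.
  apply (chain_rule3 h (fun a => x1 a ps) (fun a => x2 a ps) (fun a => x3 a ps)); trivial;
    unfold x1, x2, x3; auto_derive; trivial; ring.
Qed.

Lemma on_sphere_der_ps h th ps t : smooth4 h ->
  is_derive (fun a => on_sphere T h th a t) ps
    (sin th * (on_sphere T (D1 h) th ps t * (- sin ps) + on_sphere T (D2 h) th ps t * cos ps
       + on_sphere T (D3 h) th ps t * 0)).
Proof.
  intros Hh. unfold on_sphere.
  eapply der_eq.
  - apply (chain_rule3 h (fun a => x1 th a) (fun a => x2 th a) (fun a => x3 th a) _ _
      (sin th * - sin ps) (sin th * cos ps) 0); trivial;
    unfold x1, x2, x3; auto_derive; trivial; ring.
  - ring.
Qed.

Lemma G_der_th i th ps t : is_derive (fun a => G i a ps t) th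
  (H i 0 th ps t * (cos th * cos ps) + H i 1 th ps t * (cos th * sin ps) + H i 2 th ps t * (- sin th)).
Proof.
  destruct am_smooth as (? & ? & ? & _).
  destruct i as [|[|i]]; apply on_sphere_der_th; assumption.
Qed.

Lemma G_der_ps i th ps t : is_derive (fun a => G i th a t) ps
  (sin th * (H i 0 th ps t * (- sin ps) + H i 1 th ps t * cos ps + H i 2 th ps t * 0)).
Proof.
  destruct am_smooth as (? & ? & ? & _).
  destruct i as [|[|i]]; apply on_sphere_der_ps; assumption.
Qed.

Ltac cont_am := unfold am_p, am_k, am_A, am_B, am_D, am_x, am_dot, am_hess;
  intros v;
  repeat first
    [ cont_step
    | match goal with
      | |- continuous (fun q => G ?i (@?a q) (@?b q) (@?c q)) _ =>
          apply (cont3_comp (G i) a b c _ (G_smooth cont3 (cont3_on_sphere T) i))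
      | |- continuous (fun q => H ?i ?j (@?a q) (@?b q) (@?c q)) _ =>
          apply (cont3_comp (H i j) a b c _ (H_smooth cont3 (cont3_on_sphere T) i j))
      end ].

Lemma cont3_am_p : cont3 am_p. Proof. cont_am. Qed.
Lemma cont3_am_k : cont3 am_k. Proof. cont_am. Qed.
Lemma cont3_am_A : cont3 am_A. Proof. cont_am. Qed.
Lemma cont3_am_B : cont3 am_B. Proof. cont_am. Qed.
Lemma cont3_am_D : cont3 am_D. Proof. cont_am. Qed.

Lemma bounded_sin_comp {P : Type} (f : P -> R) : bounded_fun (fun x => sin (f x)).
Proof. exists 1. intros x. apply Rabs_le. apply SIN_bound. Qed.

Lemma bounded_cos_comp {P : Type} (f : P -> R) : bounded_fun (fun x => cos (f x)).
Proof. exists 1. intros x. apply Rabs_le. apply COS_bound. Qed.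

Ltac bdd_am := unfold bounded3, am_p, am_k, am_A, am_B, am_D, am_x, am_dot, am_hess;
  repeat first
    [ apply (G_smooth bounded3 (fun h => bounded3_on_sphere T h HT))
    | apply (H_smooth bounded3 (fun h => bounded3_on_sphere T h HT))
    | apply bounded_const | apply bounded_sin_comp | apply bounded_cos_comp
    | apply bounded_plus | apply bounded_minus | apply bounded_opp | apply bounded_mult ].

Lemma bounded3_am_p : bounded3 am_p. Proof. bdd_am. Qed.
Lemma bounded3_am_k : bounded3 am_k. Proof. bdd_am. Qed.
Lemma bounded3_am_A : bounded3 am_A. Proof. bdd_am. Qed.
Lemma bounded3_am_B : bounded3 am_B. Proof. bdd_am. Qed.
Lemma bounded3_am_D : bounded3 am_D. Proof. bdd_am. Qed.

Ltac der_am :=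
  repeat match goal with
  | |- is_derive (fun y => @?f y + @?g y) _ _ => apply (der_plus f g)
  | |- is_derive (fun y => @?f y - @?g y) _ _ => apply (der_minus f g)
  | |- is_derive (fun y => @?f y * @?g y) _ _ => apply (der_mult f g)
  | |- is_derive (fun y => G ?i y _ _) _ _ => apply G_der_th
  | |- is_derive (fun y => G ?i _ y _) _ _ => apply G_der_ps
  | |- is_derive (fun y => sin y) _ _ => apply is_derive_sin
  | |- is_derive (fun y => cos y) _ _ => apply is_derive_cos
  | |- is_derive (fun y => - @?f y) _ _ => apply (is_derive_opp (V := R_NormedModule) f)
  | |- is_derive (fun _ => ?c) _ _ => apply (is_derive_const (V := R_NormedModule))
  end.

Lemma ambient_sph_fun t : sph_fun (fun th ps => am_F th ps t) (fun th ps => am_p th ps t)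
  (fun th ps => am_k th ps t) (fun th ps => am_A th ps t) (fun th ps => am_D th ps t).
Proof.
  split.
  - apply cont3_slice, cont3_on_sphere, Hg.
  - apply cont3_slice, cont3_am_p.
  - apply cont3_slice, cont3_am_k.
  - apply cont3_slice, cont3_am_A.
  - apply cont3_slice, cont3_am_D.
  - intros. apply on_sphere_der_th, Hg.
  - intros. apply on_sphere_der_ps, Hg.
  - intros th ps. unfold am_p, am_A, am_dot, am_hess, am_x, am_dot. eapply der_eq; [der_am | unfold zero, opp; simpl; ring].
  - intros th ps. unfold am_k, am_p, am_D, am_dot, am_hess, am_x, am_dot.
    eapply der_eq; [der_am|].
    unfold zero, opp; simpl. ring_simplify.
    rewrite ?(sin_sqr th).
    ring.
  - intros. unfold am_F, on_sphere, x1, x2, x3. rewrite sin_2PI, cos_2PI, sin_0, cos_0. reflexivity.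
  - intros. unfold am_k, am_dot, G, on_sphere, x1, x2, x3. rewrite sin_2PI, cos_2PI, sin_0, cos_0. reflexivity.
Qed.

Lemma ambient_radial_data : radial_data T am_F am_Ft am_p am_k am_A am_B am_D.
Proof.
  split.
  - intros. apply ambient_sph_fun.
  - intros th ps t _. unfold am_k, am_p, am_B, am_dot, am_hess, am_dot.
    eapply der_eq; [der_am | unfold zero, opp; simpl; ring].
  - intros th ps t Ht. unfold am_F, am_Ft, on_sphere. rewrite clamp_id by lra.
    apply is_derive_ext_loc with (f := fun s => g (x1 th ps) (x2 th ps) (x3 th ps) s).
    + apply (locally_open_interval 0 T); trivial. intros s Hs. rewrite clamp_id by lra. reflexivity.
    + apply smooth4_derive, Hg.
Qed.

(** Changing one coordinate at a time leaves the sphere but stays in the cube [[-1, 1]^3], where the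
    partial derivatives are bounded; hence a Lipschitz bound. *)
Lemma ambient_modulus t : sph_modulus (fun th ps => am_F th ps t).
Proof.
  destruct am_smooth as (G1 & G2 & G3 & _).
  destruct (bounded_on_box _ T (smooth4_continuous _ G1)) as [M1 [P1 B1]].
  destruct (bounded_on_box _ T (smooth4_continuous _ G2)) as [M2 [P2 B2]].
  destruct (bounded_on_box _ T (smooth4_continuous _ G3)) as [M3 [P3 B3]].
  apply lipschitz_modulus with (M1 + M2 + M3); [lra|].
  intros th' ps' th ps. unfold am_F, on_sphere.
  destruct (x_range th ps) as (R1 & R2 & R3). destruct (x_range th' ps') as (S1 & S2 & S3).
  assert (Hc := clamp_in T t HT).
  generalize dependent (x1 th ps). generalize dependent (x2 th ps). generalize dependent (x3 th ps).
  generalize dependent (x1 th' ps'). generalize dependent (x2 th' ps'). generalize dependent (x3 th' ps').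
  generalize dependent (clamp T t).
  intros s Hs z Hz y Hy x Hx z' Hz' y' Hy' x' Hx'.
  destruct (mean_value (fun u => g u y' z' s) (fun u => D1 g u y' z' s) x x') as [c1 [C1 E1]];
    [intros; apply smooth4_derive, Hg|].
  destruct (mean_value (fun u => g x u z' s) (fun u => D2 g x u z' s) y y') as [c2 [C2 E2]];
    [intros; apply smooth4_derive, Hg|].
  destruct (mean_value (fun u => g x y u s) (fun u => D3 g x y u s) z z') as [c3 [C3 E3]];
    [intros; apply smooth4_derive, Hg|].
  assert (Hbox : forall a b c, Rmin a b <= c <= Rmax a b -> -1 <= a <= 1 -> -1 <= b <= 1 -> -1 <= c <= 1).
  { intros a b c Hc Ha Hb. unfold Rmin, Rmax in Hc. destruct (Rle_dec a b); lra. }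
  assert (F1 := B1 c1 y' z' s (Hbox _ _ _ C1 Hx Hx') Hy' Hz' Hs).
  assert (F2 := B2 x c2 z' s Hx (Hbox _ _ _ C2 Hy Hy') Hz' Hs).
  assert (F3 := B3 x y c3 s Hx Hy (Hbox _ _ _ C3 Hz Hz') Hs).
  replace (g x' y' z' s - g x y z s) with
    (D1 g c1 y' z' s * (x' - x) + D2 g x c2 z' s * (y' - y) + D3 g x y c3 s * (z' - z)) by lra.
  eapply Rle_trans; [apply Rabs_triang|].
  eapply Rle_trans; [apply Rplus_le_compat_r, Rabs_triang|]. rewrite !Rabs_mult.
  assert (Q1 := Rabs_pos (x' - x)). assert (Q2 := Rabs_pos (y' - y)). assert (Q3 := Rabs_pos (z' - z)).
  assert (K1 := Rmult_le_compat_r _ _ _ Q1 F1). assert (K2 := Rmult_le_compat_r _ _ _ Q2 F2).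
  assert (K3 := Rmult_le_compat_r _ _ _ Q3 F3).
  assert (0 <= M2 * Rabs (x' - x)) by (apply Rmult_le_pos; lra).
  assert (0 <= M3 * Rabs (x' - x)) by (apply Rmult_le_pos; lra).
  assert (0 <= M1 * Rabs (y' - y)) by (apply Rmult_le_pos; lra).
  assert (0 <= M3 * Rabs (y' - y)) by (apply Rmult_le_pos; lra).
  assert (0 <= M1 * Rabs (z' - z)) by (apply Rmult_le_pos; lra).
  assert (0 <= M2 * Rabs (z' - z)) by (apply Rmult_le_pos; lra). lra.
Qed.

Lemma ambient_variation_data :
  (forall th ps, g (x1 th ps) (x2 th ps) (x3 th ps) 0 = 0) ->
  (forall th ps, g (x1 th ps) (x2 th ps) (x3 th ps) T = 0) ->
  variation_data T am_F am_Ft am_p am_k am_A am_B am_D.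
Proof.
  intros H0 H1. destruct (smooth4_D g Hg) as (_ & _ & _ & G4).
  split.
  - apply ambient_radial_data.
  - apply cont3_on_sphere, Hg.
  - apply cont3_on_sphere, G4.
  - apply cont3_am_p.
  - apply cont3_am_k.
  - apply cont3_am_A.
  - apply cont3_am_B.
  - apply cont3_am_D.
  - apply bounded3_on_sphere; trivial.
  - apply bounded3_on_sphere; trivial.
  - apply bounded3_am_p.
  - apply bounded3_am_k.
  - apply bounded3_am_A.
  - apply bounded3_am_B.
  - apply bounded3_am_D.
  - intros. unfold am_F, on_sphere. rewrite clamp_id by lra. apply H0.
  - intros. unfold am_F, on_sphere. rewrite clamp_id by lra. apply H1.
Qed.
End AmbientData.

(** * The optimal spherical trajectory *)

Lemma action_spherical T r g : 0 < T ->
  (forall t, 0 < t < T -> ex_derive g t) -> (forall t, 0 <= t <= T -> 0 < g t) ->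
  (forall t, 0 <= t <= T -> r t = g t) ->
  action (spherical r) T = RInt (fun t => 4 * PI * ((g t * Derive g t) ^ 2 + 4)) 0 T.
Proof.
  intros HT Hd Hp Hr. unfold spherical.
  rewrite (action_radial (fun _ t => r t) T (fun _ _ t => g t) (fun _ _ t => Derive g t)
    (fun _ _ _ => 0) (fun _ _ _ => 0) (fun _ _ _ => 0) (fun _ _ _ => 0) (fun _ _ _ => 0) HT).
  - apply RInt_ext. intros t Ht. rewrite Rmin_left, Rmax_right in Ht by lra.
    assert (Hg : 0 < g t) by (apply Hp; lra).
    rewrite <- sint_const. apply sint_ext. intros th ps. unfold radial_density.
    replace (g t ^ 2 + 0 ^ 2 + 0 ^ 2) with (g t * g t) by ring.
    rewrite sqrt_square by lra. field. lra.
  - split.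
    + intros t _. apply sph_fun_const.
    + intros th ps t _. apply der_eq with 0; [apply (is_derive_const (V := R_NormedModule)) | ring].
    + intros th ps t Ht. apply Derive_correct, Hd, Ht.
  - intros; apply Hr; trivial.
  - intros; apply Hp; trivial.
Qed.

Definition opt_slope (R0 RT T : R) : R := (RT ^ 2 - R0 ^ 2) / T.
Definition opt_radius (R0 RT T t : R) : R := sqrt (R0 ^ 2 + opt_slope R0 RT T * t).

(** With [q = b + c t], every derivative has the form [C sqrt(q) q^(-n)], and the next constant is
    [C c (1/2 - n)]. The set [U] is open so that these formulas can be differentiated again. *)
Lemma sqrt_affine_smooth b c (U : R -> Prop) : (forall t, U t -> 0 < b + c * t) ->
  (forall t, U t -> locally t U) ->
  forall n t, U t -> ex_derive_n (fun s => sqrt (b + c * s)) n t.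
Proof.
  intros HU Ho.
  assert (Hn : forall n, exists C, forall t, U t ->
    Derive_n (fun s => sqrt (b + c * s)) n t = C * (sqrt (b + c * t) * (/ (b + c * t)) ^ n)).
  { assert (Hstep : forall n C t, U t -> is_derive (fun s => C * (sqrt (b + c * s) * (/ (b + c * s)) ^ n)) t
      (C * c * (/ 2 - INR n) * (sqrt (b + c * t) * (/ (b + c * t)) ^ S n))).
    { intros n C t Ht. assert (Hq := HU t Ht).
      assert (Hs := sqrt_lt_R0 _ Hq). assert (Hss := sqrt_sqrt _ (Rlt_le _ _ Hq)).
      auto_derive; [split; [lra | split; [lra | trivial]]|].
      destruct n; simpl pred; simpl pow.
      - simpl INR. set (s := sqrt (b + c * t)) in *.
        rewrite <- Hss. field. lra.
      - set (s := sqrt (b + c * t)) in *. rewrite <- Hss.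
        set (P := (/ (s * s)) ^ n). field. lra. }
    induction n as [|n [C HC]].
    - exists 1. intros t Ht. simpl. ring.
    - exists (C * c * (/ 2 - INR n)). intros t Ht. simpl Derive_n.
      rewrite (Derive_ext_loc _ (fun s => C * (sqrt (b + c * s) * (/ (b + c * s)) ^ n))).
      + apply is_derive_unique, Hstep, Ht.
      + eapply filter_imp; [|apply Ho, Ht]. exact HC. }
  intros [|n] t Ht; simpl; [trivial|].
  destruct (Hn n) as [C HC].
  apply ex_derive_ext_loc with (f := fun s => C * (sqrt (b + c * s) * (/ (b + c * s)) ^ n)).
  - eapply filter_imp; [|apply Ho, Ht]. intros s Hs. symmetry. apply HC, Hs.
  - assert (Hq := HU t Ht). auto_derive. split; [lra | split; [lra | trivial]].
Qed.

Section OptimalTrajectory.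
Context (R0 RT T : R) (HR0 : 0 < R0) (HRT : 0 < RT) (HT : 0 < T).
Let c := opt_slope R0 RT T.

Lemma opt_slope_T : c * T = RT ^ 2 - R0 ^ 2.
Proof. unfold c, opt_slope. field. lra. Qed.

Definition opt_low : R := Rmin (R0 ^ 2) (RT ^ 2).

Lemma opt_low_pos : 0 < opt_low.
Proof. apply Rmin_pos; apply pow_lt; assumption. Qed.

(** The squared radius is a convex combination of [R0^2] and [RT^2]. *)
Lemma opt_square_low t : 0 <= t <= T -> opt_low <= R0 ^ 2 + c * t.
Proof.
  intros Ht. assert (H1 := Rmin_l (R0 ^ 2) (RT ^ 2)). assert (H2 := Rmin_r (R0 ^ 2) (RT ^ 2)).
  fold opt_low in H1, H2. assert (H := opt_slope_T).
  assert (E : T * (R0 ^ 2 + c * t) = (T - t) * R0 ^ 2 + t * RT ^ 2).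
  { replace (RT ^ 2) with (R0 ^ 2 + c * T) by lra. ring. }
  apply Rmult_le_reg_l with T; trivial. rewrite E. nra.
Qed.

Lemma opt_square_up t : 0 <= t <= T -> R0 ^ 2 + c * t <= Rmax (R0 ^ 2) (RT ^ 2).
Proof.
  intros Ht. assert (H1 := Rmax_l (R0 ^ 2) (RT ^ 2)). assert (H2 := Rmax_r (R0 ^ 2) (RT ^ 2)).
  assert (H := opt_slope_T).
  assert (E : T * (R0 ^ 2 + c * t) = (T - t) * R0 ^ 2 + t * RT ^ 2).
  { replace (RT ^ 2) with (R0 ^ 2 + c * T) by lra. ring. }
  apply Rmult_le_reg_l with T; trivial. rewrite E. nra.
Qed.

Lemma opt_radius_derive t : 0 < R0 ^ 2 + c * t ->
  is_derive (opt_radius R0 RT T) t (c / (2 * opt_radius R0 RT T t)).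
Proof.
  unfold opt_radius. fold c. generalize (R0 ^ 2) c. intros b c' Hq. assert (Hs := sqrt_lt_R0 _ Hq).
  auto_derive; [lra|]. field. lra.
Qed.

Lemma opt_radius_trajectory : spherical_trajectory R0 RT T (opt_radius R0 RT T).
Proof.
  assert (Hl := opt_low_pos). assert (Hac := Rabs_pos c).
  split; [|split; [|split]].
  (* Over a time [d] the affine function changes by at most half of its lower bound, so it stays
     positive on the enlarged interval. *)
  - set (d := opt_low / (2 * (Rabs c + 1))).
    assert (Hd : 0 < d) by (apply Rdiv_lt_0_compat; lra).
    assert (Hcd : Rabs c * d <= opt_low / 2).
    { replace (opt_low / 2) with ((Rabs c + 1) * d) by (unfold d; field; lra). nra. }
    exists d, (opt_radius R0 RT T). split; [exact Hd | split; [|reflexivity]].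
    intros n t Ht. unfold opt_radius. fold c.
    apply (sqrt_affine_smooth _ _ (fun t => - d < t < T + d)); trivial.
    + intros s Hs. assert (H1 := opt_square_low (clamp T s) (clamp_in T s (Rlt_le _ _ HT))).
      assert (Hc1 := Rle_abs c). assert (Hc2 := Rle_abs (- c)). rewrite Rabs_Ropp in Hc2.
      destruct (Rlt_dec s 0) as [Hs0|Hs0].
      { assert (E := opt_square_low 0 ltac:(lra)). nra. }
      destruct (Rlt_dec T s) as [HsT|HsT].
      { assert (E := opt_square_low T ltac:(lra)). nra. }
      assert (E := opt_square_low s ltac:(lra)). lra.
    + intros s Hs. apply (locally_open_interval (- d) (T + d)); trivial.
  - intros t Ht. apply sqrt_lt_R0. assert (H := opt_square_low t Ht). fold c. lra.
  - unfold opt_radius. rewrite Rmult_0_r, Rplus_0_r, <- Rsqr_pow2. apply sqrt_Rsqr; lra.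
  - unfold opt_radius. fold c. rewrite opt_slope_T.
    replace (R0 ^ 2 + (RT ^ 2 - R0 ^ 2)) with (Rsqr RT) by (unfold Rsqr; ring). apply sqrt_Rsqr; lra.
Qed.

Lemma opt_radius_action r : (forall t, 0 <= t <= T -> r t = opt_radius R0 RT T t) ->
  action (spherical r) T = 4 * PI * (c ^ 2 / 4 + 4) * T.
Proof.
  intros Hr. assert (Hl := opt_low_pos).
  rewrite (action_spherical T _ (opt_radius R0 RT T)); trivial.
  - rewrite (RInt_ext (V := R_CompleteNormedModule) _ (fun _ => 4 * PI * (c ^ 2 / 4 + 4))).
    + rewrite (RInt_const (V := R_CompleteNormedModule)).
      change ((T - 0) * (4 * PI * (c ^ 2 / 4 + 4)) = 4 * PI * (c ^ 2 / 4 + 4) * T). ring.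
    + intros t Ht. rewrite Rmin_left, Rmax_right in Ht by lra.
      assert (Hq := opt_square_low t ltac:(lra)).
      rewrite (is_derive_unique _ _ _ (opt_radius_derive t ltac:(lra))).
      assert (Hp : 0 < opt_radius R0 RT T t) by (apply sqrt_lt_R0; fold c; lra).
      eqR. field. lra.
  - intros t Ht. assert (Hq := opt_square_low t ltac:(lra)).
    eexists. apply opt_radius_derive. lra.
  - intros t Ht. assert (Hq := opt_square_low t Ht). apply sqrt_lt_R0; fold c; lra.
Qed.

(* Cauchy-Schwarz for [(r^2)' / 2 = r r'], whose integral is prescribed, in its equality case. *)
Lemma optimal_trajectory_eq r0 : optimal_spherical_trajectory R0 RT T r0 ->
  forall t, 0 <= t <= T -> r0 t = opt_radius R0 RT T t.
Proof.
  intros [[[d [g [Hd [Hg Hrg]]]] [Hpos [H0 H1]]] Hopt].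
  assert (Hle := Hopt _ opt_radius_trajectory).
  rewrite (opt_radius_action (opt_radius R0 RT T)) in Hle by reflexivity.
  assert (Hder : forall t, 0 <= t <= T -> is_derive g t (Derive g t)).
  { intros t Ht. apply Derive_correct. apply (Hg 1%nat). lra. }
  assert (Hcont : forall t, 0 <= t <= T -> continuous (fun t => g t * Derive g t) t).
  { intros t Ht. apply cont_mult; apply (ex_derive_continuous (V := R_NormedModule)).
    - apply (Hg 1%nat). lra.
    - apply (Hg 2%nat). lra. }
  rewrite (action_spherical T r0 g) in Hle; trivial.
  2: { intros t Ht. eexists; apply Hder; lra. }
  2: { intros t Ht. rewrite <- Hrg by trivial. apply Hpos, Ht. }
  (* [Derive g] is controlled only near [[0, T]]; freezing the argument gives a function continuous
     everywhere. *)
  set (h := fun t => g (clamp T t) * Derive g (clamp T t)).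
  assert (Hh : forall t, continuous h t).
  { intros t. apply (cont_comp (fun t => g t * Derive g t) (clamp T)).
    - apply Hcont, clamp_in. lra.
    - apply continuous_clamp. }
  assert (Hhe : forall t, 0 < t < T -> h t = g t * Derive g t).
  { intros t Ht. unfold h. rewrite clamp_id by lra. reflexivity. }
  assert (HPI := PI_RGT_0).
  assert (Hex : forall f : R -> R, (forall t, continuous f t) -> ex_RInt f 0 T).
  { intros f Hf. apply ex_RInt_cont, Hf. }
  assert (Hch2 : forall t, continuous (fun t => h t ^ 2) t).
  { intros t. apply cont_pow, Hh. }
  assert (I2 : RInt (fun t => h t ^ 2) 0 T <= c ^ 2 / 4 * T).
  { rewrite (RInt_ext (V := R_CompleteNormedModule) _ (fun t => 4 * PI * h t ^ 2 + 16 * PI)) in Hle.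
    - rewrite (RInt_plus_cont (fun t => 4 * PI * h t ^ 2)), RInt_scal_cont, RInt_const_R in Hle; trivial.
      + nra.
      + intros t. apply cont_mult; [apply cont_const | apply Hch2].
      + intros t. apply cont_const.
    - intros t Ht. rewrite Rmin_left, Rmax_right in Ht by lra. rewrite Hhe by trivial. eqR. ring. }
  assert (I1 : RInt h 0 T = c * T / 2).
  { rewrite (RInt_ext (V := R_CompleteNormedModule) _ (fun t => g t * Derive g t)).
    - apply (is_RInt_unique (V := R_CompleteNormedModule)).
      replace (c * T / 2) with (minus (/ 2 * (g T * g T)) (/ 2 * (g 0 * g 0))).
      + apply (is_RInt_derive (V := R_CompleteNormedModule) (fun t => / 2 * (g t * g t))).
        * intros t Ht. rewrite Rmin_left, Rmax_right in Ht by lra.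
          apply der_eq with (/ 2 * (Derive g t * g t + g t * Derive g t)); [|field].
          apply is_derive_scal, der_mult; apply Hder, Ht.
        * intros t Ht. rewrite Rmin_left, Rmax_right in Ht by lra. apply Hcont, Ht.
      + rewrite opt_slope_T, <- !Hrg, H0, H1 by lra. unfold minus, plus, opp; simpl. field.
    - intros t Ht. rewrite Rmin_left, Rmax_right in Ht by lra. apply Hhe, Ht. }
  assert (Hsq : RInt (fun t => (h t - c / 2) ^ 2) 0 T <= 0).
  { rewrite (RInt_ext (V := R_CompleteNormedModule) _
      (fun t => h t ^ 2 + - c * h t + c ^ 2 / 4)) by (intros t _; eqR; field).
    rewrite (RInt_plus_cont (fun t => h t ^ 2 + - c * h t)), RInt_plus_cont, RInt_scal_cont,
      RInt_const_R, I1; trivial.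
    - nra.
    - intros t. apply cont_mult; [apply cont_const | apply Hh].
    - intros t. apply cont_plus; [apply Hch2|]. apply cont_mult; [apply cont_const | apply Hh].
    - intros t. apply cont_const. }
  assert (Hhc : forall t, 0 < t < T -> g t * Derive g t = c / 2).
  { intros t Ht.
    assert (E : (h t - c / 2) ^ 2 = 0).
    { apply (RInt_zero_nonneg (fun t => (h t - c / 2) ^ 2) 0 T); trivial.
      - intros s. apply (cont_pow (fun t => h t - c / 2)), cont_minus; [apply Hh | apply cont_const].
      - intros; apply pow2_ge_0. }
    rewrite Hhe in E by trivial. simpl in E. rewrite Rmult_1_r in E.
    apply Rmult_integral in E. lra. }
  intros t Ht. rewrite Hrg by trivial.
  assert (Hgt : 0 < g t) by (rewrite <- Hrg by trivial; apply Hpos, Ht).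
  (* Equality in Cauchy-Schwarz fixes [g g' = c / 2], so [g^2 - c t] keeps its initial value. *)
  assert (Hg2 : g t ^ 2 = R0 ^ 2 + c * t).
  { destruct (MVT_gen (fun s => g s * g s - c * s) 0 t (fun _ => 0)) as [s [Hs E]].
    - intros s Hs. rewrite Rmin_left, Rmax_right in Hs by lra.
      apply der_eq with (Derive g s * g s + g s * Derive g s - c * 1); [|assert (E := Hhc s ltac:(lra)); lra].
      apply der_minus; [apply der_mult; apply Hder; lra | apply is_derive_scal, (is_derive_id (K := R_AbsRing) s)].
    - intros s Hs. rewrite Rmin_left, Rmax_right in Hs by lra.
      apply continuity_pt_filterlim.
      apply (cont_minus (fun s => g s * g s) (fun s => c * s)).
      + apply cont_mult; apply (ex_derive_continuous (V := R_NormedModule)); eexists; apply Hder; lra.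
      + apply cont_mult; [apply cont_const | apply continuous_id].
    - rewrite <- (Hrg 0), H0 in E by lra. lra. }
  unfold opt_radius. fold c. rewrite <- Hg2, <- Rsqr_pow2. symmetry. apply sqrt_Rsqr. lra.
Qed.
End OptimalTrajectory.

(** * Stability *)

Definition opt_clamped (R0 RT T t : R) : R := opt_radius R0 RT T (clamp T t).

Lemma opt_clamped_square R0 RT T t : 0 < R0 -> 0 < RT -> 0 < T ->
  opt_low R0 RT <= opt_clamped R0 RT T t ^ 2 <= Rmax (R0 ^ 2) (RT ^ 2).
Proof.
  intros HR0 HRT HT. assert (Hc := clamp_in T t (Rlt_le _ _ HT)).
  assert (H1 := opt_square_low R0 RT T HT _ Hc). assert (H2 := opt_square_up R0 RT T HT _ Hc).
  assert (H0 := opt_low_pos R0 RT HR0 HRT).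
  unfold opt_clamped, opt_radius. rewrite pow2_sqrt; lra.
Qed.

Lemma opt_radius_data R0 RT T : 0 < R0 -> 0 < RT -> 0 < T ->
  radius_data T (opt_slope R0 RT T) (sqrt (opt_low R0 RT)) (opt_clamped R0 RT T).
Proof.
  intros HR0 HRT HT. assert (H0 := opt_low_pos R0 RT HR0 HRT).
  split.
  - apply sqrt_lt_R0, H0.
  - intros t. apply sqrt_le_1_alt. apply opt_square_low; trivial. apply clamp_in. lra.
  - exists (sqrt (Rmax (R0 ^ 2) (RT ^ 2))). intros t. apply sqrt_le_1_alt.
    apply opt_square_up; trivial. apply clamp_in. lra.
  - intros t. unfold opt_clamped, opt_radius.
    apply cont_sqrt, cont_plus; [apply cont_const|].
    apply cont_mult; [apply cont_const | apply continuous_clamp].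
  - intros t Ht. unfold opt_clamped. rewrite (clamp_id T t) by lra.
    apply is_derive_ext_loc with (f := opt_radius R0 RT T).
    + apply (locally_open_interval 0 T); trivial. intros s Hs. rewrite clamp_id by lra. reflexivity.
    + apply opt_radius_derive. assert (H := opt_square_low R0 RT T HT t ltac:(lra)). lra.
Qed.

Lemma on_S2_sph th ps : on_S2 (sph th ps).
Proof. exact (x_unit th ps). Qed.

Lemma expansion_of_optimal R0 RT T r0 rho F Ft p k A B D : 0 < R0 -> 0 < RT -> 0 < T ->
  optimal_spherical_trajectory R0 RT T r0 -> variation_data T F Ft p k A B D ->
  (forall th ps t, 0 <= t <= T -> rho (sph th ps) t = F th ps t) ->
  exists K d, 0 < d /\ 0 <= K /\ forall e, Rabs e <= d ->
    action (radial_graph (fun x t => r0 t + e * rho x t)) T = tint T (fun th ps t =>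
      radial_density (opt_clamped R0 RT T t + e * F th ps t)
        (opt_slope R0 RT T / (2 * opt_clamped R0 RT T t) + e * Ft th ps t) (e * p th ps t)
        (e * k th ps t) (e * A th ps t) (e * B th ps t) (e * D th ps t)) /\
    Rabs (action (radial_graph (fun x t => r0 t + e * rho x t)) T
      - (action (spherical r0) T + e ^ 2 *
         second_variation T (opt_slope R0 RT T) (opt_clamped R0 RT T) F Ft p k A D)) <= K * Rabs e ^ 3.
Proof.
  intros HR0 HRT HT Hopt HV Hrho.
  assert (Heq := optimal_trajectory_eq R0 RT T HR0 HRT HT r0 Hopt).
  rewrite (opt_radius_action R0 RT T HR0 HRT HT r0 Heq).
  apply (action_expansion T _ _ _ _ _ _ _ _ _ _ (fun e x t => r0 t + e * rho x t) HT
    (opt_radius_data R0 RT T HR0 HRT HT) HV).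
  intros e th ps t Ht. rewrite Heq, Hrho by trivial.
  unfold opt_clamped. rewrite clamp_id by trivial. reflexivity.
Qed.

Lemma cont3_weighted_quadratic T c m a (u v : R -> R -> R -> R) : radius_data T c m a ->
  cont3 u -> cont3 v -> cont3 (fun th ps t => a t ^ 2 * u th ps t + v th ps t / a t ^ 2).
Proof.
  intros Ha Hu Hv.
  assert (Hane : forall t, a t <> 0) by (intros t; apply Rgt_not_eq, (radius_pos T c m), Ha).
  intros q. cont_rad a Ha. apply pow_nonzero, Hane.
Qed.

(** At each time the bracket divided by [a^2] is the form of [sphere_inequality] for
    [tau = c^2 / 48]: then [2 + 6 tau = 2 + c^2 / 8] and [12 tau = c^2 / 4]. The hypothesis on [c]
    is [tau <= 1]. *)
Lemma second_variation_lower T c m a F Ft p k A B D : 0 < T -> radius_data T c m a ->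
  variation_data T F Ft p k A B D -> (forall t, sph_modulus (fun th ps => F th ps t)) ->
  c ^ 2 <= 48 ->
  tint T (fun th ps t => a t ^ 2 * Ft th ps t ^ 2) <= second_variation T c a F Ft p k A D.
Proof.
  intros HT Ha HV HM Hc.
  assert (Hpos := fun t => radius_pos T c m a t Ha).
  destruct HV as [rd cF cFt cp ck cA cB cD _ _ _ _ _ _ _ _ _].
  assert (c1 : cont3 (fun th ps t => Ft th ps t ^ 2)) by (intros q; cont).
  assert (c2 : cont3 (fun th ps t => c ^ 2 / 4 * F th ps t ^ 2 + (A th ps t + D th ps t) ^ 2
     - (2 + c ^ 2 / 8) * (p th ps t ^ 2 + k th ps t ^ 2))) by (intros q; cont).
  assert (c0 : cont3 (fun _ _ _ => 0)) by (intros q; apply cont_const).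
  assert (cz := cont3_weighted_quadratic T c m a _ _ Ha c1 c0).
  assert (cs := cont3_weighted_quadratic T c m a _ _ Ha c1 c2). cbv beta in cs, cz.
  unfold second_variation.
  (* The zero term gives both integrands the shape whose continuity is known. *)
  rewrite (tint_ext T (fun th ps t => a t ^ 2 * Ft th ps t ^ 2)
    (fun th ps t => a t ^ 2 * Ft th ps t ^ 2 + 0 / a t ^ 2)) by (trivial; intros; unfold Rdiv; ring).
  apply tint_le; trivial. intros t Ht.
  assert (Hs := rd_sph _ _ _ _ _ _ _ _ rd t ltac:(lra)).
  assert (Htau : 0 <= c ^ 2 / 48 <= 1).
  { assert (H := pow2_ge_0 c). lra. }
  assert (Hin := sphere_inequality _ _ _ _ _ _ Hs (HM t) Htau). cbv beta in Hin.
  rewrite (sint_ext (fun th ps => _ + 0 / _) (fun th ps => a t ^ 2 * Ft th ps t ^ 2))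
    by (intros; unfold Rdiv; ring).
  rewrite (sint_ext (fun th ps => _ + _ / _) (fun th ps => a t ^ 2 * Ft th ps t ^ 2
     + / a t ^ 2 * ((A th ps t + D th ps t) ^ 2 - (2 + 6 * (c ^ 2 / 48)) * (p th ps t ^ 2 + k th ps t ^ 2)
         + 12 * (c ^ 2 / 48) * F th ps t ^ 2))).
  2: { intros. specialize (Hpos t). field. lra. }
  rewrite sint_plus, (sint_scal (/ a t ^ 2)) by (intros q; cont).
  assert (0 <= / a t ^ 2).
  { left. apply Rinv_0_lt_compat, pow_lt, Hpos. }
  nra.
Qed.

(** A nonnegative continuous integrand with no integral vanishes, so [Ft] is zero, and [F] keeps its
    initial value 0. The conclusion is confined to the open rectangle, where the weight [sin th] is
    positive. *)
Lemma variation_zero T c m a F Ft p k A B D : 0 < T -> radius_data T c m a ->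
  variation_data T F Ft p k A B D ->
  tint T (fun th ps t => a t ^ 2 * Ft th ps t ^ 2) <= 0 ->
  forall th ps t, 0 < t < T -> 0 < th < PI -> 0 < ps < 2 * PI ->
    F th ps t = 0 /\ Ft th ps t = 0.
Proof.
  intros HT Ha HV Hle.
  assert (Hpos := fun t => radius_pos T c m a t Ha).
  destruct HV as [rd cF cFt cp ck cA cB cD _ _ _ _ _ _ _ F0 _].
  assert (c1 : cont3 (fun th ps t => a t ^ 2 * Ft th ps t ^ 2)).
  { intros q. cont_rad a Ha. }
  assert (Hnn : forall th ps t, 0 <= a t ^ 2 * Ft th ps t ^ 2).
  { intros. apply Rmult_le_pos; apply pow2_ge_0. }
  assert (HFt : forall th ps t, 0 < t < T -> 0 < th < PI -> 0 < ps < 2 * PI -> Ft th ps t = 0).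
  { intros th ps t Ht Hth Hps.
    assert (Hz : a t ^ 2 * Ft th ps t ^ 2 = 0).
    { apply (sint_zero_nonneg (fun th ps => a t ^ 2 * Ft th ps t ^ 2)); [apply (cont3_slice _ t c1) | intros; apply Hnn | | exact Hth | exact Hps].
      right. apply (RInt_zero_nonneg (fun t => sint (fun th ps => a t ^ 2 * Ft th ps t ^ 2)) 0 T); [exact HT | | | exact Hle | exact Ht].
        + intros s. apply continuous_sint_t, c1.
        + intros s _. rewrite <- (Rmult_0_r (4 * PI)), <- sint_const. apply sint_le.
          * intros q; cont.
          * apply (cont3_slice _ s c1).
          * intros; apply Hnn. }
    assert (Hat : 0 < a t ^ 2) by apply pow_lt, Hpos.
    apply Rmult_integral in Hz. destruct Hz as [Hz|Hz]; [lra|].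
    simpl in Hz. rewrite Rmult_1_r in Hz. apply Rmult_integral in Hz. tauto. }
  intros th ps t Ht Hth Hps. split; [|apply HFt; trivial].
  assert (HI : RInt (fun s => Ft th ps s) 0 t = F th ps t - F th ps 0).
  { apply (RInt_derive_open (fun s => F th ps s)); [lra | | intros s; cont ..].
    intros s Hs. apply (rd_t _ _ _ _ _ _ _ _ rd). lra. }
  rewrite (RInt_ext (V := R_CompleteNormedModule) _ (fun _ => 0)) in HI.
  - rewrite RInt_const_R, F0 in HI. lra.
  - intros s Hs. rewrite Rmin_left, Rmax_right in Hs by lra. apply HFt; trivial; lra.
Qed.

Lemma is_derive_locally_zero (f : R -> R) a b x l : a < x < b -> (forall y, a < y < b -> f y = 0) ->
  is_derive f x l -> l = 0.
Proof.
  intros Hx Hf Hd. rewrite <- (is_derive_unique _ _ _ Hd).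
  rewrite (Derive_ext_loc _ (fun _ => 0)); [apply Derive_const|].
  apply (locally_open_interval a b); trivial.
Qed.

(** A function vanishing on an open rectangle has vanishing derivatives there; the frame components
    follow on dividing by [sin th]. *)
Lemma radial_data_zero T F Ft p k A B D t : radial_data T F Ft p k A B D -> 0 <= t <= T ->
  (forall th ps, 0 < th < PI -> 0 < ps < 2 * PI -> F th ps t = 0) ->
  forall th ps, 0 < th < PI -> 0 < ps < 2 * PI ->
    p th ps t = 0 /\ k th ps t = 0 /\ A th ps t = 0 /\ B th ps t = 0 /\ D th ps t = 0.
Proof.
  intros rd Ht HF.
  destruct (rd_sph _ _ _ _ _ _ _ _ rd t Ht) as [_ _ _ _ _ Fth Fps pth kps _ _].
  assert (Hs : forall th, 0 < th < PI -> 0 < sin th) by (intros th H; apply sin_gt_0; apply H).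
  assert (Hp : forall th ps, 0 < th < PI -> 0 < ps < 2 * PI -> p th ps t = 0).
  { intros th ps Hth Hps. apply (is_derive_locally_zero (fun a => F a ps t) 0 PI th); auto. }
  assert (Hk : forall th ps, 0 < th < PI -> 0 < ps < 2 * PI -> k th ps t = 0).
  { intros th ps Hth Hps.
    assert (E : sin th * k th ps t = 0).
    { apply (is_derive_locally_zero (fun a => F th a t) 0 (2 * PI) ps); auto. }
    specialize (Hs th Hth). apply Rmult_integral in E. destruct E; lra. }
  intros th ps Hth Hps. specialize (Hs th Hth).
  assert (E1 : A th ps t = 0).
  { apply (is_derive_locally_zero (fun a => p a ps t) 0 PI th); auto. }
  assert (E2 : sin th * B th ps t + cos th * k th ps t = 0).
  { apply (is_derive_locally_zero (fun a => p th a t) 0 (2 * PI) ps); auto.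
    apply (rd_pps _ _ _ _ _ _ _ _ rd), Ht. }
  assert (E3 : sin th * D th ps t - cos th * p th ps t = 0).
  { apply (is_derive_locally_zero (fun a => k th a t) 0 (2 * PI) ps); auto. }
  rewrite Hk in E2 by trivial. rewrite Hp in E3 by trivial.
  repeat split; auto.
  - apply Rmult_eq_reg_l with (sin th); lra.
  - apply Rmult_eq_reg_l with (sin th); lra.
Qed.

(** If the kinetic term is positive, so is the second variation, and it beats the cubic remainder
    for small [e]. Otherwise the variation vanishes inside the rectangle, where the expansion would
    be inconclusive but the action does not change at all. *)
Lemma local_minimizer_of_slope R0 RT T r0 : 0 < R0 -> 0 < RT -> 0 < T ->
  optimal_spherical_trajectory R0 RT T r0 -> opt_slope R0 RT T ^ 2 <= 48 -> local_minimizer T r0.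
Proof.
  intros HR0 HRT HT Hopt Hc rho [[g [Hg Hrg]] Hrho0].
  change (smooth4 g) in Hg.
  assert (HT' : 0 <= T) by lra.
  assert (Hsph : forall th ps t, 0 <= t <= T -> rho (sph th ps) t = g (x1 th ps) (x2 th ps) (x3 th ps) t).
  { intros th ps t Ht. apply Hrg; [apply on_S2_sph | exact Ht]. }
  assert (HV := ambient_variation_data T g HT' Hg).
  specialize (HV (fun th ps => eq_trans (eq_sym (Hsph th ps 0 (conj (Rle_refl _) HT'))) (proj1 (Hrho0 _ (on_S2_sph th ps))))).
  specialize (HV (fun th ps => eq_trans (eq_sym (Hsph th ps T (conj HT' (Rle_refl _)))) (proj2 (Hrho0 _ (on_S2_sph th ps))))).
  assert (Hrd := opt_radius_data R0 RT T HR0 HRT HT).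
  destruct (expansion_of_optimal R0 RT T r0 rho _ _ _ _ _ _ _ HR0 HRT HT Hopt HV) as [K [d [Hd [HK HE]]]].
  { intros th ps t Ht. rewrite Hsph by trivial. unfold am_F, on_sphere. rewrite clamp_id by trivial. reflexivity. }
  assert (Hlow := second_variation_lower T _ _ _ _ _ _ _ _ _ _ HT Hrd HV (ambient_modulus T g HT' Hg) Hc).
  set (Q := second_variation _ _ _ _ _ _ _ _ _) in *.
  destruct (Rle_lt_dec (tint T (fun th ps t => opt_clamped R0 RT T t ^ 2 * am_Ft T g th ps t ^ 2)) 0) as [Hz|Hz].
  - assert (HZ := variation_zero T _ _ _ _ _ _ _ _ _ _ HT Hrd HV Hz).
    exists d. split; [exact Hd|]. intros e He.
    destruct (HE e ltac:(lra)) as [E1 _]. destruct (HE 0 ltac:(rewrite Rabs_R0; lra)) as [E2 E3].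
    (* The integral formula for the action is compared at [e] and at 0: all data of the variation
       vanish inside the rectangle, so the integrands agree. *)
    assert (E4 : tint T (fun th ps t =>
      radial_density (opt_clamped R0 RT T t + e * am_F T g th ps t)
        (opt_slope R0 RT T / (2 * opt_clamped R0 RT T t) + e * am_Ft T g th ps t) (e * am_p T g th ps t)
        (e * am_k T g th ps t) (e * am_A T g th ps t) (e * am_B T g th ps t) (e * am_D T g th ps t)) =
      action (radial_graph (fun x t => r0 t + 0 * rho x t)) T).
    { rewrite E2. apply RInt_ext. intros t Ht. rewrite Rmin_left, Rmax_right in Ht by lra.
      apply sint_ext_open. intros th ps Hth Hps.
      destruct (HZ th ps t Ht Hth Hps) as [-> ->].
      destruct (radial_data_zero T _ _ _ _ _ _ _ t (vd_rd _ _ _ _ _ _ _ _ HV) ltac:(lra)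
        (fun th ps Hth Hps => proj1 (HZ th ps t Ht Hth Hps)) th ps Hth Hps) as (-> & -> & -> & -> & ->).
      rewrite !Rmult_0_r. reflexivity. }
    rewrite E1, E4. right.
    rewrite Rabs_R0 in E3. simpl in E3. rewrite !Rmult_0_l, Rmult_0_r, Rplus_0_r in E3.
    apply Rabs_le_between in E3. lra.
  - assert (HQ : 0 < Q) by lra.
    (* This makes [K * |e| <= Q]; the summand 1 covers [K = 0]. *)
    exists (Rmin d (Q / (K + 1))).
    assert (Hm1 := Rmin_l d (Q / (K + 1))). assert (Hm2 := Rmin_r d (Q / (K + 1))).
    split; [apply Rmin_pos; [exact Hd | apply Rdiv_lt_0_compat; lra]|].
    intros e He. destruct (HE e ltac:(lra)) as [_ E]. apply Rabs_le_between in E.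
    assert (Ha := Rabs_pos e).
    assert (HeK : Rabs e * (K + 1) <= Q).
    { apply Rle_trans with (Q / (K + 1) * (K + 1)); [apply Rmult_le_compat_r; lra | right; field; lra]. }
    rewrite <- pow2_abs in E.
    assert (K * Rabs e ^ 3 <= Rabs e ^ 2 * Q); [|lra].
    replace (K * Rabs e ^ 3) with (Rabs e ^ 2 * (K * Rabs e)) by ring.
    apply Rmult_le_compat_l; [apply pow2_ge_0 | lra].
Qed.

(** * Instability *)

(** A class containing the test variation and stable under partial derivatives, so that smoothness
    of every order follows by induction. *)
Inductive polynomial4 : (R -> R -> R -> R -> R) -> Prop :=
| p4_const c : polynomial4 (fun _ _ _ _ => c)
| p4_z : polynomial4 (fun _ _ z _ => z)
| p4_t : polynomial4 (fun _ _ _ t => t)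
| p4_plus f g : polynomial4 f -> polynomial4 g -> polynomial4 (fun x y z t => f x y z t + g x y z t)
| p4_mult f g : polynomial4 f -> polynomial4 g -> polynomial4 (fun x y z t => f x y z t * g x y z t).

Lemma polynomial4_continuous f : polynomial4 f -> forall p : R * R * R * R,
  continuous (fun q : R * R * R * R => let '(x, y, z, t) := q in f x y z t) p.
Proof.
  intros Hf p.
  apply continuous_ext with (f := fun q : R * R * R * R => f (fst (fst (fst q))) (snd (fst (fst q))) (snd (fst q)) (snd q)).
  { intros [[[x y] z] t]. reflexivity. }
  induction Hf; cont.
Qed.

Lemma polynomial4_derivable f : polynomial4 f -> exists f1 f2 f3 f4,
  polynomial4 f1 /\ polynomial4 f2 /\ polynomial4 f3 /\ polynomial4 f4 /\
  forall x y z t, is_derive (fun s => f s y z t) x (f1 x y z t) /\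
    is_derive (fun s => f x s z t) y (f2 x y z t) /\
    is_derive (fun s => f x y s t) z (f3 x y z t) /\ is_derive (fun s => f x y z s) t (f4 x y z t).
Proof.
  assert (Hc : forall b x : R, is_derive (fun _ : R => b) x 0).
  { intros. apply (is_derive_const (V := R_NormedModule)). }
  assert (Hi : forall x : R, is_derive (fun s : R => s) x 1).
  { intros. apply (is_derive_id (K := R_AbsRing)). }
  assert (H0 := p4_const 0). assert (H1 := p4_const 1).
  induction 1 as [c | | | f g Hf (f1 & f2 & f3 & f4 & ? & ? & ? & ? & IHf) Hg (g1 & g2 & g3 & g4 & ? & ? & ? & ? & IHg)
     | f g Hf (f1 & f2 & f3 & f4 & ? & ? & ? & ? & IHf) Hg (g1 & g2 & g3 & g4 & ? & ? & ? & ? & IHg)].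
  - exists (fun _ _ _ _ => 0), (fun _ _ _ _ => 0), (fun _ _ _ _ => 0), (fun _ _ _ _ => 0).
    do 4 (split; [assumption|]). intros x y z t.
    split; [|split; [|split]]; auto.
  - exists (fun _ _ _ _ => 0), (fun _ _ _ _ => 0), (fun _ _ _ _ => 1), (fun _ _ _ _ => 0).
    do 4 (split; [assumption|]). intros x y z t.
    split; [|split; [|split]]; auto.
  - exists (fun _ _ _ _ => 0), (fun _ _ _ _ => 0), (fun _ _ _ _ => 0), (fun _ _ _ _ => 1).
    do 4 (split; [assumption|]). intros x y z t.
    split; [|split; [|split]]; auto.
  - exists (fun x y z t => f1 x y z t + g1 x y z t), (fun x y z t => f2 x y z t + g2 x y z t),
      (fun x y z t => f3 x y z t + g3 x y z t), (fun x y z t => f4 x y z t + g4 x y z t).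
    do 4 (split; [apply p4_plus; assumption|]).
    intros x y z t. destruct (IHf x y z t) as (F1 & F2 & F3 & F4). destruct (IHg x y z t) as (G1 & G2 & G3 & G4).
    split; [|split; [|split]].
    + apply (der_plus (fun s => f s y z t) (fun s => g s y z t)); assumption.
    + apply (der_plus (fun s => f x s z t) (fun s => g x s z t)); assumption.
    + apply (der_plus (fun s => f x y s t) (fun s => g x y s t)); assumption.
    + apply (der_plus (fun s => f x y z s) (fun s => g x y z s)); assumption.
  - exists (fun x y z t => f1 x y z t * g x y z t + f x y z t * g1 x y z t),
      (fun x y z t => f2 x y z t * g x y z t + f x y z t * g2 x y z t),
      (fun x y z t => f3 x y z t * g x y z t + f x y z t * g3 x y z t),
      (fun x y z t => f4 x y z t * g x y z t + f x y z t * g4 x y z t).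
    do 4 (split; [apply p4_plus; apply p4_mult; assumption|]).
    intros x y z t. destruct (IHf x y z t) as (F1 & F2 & F3 & F4). destruct (IHg x y z t) as (G1 & G2 & G3 & G4).
    split; [|split; [|split]].
    + apply (der_mult (fun s => f s y z t) (fun s => g s y z t)); assumption.
    + apply (der_mult (fun s => f x s z t) (fun s => g x s z t)); assumption.
    + apply (der_mult (fun s => f x y s t) (fun s => g x y s t)); assumption.
    + apply (der_mult (fun s => f x y z s) (fun s => g x y z s)); assumption.
Qed.

(** Functional extensionality enters because [Ck4] recurses on the functions [Derive ...]
    themselves, which are only pointwise equal to members of the class. *)
Lemma polynomial4_smooth f : polynomial4 f -> smooth4 f.
Proof.
  intros Hf k. revert f Hf. induction k as [|k IH]; intros f Hf.
  - exact (polynomial4_continuous f Hf).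
  - destruct (polynomial4_derivable f Hf) as (f1 & f2 & f3 & f4 & H1 & H2 & H3 & H4 & HD).
    assert (E : forall h h' : R -> R -> R -> R -> R, (forall x y z t, h x y z t = h' x y z t) -> h = h').
    { intros h h' Hh. do 4 (apply functional_extensionality; intro). apply Hh. }
    split; [|split; [|split; [|split]]].
    + intros x y z t. destruct (HD x y z t) as (E1 & E2 & E3 & E4).
      split; [|split; [|split]]; eexists; eassumption.
    + rewrite (E _ f1); [auto|]. intros; apply is_derive_unique, HD.
    + rewrite (E _ f2); [auto|]. intros; apply is_derive_unique, HD.
    + rewrite (E _ f3); [auto|]. intros; apply is_derive_unique, HD.
    + rewrite (E _ f4); [auto|]. intros; apply is_derive_unique, HD.
Qed.

Lemma polynomial4_pow_z n : polynomial4 (fun _ _ z _ => z ^ n).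
Proof.
  induction n as [|n IH]; simpl; [apply p4_const|].
  apply (p4_mult (fun _ _ z _ => z)); [apply p4_z | exact IH].
Qed.

Definition test_variation (n : nat) (T : R) (x : V3) (t : R) : R := t * (T - t) * snd x ^ n.

Lemma test_variation_admissible n T : admissible_variation T (test_variation n T).
Proof.
  split.
  - exists (fun _ _ z t => t * (T + -1 * t) * z ^ n). split.
    + change (smooth4 (fun _ _ z t => t * (T + -1 * t) * z ^ n)). apply polynomial4_smooth.
      apply (p4_mult (fun _ _ _ t => t * (T + -1 * t)) (fun _ _ z _ => z ^ n)); [|apply polynomial4_pow_z].
      apply (p4_mult (fun _ _ _ t => t) (fun _ _ _ t => T + -1 * t)); [apply p4_t|].
      apply (p4_plus (fun _ _ _ _ => T) (fun _ _ _ t => -1 * t)); [apply p4_const|].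
      apply (p4_mult (fun _ _ _ _ => -1) (fun _ _ _ t => t)); [apply p4_const | apply p4_t].
    + intros. unfold test_variation. simpl. ring.
  - intros x _. unfold test_variation. split; ring.
Qed.

(** The function [x_3^n], with its components written exactly as [sph_fun_pow] produces them. *)
Definition zon (n : nat) (th ps : R) : R := lin 0 0 1 th ps ^ n.
Definition zon_p (n : nat) (th ps : R) : R := INR n * lin 0 0 1 th ps ^ pred n * lin1 0 0 1 th ps.
Definition zon_k (n : nat) (th ps : R) : R := INR n * lin 0 0 1 th ps ^ pred n * lin2 0 0 1 th ps.
Definition zon_A (n : nat) (th ps : R) : R :=
  INR n * (INR (pred n) * lin 0 0 1 th ps ^ pred (pred n) * lin1 0 0 1 th ps * lin1 0 0 1 th ps
    + lin 0 0 1 th ps ^ pred n * - lin 0 0 1 th ps).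
Definition zon_D (n : nat) (th ps : R) : R :=
  INR n * (INR (pred n) * lin 0 0 1 th ps ^ pred (pred n) * lin2 0 0 1 th ps * lin2 0 0 1 th ps
    + lin 0 0 1 th ps ^ pred n * - lin 0 0 1 th ps).

Lemma zon_sph_fun n : sph_fun (zon n) (zon_p n) (zon_k n) (zon_A n) (zon_D n).
Proof. exact (sph_fun_pow _ _ _ _ _ n (sph_fun_lin 0 0 1)). Qed.

Lemma zon_k_zero n th ps : zon_k n th ps = 0.
Proof. unfold zon_k, lin2. ring. Qed.

Lemma sint_even_power n : sint (fun th ps => lin 0 0 1 th ps ^ (2 * n)) = 4 * PI / (2 * INR n + 1).
Proof.
  assert (Hn := pos_INR n).
  rewrite (sint_ext _ (fun th _ => cos th ^ (2 * n))).
  2: { intros. unfold lin. f_equal. ring. }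
  rewrite (sint_theta (fun th => cos th ^ (2 * n))) by (intros; cont).
  rewrite (RInt_derive_eq (fun th => - / (2 * INR n + 1) * cos th ^ S (2 * n))).
  - rewrite cos_PI, cos_0, pow1. rewrite pow_1_odd. eqR. field. lra.
  - intros th. eapply der_eq.
    + apply is_derive_scal, is_derive_pow, is_derive_cos.
    + rewrite S_INR, mult_INR. change (Init.Nat.pred (S (2 * n))) with (2 * n)%nat. change (INR 2) with 2. field. lra.
  - intros th. cont.
Qed.

Lemma zon_mass n : sint (fun th ps => zon n th ps ^ 2) = 4 * PI / (2 * INR n + 1).
Proof.
  rewrite <- sint_even_power. apply sint_ext. intros. unfold zon.
  rewrite <- pow_mult. f_equal. lia.
Qed.

(** The squared gradient of [x_3^n] is [n^2 (x_3^(2n-2) - x_3^(2n))], so the Rayleigh quotient is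
    [2 n^2 / (2 n - 1)]. It grows without bound, as an eigenvalue would, with elementary
    integrals. *)
Lemma zon_gradient n : (1 <= n)%nat ->
  INR n * sint (fun th ps => zon n th ps ^ 2) <=
  sint (fun th ps => zon_p n th ps ^ 2 + zon_k n th ps ^ 2).
Proof.
  intros Hn. destruct n as [|n]; [lia|].
  assert (Hp := pos_INR n).
  rewrite (sint_ext (fun th ps => _ + _) (fun th ps => INR (S n) ^ 2 * lin 0 0 1 th ps ^ (2 * n)
     + - INR (S n) ^ 2 * lin 0 0 1 th ps ^ (2 * S n))).
  - assert (Hc := cont2_lin 0 0 1).
    rewrite sint_plus, !sint_scal, !sint_even_power, zon_mass by (intros q; cont).
    rewrite S_INR. assert (HPI := PI_RGT_0).
    replace ((INR n + 1) ^ 2 * (4 * PI / (2 * INR n + 1)) + - (INR n + 1) ^ 2 * (4 * PI / (2 * (INR n + 1) + 1)))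
      with (4 * PI * ((INR n + 1) * (2 * (INR n + 1)) / (2 * INR n + 1) / (2 * (INR n + 1) + 1))) by (field; lra).
    replace ((INR n + 1) * (4 * PI / (2 * (INR n + 1) + 1)))
      with (4 * PI * ((INR n + 1) * 1 / (2 * (INR n + 1) + 1))) by (field; lra).
    apply Rmult_le_compat_l; [lra|]. apply Rmult_le_compat_r; [left; apply Rinv_0_lt_compat; lra|].
    unfold Rdiv. rewrite Rmult_assoc. apply Rmult_le_compat_l; [lra|].
    apply Rmult_le_reg_r with (2 * INR n + 1); [lra|]. rewrite Rmult_assoc, Rinv_l by lra. lra.
  - intros th ps. rewrite zon_k_zero. unfold zon_p. simpl pred.
    assert (Hu := lin_frame 0 0 1 th ps 0 0 1).
    assert (H2 : lin2 0 0 1 th ps = 0) by (unfold lin2; ring). rewrite H2 in Hu.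
    set (u := lin 0 0 1 th ps) in *. set (u1 := lin1 0 0 1 th ps) in *.
    replace (2 * S n)%nat with (n + n + 2)%nat by lia. replace (2 * n)%nat with (n + n)%nat by lia.
    rewrite !pow_add. replace ((INR (S n) * u ^ n * u1) ^ 2) with (INR (S n) ^ 2 * (u ^ n * u ^ n) * (u1 * u1)) by ring.
    replace (u1 * u1) with (1 - u * u) by lra. ring.
Qed.

(** * Second variation along [t (T - t) x_3^n] *)

Section TestVariation.
Context (n : nat) (T : R) (HT : 0 < T).

Definition bump (t : R) : R := clamp T t * (T - clamp T t).
Definition bump' (t : R) : R := T - 2 * clamp T t.

Lemma cont_bump {U : UniformSpace} (f : U -> R) q : continuous f q -> continuous (fun q => bump (f q)) q.
Proof.
  intros Hf. assert (Hc : continuous (fun q => clamp T (f q)) q).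
  { apply (cont_comp (clamp T)); [apply continuous_clamp | exact Hf]. }
  unfold bump. cont.
Qed.

Lemma cont_bump' {U : UniformSpace} (f : U -> R) q : continuous f q -> continuous (fun q => bump' (f q)) q.
Proof.
  intros Hf. assert (Hc : continuous (fun q => clamp T (f q)) q).
  { apply (cont_comp (clamp T)); [apply continuous_clamp | exact Hf]. }
  unfold bump'. cont.
Qed.

Lemma bounded_bump {P : Type} (f : P -> R) : bounded_fun (fun x => bump (f x)).
Proof.
  exists (T * T). intros x. unfold bump. assert (H := clamp_in T (f x) (Rlt_le _ _ HT)).
  rewrite Rabs_pos_eq; nra.
Qed.

Lemma bounded_bump' {P : Type} (f : P -> R) : bounded_fun (fun x => bump' (f x)).
Proof.
  exists T. intros x. unfold bump'. assert (H := clamp_in T (f x) (Rlt_le _ _ HT)).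
  apply Rabs_le. lra.
Qed.

Lemma cont3_bump u : cont2 u -> cont3 (fun th ps t => bump t * u th ps).
Proof. intros Hu q. apply cont_mult; [apply cont_bump; cont | cont]. Qed.

Lemma bounded3_bump u : bounded_fun (fun x : R * R * R => u (fst (fst x)) (snd (fst x))) ->
  bounded3 (fun th ps t => bump t * u th ps).
Proof. intros Hu. apply (bounded_mult (fun x : R * R * R => bump (snd x))); [apply bounded_bump | exact Hu]. Qed.

Ltac bdd_zon := unfold zon, zon_p, zon_k, zon_A, zon_D, lin, lin1, lin2;
  repeat first [ apply bounded_const | apply bounded_sin_comp | apply bounded_cos_comp
    | apply bounded_plus | apply bounded_minus | apply bounded_opp | apply bounded_mult | apply bounded_pow ].

(** The leading [0 +] is the shape produced by [sph_fun_affine]. The mixed entry is 0 because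
    [x_3^n] does not depend on psi. *)
Lemma test_variation_data : variation_data T
  (fun th ps t => 0 + bump t * zon n th ps) (fun th ps t => bump' t * zon n th ps)
  (fun th ps t => bump t * zon_p n th ps) (fun th ps t => bump t * zon_k n th ps)
  (fun th ps t => bump t * zon_A n th ps) (fun _ _ _ => 0) (fun th ps t => bump t * zon_D n th ps).
Proof.
  destruct (zon_sph_fun n) as [cF cp ck cA cD _ _ _ _ _ _].
  split.
  - split.
    + intros t _. apply sph_fun_affine, zon_sph_fun.
    + intros th ps t _. apply der_eq with 0.
      * apply is_derive_ext with (f := fun _ => bump t * zon_p n th ps).
        -- intros s. f_equal. unfold zon_p, lin, lin1. rewrite !Rmult_0_r. reflexivity.
        -- apply (is_derive_const (V := R_NormedModule)).
      * rewrite zon_k_zero. ring.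
    + intros th ps t Ht.
      apply is_derive_ext_loc with (f := fun s => 0 + s * (T - s) * zon n th ps).
      * apply (locally_open_interval 0 T); trivial. intros s Hs. unfold bump. rewrite clamp_id by lra. reflexivity.
      * unfold bump'. rewrite clamp_id by lra. auto_derive; trivial. ring.
  - intros q. apply cont_plus; [apply cont_const | apply cont3_bump, cF].
  - intros q. apply cont_mult; [apply cont_bump'; cont | cont].
  - apply cont3_bump, cp.
  - apply cont3_bump, ck.
  - apply cont3_bump, cA.
  - intros q; apply cont_const.
  - apply cont3_bump, cD.
  - apply bounded_plus; [apply bounded_const | apply bounded3_bump; bdd_zon].
  - apply (bounded_mult (fun x : R * R * R => bump' (snd x))); [apply bounded_bump' | bdd_zon].
  - apply bounded3_bump; bdd_zon.
  - apply bounded3_bump; bdd_zon.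
  - apply bounded3_bump; bdd_zon.
  - exact (bounded_const 0).
  - apply bounded3_bump; bdd_zon.
  - intros. unfold bump. rewrite clamp_id by lra. ring.
  - intros. unfold bump. rewrite clamp_id by lra. ring.
Qed.

Lemma RInt_bump'_square : RInt (fun t => (T - 2 * t) ^ 2) 0 T = T ^ 3 / 3.
Proof.
  rewrite (RInt_derive_eq (fun t => - (T - 2 * t) ^ 3 / 6)).
  - eqR. field.
  - intros t. auto_derive; trivial. field.
  - intros t. cont.
Qed.

Lemma RInt_bump_square : RInt (fun t => (t * (T - t)) ^ 2) 0 T = T ^ 5 / 30.
Proof.
  rewrite (RInt_derive_eq (fun t => T ^ 2 * t ^ 3 / 3 - T * t ^ 4 / 2 + t ^ 5 / 5)).
  - eqR. field.
  - intros t. auto_derive; trivial. field.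
  - intros t. cont.
Qed.

(** The spatial part of the second variation at [x_3^n], before division by the squared radius and
    without the factor in time. *)
Definition zon_energy (c : R) : R :=
  c ^ 2 / 4 * sint (fun th ps => zon n th ps ^ 2) + sint (fun th ps => (zon_A n th ps + zon_D n th ps) ^ 2)
  - (2 + c ^ 2 / 8) * sint (fun th ps => zon_p n th ps ^ 2 + zon_k n th ps ^ 2).

(** The squared radius is replaced by its bound [M] in both terms: directly in the kinetic one, and
    in the other through [1 / a^2 >= 1 / M], which points the right way because the energy is not
    positive. *)
Lemma test_second_variation_upper c m a M : radius_data T c m a -> (forall t, a t ^ 2 <= M) ->
  zon_energy c <= 0 ->
  second_variation T c a (fun th ps t => 0 + bump t * zon n th ps) (fun th ps t => bump' t * zon n th ps)
    (fun th ps t => bump t * zon_p n th ps) (fun th ps t => bump t * zon_k n th ps)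
    (fun th ps t => bump t * zon_A n th ps) (fun th ps t => bump t * zon_D n th ps)
  <= M * sint (fun th ps => zon n th ps ^ 2) * (T ^ 3 / 3) + zon_energy c / M * (T ^ 5 / 30).
Proof.
  intros Ha HM HE.
  assert (Hpos := fun t => radius_pos T c m a t Ha).
  destruct (zon_sph_fun n) as [cF cp ck cA cD _ _ _ _ _ _].
  destruct test_variation_data as [_ c1 c2 c3 c4 c5 _ c6 _ _ _ _ _ _ _ _ _].
  set (F := fun th ps t => 0 + bump t * zon n th ps) in *.
  set (y0 := sint (fun th ps => zon n th ps ^ 2)) in *.
  assert (Hy0 : 0 <= y0).
  { unfold y0. rewrite <- (Rmult_0_r (4 * PI)), <- sint_const. apply sint_le; try (intros q; cont).
    intros; apply pow2_ge_0. }
  rewrite <- RInt_bump'_square, <- RInt_bump_square.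
  rewrite <- !RInt_scal_cont, <- RInt_plus_cont by (intros; cont).
  assert (cs := cont3_weighted_quadratic T c m a
    (fun th ps t => (bump' t * zon n th ps) ^ 2)
    (fun th ps t => c ^ 2 / 4 * F th ps t ^ 2 + (bump t * zon_A n th ps + bump t * zon_D n th ps) ^ 2
     - (2 + c ^ 2 / 8) * ((bump t * zon_p n th ps) ^ 2 + (bump t * zon_k n th ps) ^ 2)) Ha).
  apply RInt_le.
  - lra.
  - apply ex_tint, cs; intros q;
    repeat first [exact (c1 q) | exact (c2 q) | exact (c3 q) | exact (c4 q) | exact (c5 q) | exact (c6 q) | cont_step].
  - apply ex_RInt_cont. intros; cont.
  - intros t Ht.
    rewrite (sint_ext _ (fun th ps => a t ^ 2 * bump' t ^ 2 * zon n th ps ^ 2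
       + bump t ^ 2 / a t ^ 2 * (c ^ 2 / 4 * zon n th ps ^ 2 + (zon_A n th ps + zon_D n th ps) ^ 2
          + - (2 + c ^ 2 / 8) * (zon_p n th ps ^ 2 + zon_k n th ps ^ 2)))).
    2: { intros. specialize (Hpos t). unfold F. field. lra. }
    rewrite sint_plus, !sint_scal, 2!sint_plus, !sint_scal by (intros q; cont).
    fold y0. unfold bump, bump'. rewrite clamp_id by lra.
    assert (E1 : c ^ 2 / 4 * y0 + sint (fun th ps => (zon_A n th ps + zon_D n th ps) ^ 2)
        + - (2 + c ^ 2 / 8) * sint (fun th ps => zon_p n th ps ^ 2 + zon_k n th ps ^ 2) = zon_energy c)
      by (unfold zon_energy; fold y0; ring).
    rewrite E1.
    assert (Hat : 0 < a t ^ 2) by apply pow_lt, Hpos.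
    specialize (HM t).
    assert (Hi : / M <= / a t ^ 2) by (apply Rinv_le_contravar; trivial).
    assert (Hb := pow2_ge_0 (t * (T - t))). assert (Hb' := pow2_ge_0 (T - 2 * t)).
    apply Rplus_le_compat.
    + replace (a t ^ 2 * (T - 2 * t) ^ 2 * y0) with (a t ^ 2 * ((T - 2 * t) ^ 2 * y0)) by ring.
      replace (M * y0 * (T - 2 * t) ^ 2) with (M * ((T - 2 * t) ^ 2 * y0)) by ring.
      apply Rmult_le_compat_r; trivial. apply Rmult_le_pos; trivial.
    + unfold Rdiv.
      replace ((t * (T - t)) ^ 2 * / a t ^ 2 * zon_energy c) with (- (/ a t ^ 2 * ((t * (T - t)) ^ 2 * - zon_energy c))) by ring.
      replace (zon_energy c * / M * (t * (T - t)) ^ 2) with (- (/ M * ((t * (T - t)) ^ 2 * - zon_energy c))) by ring.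
      apply Ropp_le_contravar, Rmult_le_compat_r; trivial.
      apply Rmult_le_pos; trivial. lra.
Qed.
End TestVariation.

Lemma not_local_minimizer R0 RT T r0 n : 0 < R0 -> 0 < RT -> 0 < T ->
  optimal_spherical_trajectory R0 RT T r0 ->
  let M := Rmax (R0 ^ 2) (RT ^ 2) in
  let E := zon_energy n (opt_slope R0 RT T) in
  E <= 0 ->
  M * sint (fun th ps => zon n th ps ^ 2) * (T ^ 3 / 3) + E / M * (T ^ 5 / 30) < 0 ->
  ~ local_minimizer T r0.
Proof.
  intros HR0 HRT HT Hopt M E HE Hneg Hloc.
  destruct (Hloc _ (test_variation_admissible n T)) as [e0 [He0 Hmin]].
  destruct (expansion_of_optimal R0 RT T r0 (test_variation n T) _ _ _ _ _ _ _ HR0 HRT HT Hopt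
    (test_variation_data n T HT)) as [K [d [Hd [HK Hexp]]]].
  { intros th ps t Ht. unfold test_variation, bump, zon, lin, sph. rewrite clamp_id by trivial. simpl snd.
    rewrite !Rmult_0_r, !Rplus_0_l, Rmult_1_r. reflexivity. }
  assert (HQ := test_second_variation_upper n T HT _ _ _ M (opt_radius_data R0 RT T HR0 HRT HT)
    (fun t => proj2 (opt_clamped_square R0 RT T t HR0 HRT HT)) HE).
  fold E in HQ.
  set (Q := second_variation _ _ _ _ _ _ _ _ _) in *.
  assert (HQneg : 0 < - Q) by lra.
  (* The last entry makes [K * e] at most [- Q / 2], strictly below [- Q]. *)
  set (e := Rmin (d / 2) (Rmin (e0 / 2) (- Q / (2 * (K + 1))))).
  assert (Hq : 0 < - Q / (2 * (K + 1))) by (apply Rdiv_lt_0_compat; lra).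
  assert (He : 0 < e) by (unfold e; repeat apply Rmin_pos; lra).
  assert (H1 := Rmin_l (d / 2) (Rmin (e0 / 2) (- Q / (2 * (K + 1))))).
  assert (H2 := Rmin_r (d / 2) (Rmin (e0 / 2) (- Q / (2 * (K + 1))))).
  assert (H3 := Rmin_l (e0 / 2) (- Q / (2 * (K + 1)))). assert (H4 := Rmin_r (e0 / 2) (- Q / (2 * (K + 1)))).
  fold e in H1, H2.
  assert (Habs : Rabs e = e) by (apply Rabs_pos_eq; lra).
  destruct (Hexp e ltac:(lra)) as [_ Hbd]. specialize (Hmin e ltac:(lra)).
  rewrite Habs in Hbd. apply Rabs_le_between in Hbd.
  assert (HeK : e * (K + 1) <= - Q / 2).
  { apply Rle_trans with (- Q / (2 * (K + 1)) * (K + 1)); [apply Rmult_le_compat_r; lra | right; field; lra]. }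
  assert (He2 : 0 < e ^ 2) by (apply pow_lt; exact He).
  assert (K * e ^ 3 < e ^ 2 * - Q); [|lra].
  replace (K * e ^ 3) with (e ^ 2 * (K * e)) by ring.
  apply Rmult_lt_compat_l; trivial. nra.
Qed.

Theorem theorem6p7 :
  forall R0 RT : R, 0 < R0 -> 0 < RT -> R0 <> RT ->
    (forall T : R, / 3 * sqrt 3 * T_MCF R0 RT <= T ->
       forall r0 : R -> R, optimal_spherical_trajectory R0 RT T r0 ->
         local_minimizer T r0) /\
    (exists T1 : R, 0 < T1 <= / 3 * sqrt 3 * T_MCF R0 RT /\
       forall T : R, 0 < T < T1 ->
       forall r0 : R -> R, optimal_spherical_trajectory R0 RT T r0 ->
         ~ local_minimizer T r0).
Proof.
  intros R0 RT HR0 HRT Hne.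
  set (D := RT ^ 2 - R0 ^ 2).
  assert (HD : D <> 0).
  { unfold D. intros H. apply Hne. assert (H' : (RT - R0) * (RT + R0) = 0) by lra.
    apply Rmult_integral in H'. lra. }
  assert (HDa : 0 < Rabs D) by (apply Rabs_pos_lt, HD).
  assert (Hs : 0 < sqrt 3) by (apply sqrt_lt_R0; lra).
  assert (Hss : sqrt 3 * sqrt 3 = 3) by (apply sqrt_sqrt; lra).
  set (thr := / 3 * sqrt 3 * T_MCF R0 RT).
  assert (Hthr : thr = / 12 * sqrt 3 * Rabs D).
  { unfold thr, T_MCF, D. rewrite <- Rabs_Ropp. replace (- (R0 ^ 2 - RT ^ 2)) with (RT ^ 2 - R0 ^ 2) by ring. field. }
  assert (Hthr0 : 0 < thr) by (rewrite Hthr; nra).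
  split.
  - intros T HTthr r0 Hopt.
    assert (HT : 0 < T) by lra.
    apply (local_minimizer_of_slope R0 RT); trivial.
    unfold opt_slope. fold D.
    replace ((D / T) ^ 2) with (D ^ 2 / T ^ 2) by (field; lra).
    apply Rmult_le_reg_r with (T ^ 2); [apply pow_lt, HT|].
    replace (D ^ 2 / T ^ 2 * T ^ 2) with (D ^ 2) by (field; lra).
    rewrite <- pow2_abs.
    (* The threshold is the time at which the slope satisfies [c^2 = 48]. *)
    assert (H48 : thr ^ 2 * 48 = Rabs D ^ 2).
    { rewrite Hthr. replace ((/ 12 * sqrt 3 * Rabs D) ^ 2 * 48) with ((sqrt 3 * sqrt 3) / 3 * Rabs D ^ 2) by field.
      rewrite Hss. field. }
    rewrite <- H48. assert (thr ^ 2 <= T ^ 2) by (apply pow_incr; lra). lra.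
  - set (M := Rmax (R0 ^ 2) (RT ^ 2)).
    assert (HM : 0 < M).
    { apply Rlt_le_trans with (R0 ^ 2); [apply pow_lt, HR0 | apply Rmax_l]. }
    assert (HD2 : 0 < D ^ 2) by (rewrite <- pow2_abs; apply pow_lt, HDa).
    destruct (nfloor_ex (8 * (10 * M ^ 2 + 1) / D ^ 2)) as [n0 [_ Hn0]].
    { apply Rmult_le_pos; [assert (H := pow2_ge_0 M); lra | left; apply Rinv_0_lt_compat, HD2]. }
    (* One unit compensates the rounding; the other two absorb [D^2 / 4 * y0], which is twice
       [D^2 / 8 * y0]. *)
    set (n := (n0 + 3)%nat).
    assert (Hn : 8 * (10 * M ^ 2 + 1) / D ^ 2 < INR n - 2).
    { unfold n. rewrite plus_INR. simpl (INR 3). lra. }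
    assert (HnD : 10 * M ^ 2 + 1 < D ^ 2 * (INR n - 2) / 8).
    { apply (Rmult_lt_compat_l (D ^ 2)) in Hn; trivial.
      replace (D ^ 2 * (8 * (10 * M ^ 2 + 1) / D ^ 2)) with (8 * (10 * M ^ 2 + 1)) in Hn by (field; lra). lra. }
    set (y0 := sint (fun th ps => zon n th ps ^ 2)).
    set (y2 := sint (fun th ps => (zon_A n th ps + zon_D n th ps) ^ 2)).
    assert (Hy0 : 0 < y0).
    { unfold y0. rewrite zon_mass. assert (HPI := PI_RGT_0). assert (Hp := pos_INR n).
      apply Rdiv_lt_0_compat; lra. }
    assert (Hy2 : 0 <= y2).
    { destruct (zon_sph_fun n) as [_ _ _ cA cD _ _ _ _ _ _].
      unfold y2. rewrite <- (Rmult_0_r (4 * PI)), <- sint_const. apply sint_le; try (intros q; cont).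
      intros; apply pow2_ge_0. }
    assert (Hy1 := zon_gradient n ltac:(unfold n; lia)). fold y0 in Hy1.
    set (y1 := sint (fun th ps => zon_p n th ps ^ 2 + zon_k n th ps ^ 2)) in Hy1.
    (* For [T < 1] and [T < b] the Laplacian term satisfies [T^2 y2 <= y0]; this is the 1 in
       [10 M^2 + 1]. *)
    set (b := y0 / (y2 + 1)).
    assert (Hb : 0 < b) by (apply Rdiv_lt_0_compat; lra).
    exists (Rmin thr (Rmin 1 b)).
    split; [split; [repeat apply Rmin_pos; lra | apply Rmin_l]|].
    intros T [HT HT1] r0 Hopt.
    assert (HTb : T < 1 /\ T < b).
    { assert (E1 := Rmin_r thr (Rmin 1 b)). assert (E2 := Rmin_l 1 b). assert (E3 := Rmin_r 1 b). lra. }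
    assert (HTy : T ^ 2 * y2 <= y0).
    { assert (Hby : b * (y2 + 1) = y0) by (unfold b; field; lra).
      rewrite <- Hby. simpl. rewrite Rmult_1_r. assert (0 <= T * y2) by nra. nra. }
    (* Since [c^2 T^2 = D^2], multiplying the energy by [T^2] leaves at most
       [y0 (1 - D^2 (n - 2) / 8)], and the choice of [n] depends on the radii alone. The bound
       [10 M^2] is what the kinetic term costs, from the ratio of [T^3 / 3] to [T^5 / 30]. *)
    assert (HE : T ^ 2 * zon_energy n (opt_slope R0 RT T) < - (10 * M ^ 2 * y0)).
    { unfold zon_energy. fold y0 y1 y2.
      assert (Hc : opt_slope R0 RT T ^ 2 * T ^ 2 = D ^ 2) by (unfold opt_slope; fold D; field; lra).
      set (c := opt_slope R0 RT T) in *.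
      replace (T ^ 2 * (c ^ 2 / 4 * y0 + y2 - (2 + c ^ 2 / 8) * y1)) with
        ((c ^ 2 * T ^ 2) / 4 * y0 + T ^ 2 * y2 - (2 * T ^ 2 + (c ^ 2 * T ^ 2) / 8) * y1) by field.
      rewrite Hc.
      assert (Hy1' : 0 <= y1) by (assert (Hp := pos_INR n); nra).
      assert (HT2 : 0 < T ^ 2) by (apply pow_lt, HT).
      assert (G1 : D ^ 2 / 8 * (INR n * y0) <= D ^ 2 / 8 * y1) by (apply Rmult_le_compat_l; lra).
      assert (G2 : (10 * M ^ 2 + 1) * y0 < D ^ 2 * (INR n - 2) / 8 * y0) by (apply Rmult_lt_compat_r; lra).
      assert (G3 : 0 <= 2 * T ^ 2 * y1) by (apply Rmult_le_pos; lra).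
      lra. }
    assert (HT2 : 0 < T ^ 2) by (apply pow_lt, HT).
    assert (HM2 : 0 < M ^ 2) by (apply pow_lt, HM).
    apply (not_local_minimizer R0 RT T r0 n); trivial; fold M.
    + assert (0 < 10 * M ^ 2 * y0) by (apply Rmult_lt_0_compat; lra).
      apply Rnot_lt_le. intros Hp. assert (0 < T ^ 2 * zon_energy n (opt_slope R0 RT T)) by (apply Rmult_lt_0_compat; trivial).
      lra.
    + fold y0. set (E := zon_energy n (opt_slope R0 RT T)) in *.
      replace (M * y0 * (T ^ 3 / 3) + E / M * (T ^ 5 / 30)) with (T ^ 3 / (30 * M) * (10 * M ^ 2 * y0 + T ^ 2 * E))
        by (field; lra).
      assert (0 < T ^ 3 / (30 * M)) by (apply Rdiv_lt_0_compat; [apply pow_lt, HT | lra]).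
      assert (10 * M ^ 2 * y0 + T ^ 2 * E < 0) by lra. nra.
Qed.
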